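(* The Intersection Non-emptiness problem for DFAs or NFAs accepting languages from $\mathsf{DD}_1$ or from $\mathsf{ST}_2$ is $\mathsf{PSPACE}$-complete, even for binary input alphabets.
   Context: Fix a finite alphabet $\Sigma$. A marked product of $L_0,\dots,L_k$ is $L_0a_1L_1\cdots a_kL_k$ with $a_i\in\Sigma$; the polynomial closure of a class is the set of finite unions of marked products of its languages. The concatenation hierarchy with basis $\mathcal{C}$: level $0$ is $\mathcal{C}$, level $n+1/2$ is the polynomial closure of level $n$, level $n+1$ is the Boolean closure of level $n+1/2$. $\mathsf{ST}_n$ (Straubing–Thérien) has basis $\{\emptyset,\Sigma^*\}$; $\mathsf{DD}_n$ (dot-depth) has basis the finite and cofinite languages. In particular $\mathsf{DD}_1$ consists of the finite Boolean combinations of languages $u_0\Sigma^*u_1\Sigma^*\cdots\Sigma^*u_k$ with $u_i\in\Sigma^*$. The Intersection Non-emptiness problem for NFAs (resp. DFAs) accepting languages from $\mathcal{C}$: given NFAs (resp. DFAs) $A_1,\dots,A_m$ over a common alphabet $\Sigma$, promised that each $L(A_i)\in\mathcal{C}$, decide whether $\bigcap_i L(A_i)\neq\emptyset$. Completeness is w.r.t. deterministic logspace many-one reductions. *)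

(* Defs.v *)
From mathcomp Require Import all_boot.
From Stdlib Require List.

Set Implicit Arguments.
Unset Strict Implicit.
Unset Printing Implicit Defensive.

Definition lang (Sigma : Type) := seq Sigma -> Prop.
Definition lclass (Sigma : Type) := lang Sigma -> Prop.

Definition mark_concat (Sigma : Type) (L : lang Sigma) (a : Sigma) (L' : lang Sigma)
  : lang Sigma := fun w => exists u v, w = u ++ a :: v /\ L u /\ L' v.

Inductive marked_product (Sigma : Type) (C : lclass Sigma) : lang Sigma -> Prop :=
| mp_base L : C L -> marked_product C L
| mp_step L a L' : marked_product C L -> C L' ->
    marked_product C (mark_concat L a L').

Inductive PolCl (Sigma : Type) (C : lclass Sigma) : lang Sigma -> Prop :=
| pol_empty L : (forall w, ~ L w) -> PolCl C L
| pol_union M L N : marked_product C M -> PolCl C L ->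
    (forall w, N w <-> (M w \/ L w)) -> PolCl C N.

Inductive BoolCl (Sigma : Type) (C : lclass Sigma) : lang Sigma -> Prop :=
| bc_base L : C L -> BoolCl C L
| bc_compl L M : BoolCl C L -> (forall w, M w <-> ~ L w) -> BoolCl C M
| bc_union L1 L2 M : BoolCl C L1 -> BoolCl C L2 ->
    (forall w, M w <-> (L1 w \/ L2 w)) -> BoolCl C M.

(* level n (integer levels) of the hierarchy with basis C0;
   level n + 1/2 is PolCl (hier C0 n). *)
Fixpoint hier (Sigma : Type) (C0 : lclass Sigma) (n : nat) : lclass Sigma :=
  match n with
  | 0 => C0
  | m.+1 => BoolCl (PolCl (hier C0 m))
  end.

Definition ST_basis (Sigma : Type) : lclass Sigma :=
  fun L => (forall w, ~ L w) \/ (forall w, L w).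

Definition DD_basis (Sigma : Type) : lclass Sigma :=
  fun L => (exists s : seq (seq Sigma), forall w, L w <-> List.In w s)
        \/ (exists s : seq (seq Sigma), forall w, L w <-> ~ List.In w s).

Definition ST (n : nat) (Sigma : Type) : lclass Sigma := hier (@ST_basis Sigma) n.
Definition DD (n : nat) (Sigma : Type) : lclass Sigma := hier (@DD_basis Sigma) n.

Record nfa := NFA {
  n_states : nat;
  n_init : seq nat;
  n_final : seq nat;
  n_trans : seq (nat * nat * nat)   (* ((source, letter), target) *)
}.

Definition nfa_wf (k : nat) (A : nfa) : bool :=
  [&& all (fun q => q < n_states A) (n_init A),
      all (fun q => q < n_states A) (n_final A) &
      all (fun t => [&& t.1.1 < n_states A, t.1.2 < k & t.2 < n_states A])
          (n_trans A)].

Definition is_dfa (k : nat) (A : nfa) : bool :=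
  [&& nfa_wf k A, size (n_init A) == 1 &
      all (fun q => all (fun a =>
          count (fun t => (t.1.1 == q) && (t.1.2 == a)) (n_trans A) == 1)
        (iota 0 k)) (iota 0 (n_states A))].

Definition nfa_step (A : nfa) (S : seq nat) (a : nat) : seq nat :=
  [seq t.2 | t <- n_trans A & (t.1.1 \in S) && (t.1.2 == a)].

Definition nfa_accepts (A : nfa) (w : seq nat) : bool :=
  has (fun q => q \in n_final A) (foldl (nfa_step A) (n_init A) w).

Definition nfa_lang (k : nat) (A : nfa) : lang 'I_k :=
  fun w => nfa_accepts A (map (@nat_of_ord k) w).

Record instance := Inst { i_alpha : nat; i_auts : seq nfa }.

Fixpoint nbits_aux (fuel n : nat) : seq bool :=
  match fuel with
  | 0 => [::]
  | f.+1 => if n is 0 then [::] else odd n :: nbits_aux f n./2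
  end.
Definition nbits (n : nat) : seq bool := nbits_aux n n.

Definition enc_nat (n : nat) : seq bool :=
  flatten [seq [:: false; b] | b <- nbits n] ++ [:: true; false].
Definition enc_seq (T : Type) (f : T -> seq bool) (s : seq T) : seq bool :=
  flatten (map f s) ++ [:: true; true].
Definition enc_trans (t : nat * nat * nat) : seq bool :=
  enc_nat t.1.1 ++ enc_nat t.1.2 ++ enc_nat t.2.
Definition enc_nfa (A : nfa) : seq bool :=
  enc_nat (n_states A) ++ enc_seq enc_nat (n_init A) ++
  enc_seq enc_nat (n_final A) ++ enc_seq enc_trans (n_trans A).
Definition enc_inst (I : instance) : seq bool :=
  enc_nat (i_alpha I) ++ enc_seq enc_nfa (i_auts I).

Definition promise_problem := ((seq bool -> Prop) * (seq bool -> Prop))%type.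

Definition inst_ok (det bin : bool) (C : forall Sigma : Type, lclass Sigma)
    (I : instance) : Prop :=
  (bin -> i_alpha I = 2) /\
  List.Forall (fun A =>
      (if det then @is_dfa (i_alpha I) A else @nfa_wf (i_alpha I) A) /\
      C 'I_(i_alpha I) (@nfa_lang (i_alpha I) A)) (i_auts I).

Definition inter_nonempty (I : instance) : Prop :=
  exists w : seq 'I_(i_alpha I),
    List.Forall (fun A => @nfa_lang (i_alpha I) A w) (i_auts I).

Definition INE (det bin : bool) (C : forall Sigma : Type, lclass Sigma)
  : promise_problem :=
  (fun w => exists I, w = enc_inst I /\ inst_ok det bin C I /\ inter_nonempty I,
   fun w => exists I, w = enc_inst I /\ inst_ok det bin C I /\ ~ inter_nonempty I).

(* 5. Turing machines: read-only two-way input tape with endmarkers,      *)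
(*    one work tape, write-only output tape.                              *)

Unset Implicit Arguments.

Inductive move := MoveL | MoveS | MoveR.
Definition mv (m : move) (p : nat) : nat :=
  match m with MoveL => p.-1 | MoveS => p | MoveR => p.+1 end.

Record TM := mkTM {
  tm_Q : finType;
  tm_G : finType;
  tm_blank : tm_G;
  tm_q0 : tm_Q;
  tm_halt : pred tm_Q;
  tm_acc : pred tm_Q;
  (* state, input symbol (None = endmarker), work symbol ->
     new state, written work symbol, input move, work move, output symbol *)
  tm_delta : tm_Q -> option bool -> tm_G -> tm_Q * tm_G * move * move * option bool
}.

Record config (M : TM) := Cfg {
  c_q : tm_Q M;
  c_ipos : nat;             (* 0 and size w + 1 are the endmarkers *)
  c_tape : nat -> tm_G M;
  c_wpos : nat;
  c_out : seq bool
}.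

Definition read_input (w : seq bool) (i : nat) : option bool :=
  if i is j.+1 then (if j < size w then Some (nth false w j) else None) else None.

Definition tm_init (M : TM) : config M :=
  Cfg M (tm_q0 M) 0 (fun _ => tm_blank M) 0 [::].

Definition tm_step (M : TM) (w : seq bool) (c : config M) : config M :=
  if tm_halt M (c_q M c) then c else
  let: (q', g, mi, mw, o) :=
     tm_delta M (c_q M c) (read_input w (c_ipos M c)) (c_tape M c (c_wpos M c)) in
  Cfg M q' (minn (mv mi (c_ipos M c)) (size w).+1)
      (fun j => if j == c_wpos M c then g else c_tape M c j)
      (mv mw (c_wpos M c))
      (c_out M c ++ (if o is Some b then [:: b] else [::])).

Definition tm_run (M : TM) (w : seq bool) (t : nat) : config M :=
  iter t (tm_step M w) (tm_init M).

Definition tm_halts (M : TM) (w : seq bool) : Prop :=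
  exists t, tm_halt M (c_q M (tm_run M w t)).
Definition tm_accepts (M : TM) (w : seq bool) : Prop :=
  exists t, tm_halt M (c_q M (tm_run M w t)) && tm_acc M (c_q M (tm_run M w t)).
Definition tm_rejects (M : TM) (w : seq bool) : Prop :=
  exists t, tm_halt M (c_q M (tm_run M w t)) && ~~ tm_acc M (c_q M (tm_run M w t)).

Definition space_bounded (M : TM) (s : nat -> nat) : Prop :=
  forall w t, c_wpos M (tm_run M w t) < s (size w).

Definition decides_promise (M : TM) (P : promise_problem) : Prop :=
  forall w, tm_halts M w /\ (P.1 w -> tm_accepts M w) /\ (P.2 w -> tm_rejects M w).

Definition in_PSPACE (P : promise_problem) : Prop :=
  exists (M : TM) (c : nat),
    space_bounded M (fun n => c * n ^ c + c) /\ decides_promise M P.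

Definition lang_problem (L : seq bool -> Prop) : promise_problem :=
  (L, fun w => ~ L w).

Definition logspace_computable (f : seq bool -> seq bool) : Prop :=
  exists (M : TM) (c : nat),
    space_bounded M (fun n => c * (trunc_log 2 n).+1) /\
    forall w, exists t, tm_halt M (c_q M (tm_run M w t)) /\ c_out M (tm_run M w t) = f w.

Definition logspace_reduces (L : seq bool -> Prop) (P : promise_problem) : Prop :=
  exists f, logspace_computable f /\
    forall w, (L w -> P.1 (f w)) /\ (~ L w -> P.2 (f w)).

Definition PSPACE_hard (P : promise_problem) : Prop :=
  forall L : seq bool -> Prop, in_PSPACE (lang_problem L) -> logspace_reduces L P.

Definition PSPACE_complete (P : promise_problem) : Prop :=
  in_PSPACE P /\ PSPACE_hard P.

(* Main.v *)
(* Turing machines are only programmed once, as simulators of counter programs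
   whose registers are kept in binary on the tracks of the work tape, in space
   logarithmic in the largest value.  Such programs compute all functions built
   by recursions whose values remain polynomial in the arguments; hence these
   are computed in logarithmic space, and in polynomial space on arguments below
   2 ^ poly(n).

   Membership: the automata are run in parallel, a tuple of states being written
   as a number below 2 ^ (n * n).  Reachability is decided by Savitch's recursion,
   seen as a game whose plays are numbered in a large base; the game is evaluated
   by going through the numbers with short cuts, so that the number of the current
   play is the only memory.

   Hardness: the computation of a space-bounded machine is a word made of blocks
   11 0 x_1 0 x_2 ... of one-hot bits, and it is correct iff every pair of
   consecutive blocks satisfies polynomially many clauses, one small automaton for
   each.  The marker 11 cannot be shifted, so such an automaton either dies or has
   a state determined by the last letters; the words it accepts are characterized
   by their prefix, suffix and factors of a fixed length, which puts the language
   in DD_1, hence in ST_2. *)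
Require Import Defs.
From mathcomp Require Import all_boot zify.
From Stdlib Require Import FunctionalExtensionality.

Set Implicit Arguments.
Unset Strict Implicit.
Unset Printing Implicit Defensive.

(** * Counter programs on Turing machines *)

(** The obstacle to hardness is that reading blocks means counting letters modulo the block length,
    and in general such counting leaves every level of both hierarchies. The zeros between the
    payload bits make [110] impossible except at a block boundary, so the count can be recovered
    from a bounded factor. Conditions are put in negative form: a window of two consecutive blocks
    must not meet a list of demands. Then two flags suffice, and both are renewed at every boundary.
    The obstacle to membership is the machine model: the machine has to halt within the space bound
    on every string, encoding or not. The automata built are deterministic and their languages lie
    in [DD 1], so one reduction serves all variants. *)

Definition upd (rg : nat -> nat) (r v : nat) : nat -> nat :=
  fun i => if i == r then v else rg i.

Inductive cmd :=
| CSkip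
| CInc of nat
| CMov of bool
| CEmit of bool
| CSeq of cmd & cmd
| CLoop of nat & cmd
| CIf of nat & cmd & cmd
| CIfIn of cmd & cmd & cmd
| CWhileIn of cmd.

Record store := Store { st_rg : nat -> nat; st_ip : nat; st_out : seq bool }.

Section Exec.
Variables (w : seq bool) (V : nat).

Definition move_in (b : bool) (i : nat) :=
  minn (mv (if b then MoveR else MoveL) i) (size w).+1.

(** Big-step semantics in which an increment past [V] has no derivation: a derivation is at once a
    proof of termination and of a space bound. [CLoop r c] decrements [r] before each turn, so it
    consumes its counter. *)
Inductive exec : cmd -> store -> store -> Prop :=
| ex_skip s : exec CSkip s s
| ex_inc r rg i o : (rg r).+1 <= V ->
    exec (CInc r) (Store rg i o) (Store (upd rg r (rg r).+1) i o)
| ex_mov b rg i o : exec (CMov b) (Store rg i o) (Store rg (move_in b i) o)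
| ex_emit b rg i o : exec (CEmit b) (Store rg i o) (Store rg i (o ++ [:: b]))
| ex_seq c1 c2 s1 s2 s3 : exec c1 s1 s2 -> exec c2 s2 s3 -> exec (CSeq c1 c2) s1 s3
| ex_loop0 r c s : st_rg s r = 0 -> exec (CLoop r c) s s
| ex_loopS r c rg i o v s1 s2 : rg r = v.+1 ->
    exec c (Store (upd rg r v) i o) s1 -> exec (CLoop r c) s1 s2 ->
    exec (CLoop r c) (Store rg i o) s2
| ex_if r c1 c2 s s' : exec (if st_rg s r == 0 then c1 else c2) s s' ->
    exec (CIf r c1 c2) s s'
| ex_ifin cN c0 c1 s s' :
    exec (match read_input w (st_ip s) with
          | None => cN | Some false => c0 | Some true => c1 end) s s' ->
    exec (CIfIn cN c0 c1) s s'
| ex_whilein0 c s : read_input w (st_ip s) = None -> exec (CWhileIn c) s s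
| ex_whileinS c s1 s2 s3 : read_input w (st_ip s1) <> None ->
    exec c s1 s2 -> exec (CWhileIn c) s2 s3 -> exec (CWhileIn c) s1 s3.
End Exec.

Inductive instr :=
| IInc of nat & nat
| IDec of nat & nat
| IJz of nat & nat & nat
| IMov of bool & nat
| IEmit of bool & nat
| IRd of nat & nat & nat
| IHalt of bool.

Fixpoint clen (c : cmd) : nat :=
  match c with
  | CSkip => 1
  | CInc _ | CMov _ | CEmit _ => 1
  | CSeq a b => clen a + clen b
  | CLoop _ a => (clen a).+2
  | CIf _ a b => (clen a + clen b).+1
  | CIfIn a b d => (clen a + clen b + clen d).+1
  | CWhileIn a => (clen a).+1
  end.

(* The code occupies the addresses [s, s + clen c) and leaves to address [k]. *)
Fixpoint ccomp (c : cmd) (s k : nat) : seq instr :=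
  match c with
  | CSkip => [:: IRd k k k]
  | CInc r => [:: IInc r k]
  | CMov b => [:: IMov b k]
  | CEmit b => [:: IEmit b k]
  | CSeq a b => ccomp a s (s + clen a) ++ ccomp b (s + clen a) k
  | CLoop r a => [:: IJz r k s.+1, IDec r s.+2 & ccomp a s.+2 s]
  | CIf r a b => IJz r s.+1 (s.+1 + clen a)
      :: ccomp a s.+1 k ++ ccomp b (s.+1 + clen a) k
  | CIfIn a b d => IRd s.+1 (s.+1 + clen a) (s.+1 + clen a + clen b)
      :: ccomp a s.+1 k ++ ccomp b (s.+1 + clen a) k
         ++ ccomp d (s.+1 + clen a + clen b) k
  | CWhileIn a => IRd k s.+1 s.+1 :: ccomp a s.+1 s
  end.

Lemma size_ccomp c s k : size (ccomp c s k) = clen c.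
Proof.
elim: c s k => //= [a IHa b IHb|r a IHa|r a IHa b IHb|a IHa b IHb d IHd|a IHa] s k;
  by rewrite ?size_cat ?IHa ?IHb ?IHd ?addnA.
Qed.

Definition regs_of (i : instr) : seq nat :=
  match i with IInc r _ | IDec r _ | IJz r _ _ => [:: r] | _ => [::] end.

Fixpoint maxreg (c : cmd) : nat :=
  match c with
  | CSkip | CMov _ | CEmit _ => 0
  | CInc r => r
  | CSeq a b => maxn (maxreg a) (maxreg b)
  | CLoop r a => maxn r (maxreg a)
  | CIf r a b => maxn r (maxn (maxreg a) (maxreg b))
  | CIfIn a b d => maxn (maxreg a) (maxn (maxreg b) (maxreg d))
  | CWhileIn a => maxreg a
  end.

Lemma ccomp_regs c s k m : maxreg c <= m ->
  all (fun i => all (fun t => t <= m) (regs_of i)) (ccomp c s k).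
Proof.
elim: c s k => //= [r|a IHa b IHb|r a IHa|r a IHa b IHb|a IHa b IHb d IHd|a IHa] s k;
  rewrite ?geq_max ?all_cat.
- by move=> ->.
- by case/andP=> Ha Hb; rewrite IHa ?IHb.
- by case/andP=> Hr Ha; rewrite IHa // Hr.
- by case/and3P=> Hr Ha Hb; rewrite IHa ?IHb // Hr.
- by case/and3P=> Ha Hb Hd; rewrite IHa ?IHb ?IHd.
- by move=> Ha; rewrite IHa.
Qed.

Fixpoint num (bs : seq bool) : nat := if bs is b :: s then b + (num s).*2 else 0.

Lemma num_lt bs : num bs < 2 ^ size bs.
Proof. by elim: bs => [|b s IH] //=; rewrite expnS; case: b; lia. Qed.

(* A register is a column of the work tape, least significant bit in cell 1.
   A register instruction is one sweep to the first blank, performed by a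
   finite transducer with a one-bit carry, and a return to the mark. *)
Section Machine.
Variables (code : seq instr) (K' : nat).
Let K := K'.+1.
Let m := size code.
Let fetch pc := nth (IHalt false) code pc.

Definition bits := {ffun 'I_K -> bool}.
(* [None] is the blank, [Some None] the mark written on cell [0]. *)
Definition cell : finType := option (option bits).
Definition phase : finType := option (bool * bool).
Definition cmark : cell := Some None.
Definition cbits (f : bits) : cell := Some (Some f).

Definition setb (f : bits) (r : nat) (b : bool) : bits :=
  [ffun i : 'I_K => if val i == r then b else f i].
Definition nob : bits := [ffun _ => false].

(** The flag is the carry of an increment, the borrow of a decrement, and for a zero test the
    disjunction of the bits seen so far. *)
Definition sweep1 (i : instr) (fl : bool) (f : bits) : bits * bool :=
  match i with
  | IInc r _ => (setb f r (f (inord r) (+) fl), fl && f (inord r))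
  | IDec r _ => (setb f r (f (inord r) (+) fl), fl && ~~ f (inord r))
  | IJz r _ _ => (f, fl || f (inord r))
  | _ => (f, fl)
  end.

(** A carry that survives the sweep opens a new column, zero in all other registers. *)
Definition sweep_end (i : instr) (fl : bool) : seq bits :=
  match i with
  | IInc r _ => if fl then [:: setb nob r true] else [::]
  | _ => [::]
  end.

Definition sweep_next (i : instr) (fl : bool) : nat :=
  match i with
  | IInc _ k | IDec _ k => k
  | IJz _ kz knz => if fl then knz else kz
  | _ => 0
  end.

Definition mst : finType := ('I_m.+1 * phase)%type.

(** Phase [None] fetches an instruction with the head on cell [0]; [Some (true, fl)] is the sweep to
    the right, [Some (false, fl)] the return to the mark. *)
Definition mdelta (q : mst) (a : option bool) (g : cell)
  : mst * cell * move * move * option bool :=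
  let: (pc, ph) := q in
  let go k : mst := (inord k, None) in
  match ph with
  | None =>
    match fetch pc with
    | IInc _ _ | IDec _ _ => ((pc, Some (true, true)), cmark, MoveS, MoveR, None)
    | IJz _ _ _ => ((pc, Some (true, false)), cmark, MoveS, MoveR, None)
    | IMov b k => (go k, g, if b then MoveR else MoveL, MoveS, None)
    | IEmit b k => (go k, g, MoveS, MoveS, Some b)
    | IRd kN k0 k1 =>
        (go (match a with None => kN | Some false => k0 | Some true => k1 end),
         g, MoveS, MoveS, None)
    | IHalt _ => (q, g, MoveS, MoveS, None)
    end
  | Some (true, fl) =>
    match g with
    | Some (Some f) => let: (f', fl') := sweep1 (fetch pc) fl f in
        ((pc, Some (true, fl')), cbits f', MoveS, MoveR, None)
    | _ => ((pc, Some (false, fl)),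
            (if sweep_end (fetch pc) fl is f :: _ then cbits f else None),
            MoveS, MoveL, None)
    end
  | Some (false, fl) =>
    match g with
    | Some None => (go (sweep_next (fetch pc) fl), cmark, MoveS, MoveS, None)
    | _ => ((pc, Some (false, fl)), g, MoveS, MoveL, None)
    end
  end.

Definition mhalt (q : mst) : bool :=
  if q.2 is None then (if fetch q.1 is IHalt _ then true else false) else false.
Definition macc (q : mst) : bool := if fetch q.1 is IHalt b then b else false.

Definition machine : TM :=
  @mkTM mst cell None ((ord0, None) : mst) mhalt macc mdelta.

Variable w : seq bool.

Definition steps (B : nat) (c c' : config machine) : Prop :=
  exists T, iter T (tm_step machine w) c = c' /\
    forall t, t <= T -> c_wpos machine (iter t (tm_step machine w) c) < B.

Lemma steps_refl B c : c_wpos machine c < B -> steps B c c.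
Proof. by move=> H; exists 0; split=> // t; rewrite leqn0 => /eqP ->. Qed.

Lemma steps_trans B c1 c2 c3 : steps B c1 c2 -> steps B c2 c3 -> steps B c1 c3.
Proof.
move=> [T1 [E1 H1]] [T2 [E2 H2]]; exists (T2 + T1); split.
  by rewrite iterD E1.
move=> t Ht; case: (leqP t T1) => [/H1 //|Hlt].
have -> : t = (t - T1) + T1 by lia.
by rewrite iterD E1; apply: H2; lia.
Qed.

Lemma steps_step B c c' c'' : c_wpos machine c < B -> tm_step machine w c = c' ->
  steps B c' c'' -> steps B c c''.
Proof.
move=> HB E [T [HT HH]]; exists T.+1; split; first by rewrite iterSr E.
by case=> [//|t] Ht; rewrite iterSr E; apply: HH.
Qed.

Definition tapeof (bs : seq bits) (T : nat -> cell) : Prop :=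
  forall j, T j.+1 = if j < size bs then cbits (nth nob bs j) else None.

Fixpoint sweep (i : instr) (fl : bool) (bs : seq bits) : seq bits * bool :=
  if bs is f :: s then
    let: (f', fl') := sweep1 i fl f in
    let: (s', fl'') := sweep i fl' s in (f' :: s', fl'')
  else ([::], fl).

Lemma size_sweep i fl bs : size (sweep i fl bs).1 = size bs.
Proof.
elim: bs fl => //= f s IH fl.
by case: (sweep1 i fl f) => f' fl' /=; case E: (sweep i fl' s) => /=; rewrite -(IH fl') E.
Qed.

Lemma right_sweep B (pc : 'I_m.+1) fl dn bs T ip (o : seq bool) : ip <= (size w).+1 ->
  size dn + size bs + 1 < B -> tapeof (dn ++ bs) T -> T 0 = cmark ->
  exists T', [/\ tapeof (dn ++ (sweep (fetch pc) fl bs).1) T', T' 0 = cmark &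
    steps B (Cfg machine (pc, Some (true, fl)) ip T (size dn).+1 o)
      (Cfg machine (pc, Some (true, (sweep (fetch pc) fl bs).2)) ip
         T' (size dn + size bs).+1 o)].
Proof.
move=> Hip; elim: bs dn fl T => [|f s IH] dn fl T HB HT H0.
  exists T; split=> //=; rewrite addn0; apply: steps_refl => /=; move: HB => /=; lia.
have HTd : T (size dn).+1 = cbits f.
  by rewrite HT size_cat /= ifT ?nth_cat ?ltnn ?subnn //; lia.
case E: (sweep1 (fetch pc) fl f) => [f' fl'].
pose T1 j := if j == (size dn).+1 then cbits f' else T j.
have HT1 : tapeof (rcons dn f' ++ s) T1.
  move=> j; rewrite /T1 eqSS cat_rcons size_cat /= nth_cat.
  case: eqP => [->|Hj]; first by rewrite ltnn subnn /= ifT //; lia.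
  rewrite HT size_cat /= nth_cat; case: ifP => // _; case: ifP => // H1.
  by have -> : j - size dn = (j - size dn).-1.+1 by lia.
case: (IH (rcons dn f') fl' T1) => //; first by move: HB; rewrite size_rcons /=; lia.
move=> T' [HT' H0' HS]; exists T'.
have Esw : sweep (fetch pc) fl (f :: s) = (f' :: (sweep (fetch pc) fl' s).1, (sweep (fetch pc) fl' s).2).
  by rewrite /= E; case: (sweep _ _ _).
rewrite Esw; split=> //; first by rewrite -cat_rcons.
apply: steps_step; [ | | ].
- by rewrite /=; move: HB => /=; lia.
- rewrite /tm_step /= /mdelta HTd /= E /= cats0 (minn_idPl Hip). reflexivity.
- move: HS; rewrite size_rcons /= addnS; exact.
Qed.

(** The tape is given up to pointwise equality only, since each step wraps it in a conditional that
    writes back the symbol read. *)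
Lemma left_sweep B (pc : 'I_m.+1) fl j T ip (o : seq bool) : ip <= (size w).+1 -> j.+1 < B ->
  T 0 = cmark -> (forall i, i < j -> T i.+1 <> cmark) ->
  exists T', (forall i, T' i = T i) /\
    steps B (Cfg machine (pc, Some (false, fl)) ip T j o)
      (Cfg machine (inord (sweep_next (fetch pc) fl), None) ip T' 0 o).
Proof.
move=> Hip; elim: j T => [|j IH] T HB H0 Hj.
  eexists; split; last first.
    apply: steps_step; [by rewrite /=; lia| |].
    - rewrite /tm_step /= /mdelta H0 /= cats0 (minn_idPl Hip). reflexivity.
    - by apply: steps_refl => /=; lia.
  by move=> i /=; case: eqP => [->|].
pose T1 i := if i == j.+1 then T j.+1 else T i.
have E1 i : T1 i = T i by rewrite /T1; case: eqP => [->|].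
case: (IH T1); rewrite ?E1 //; first lia.
  by move=> i Hi; rewrite E1; apply: Hj; lia.
move=> T' [HT' HS]; exists T'; split; first by move=> i; rewrite HT'.
apply: steps_step HS; first by rewrite /=; lia.
rewrite /tm_step /= /mdelta; move: (Hj j (ltnSn _)); rewrite /T1.
by case: (T j.+1) => [[g|]|] //= _; rewrite cats0 (minn_idPl Hip).
Qed.

Lemma round_trip B (pc : 'I_m.+1) fl bs T T1 ip (o : seq bool) : ip <= (size w).+1 ->
  let i := fetch pc in
  let bs' := (sweep i fl bs).1 ++ sweep_end i (sweep i fl bs).2 in
  (size bs).+2 < B -> tapeof bs T -> (forall j, T1 j = if j == 0 then cmark else T j) ->
  exists T', tapeof bs' T' /\
    steps B (Cfg machine (pc, Some (true, fl)) ip T1 1 o)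
      (Cfg machine (inord (sweep_next i (sweep i fl bs).2), None) ip T' 0 o).
Proof.
move=> Hip i bs' HB HT HT1.
have HT1' : tapeof ([::] ++ bs) T1 by move=> j; rewrite HT1 HT.
case: (right_sweep pc fl (B := B) o Hip _ HT1' (HT1 0)); first by rewrite /=; lia.
rewrite -/i => T2 [HT2 H02 HS2]; move: HT2 => /= HT2.
set fl' := (sweep i fl bs).2 in HS2 *.
set cl : cell := if sweep_end i fl' is f :: _ then cbits f else None.
pose T3 j := if j == (size bs).+1 then cl else T2 j.
have HT3 : tapeof bs' T3.
  move=> j; rewrite /T3 /bs' size_cat size_sweep nth_cat size_sweep eqSS -/fl'.
  have Hs : size (sweep_end i fl') <= 1 by case: (i) => //= *; case: ifP.
  rewrite HT2 size_sweep /cl.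
  case: (sweep_end i fl') Hs => [|f [|]] //= _; case: eqP => [->|Hj];
    rewrite ?addn0 ?ltnn ?addn1 ?ltnSn ?subnn //.
  - by case: ifP.
  - case: (ltngtP j (size bs)) => H //; rewrite ltnS; first by rewrite ltnW.
    by rewrite leqNgt H.
have Hmk k : k < size bs -> T3 k.+1 <> cmark.
  move=> Hj; rewrite /T3 eqSS ifF ?HT2 ?size_sweep ?Hj //; lia.
case: (@left_sweep B pc fl' (size bs) T3 ip o Hip) => //; try lia.
move=> T4 [HT4 HS4]; exists T4; split; first by move=> j; rewrite HT4 HT3.
apply: (steps_trans HS2); apply: steps_step HS4 => /=; first lia.
by rewrite /tm_step /= /mdelta HT2 size_sweep ltnn /= cats0 (minn_idPl Hip).
Qed.

Definition rep (rg : nat -> nat) (bs : seq bits) : Prop :=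
  forall i : 'I_K, rg i = num [seq f i | f : bits <- bs].

Lemma num_cat s t : num (s ++ t) = num s + 2 ^ size s * num t.
Proof. by elim: s => [|b s IH] /=; rewrite ?mul1n // IH expnS; lia. Qed.

Lemma setbE (f : bits) r b (i : 'I_K) : setb f r b i = if val i == r then b else f i.
Proof. by rewrite ffunE. Qed.

Lemma sweep_inc r k fl bs (i : 'I_K) : r <= K' ->
  let: (bs', fl') := sweep (IInc r k) fl bs in
  if val i == r then
    num [seq f i | f : bits <- bs'] + 2 ^ size bs * fl' = num [seq f i | f : bits <- bs] + fl
  else [seq f i | f : bits <- bs'] = [seq f i | f : bits <- bs].
Proof.
move=> Hr; elim: bs fl => [|f s IH] fl /=; first by case: eqP => // _; rewrite mul1n.
move: (IH (fl && f (inord r))); case: (sweep _ _ s) => bs' fl' /=.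
rewrite setbE; case: eqP => [E|_ ->] //.
have -> : (inord r : 'I_K) = i by apply/val_inj; rewrite /= inordK.
rewrite expnS -mulnA; move: (2 ^ _ * _) => p; case: fl; case: (f i) => /=; lia.
Qed.

Lemma sweep_dec r k fl bs (i : 'I_K) : r <= K' ->
  let: (bs', fl') := sweep (IDec r k) fl bs in
  if val i == r then
    num [seq f i | f : bits <- bs'] + fl = num [seq f i | f : bits <- bs] + 2 ^ size bs * fl'
  else [seq f i | f : bits <- bs'] = [seq f i | f : bits <- bs].
Proof.
move=> Hr; elim: bs fl => [|f s IH] fl /=; first by case: eqP => // _; rewrite mul1n.
move: (IH (fl && ~~ f (inord r))); case: (sweep _ _ s) => bs' fl' /=.
rewrite setbE; case: eqP => [E|_ ->] //.
have -> : (inord r : 'I_K) = i by apply/val_inj; rewrite /= inordK.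
rewrite expnS -mulnA; move: (2 ^ _ * _) => p; case: fl; case: (f i) => /=; lia.
Qed.

Lemma sweep_jz r k1 k2 fl bs : sweep (IJz r k1 k2) fl bs =
  (bs, fl || (0 < num [seq f (inord r) | f : bits <- bs])).
Proof.
elim: bs fl => [|f s IH] fl /=; first by rewrite orbF.
rewrite IH -orbA; congr (_, _ || _); case: (f _) => //=.
by rewrite add0n double_gt0.
Qed.

(** * Simulation of counter programs by the machine *)

Section Sim.
Variable V : nat.
Let Lm := (trunc_log 2 V).+1.
Let B := Lm.+3.

Definition sim (k : nat) (s : store) (c : config machine) : Prop :=
  [/\ c = Cfg machine (inord k, None) (st_ip s) (c_tape machine c) 0 (st_out s),
    st_ip s <= (size w).+1 &
    exists bs, [/\ tapeof bs (c_tape machine c), rep (st_rg s) bs & size bs <= Lm]].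

Hypothesis Hrg : all (fun i => all (fun t => t <= K') (regs_of i)) code.

Lemma fetch_inord k : k <= m -> fetch (inord k : 'I_m.+1) = fetch k.
Proof. by move=> H; rewrite inordK. Qed.

Lemma regs_le k r : r \in regs_of (fetch k) -> r <= K'.
Proof.
move=> Hr; case: (ltnP k m) => Hk; last by move: Hr; rewrite /fetch nth_default.
by move/(all_nthP (IHalt false))/(_ k Hk)/allP/(_ r Hr): Hrg.
Qed.

Lemma sim_inc k r k' rg ip o c : k <= m -> fetch k = IInc r k' ->
  (rg r).+1 <= V -> sim k (Store rg ip o) c ->
  exists c', steps B c c' /\ sim k' (Store (upd rg r (rg r).+1) ip o) c'.
Proof.
move=> Hk Ef HV [-> /= Hip [bs [HT Hrep Hsz]]].
have Hr : r <= K' by apply: (@regs_le k); rewrite Ef mem_head.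
set T := c_tape machine c in HT *.
pose pc : 'I_m.+1 := inord k.
pose T1 j := if j == 0 then cmark else T j.
have Efp : fetch pc = IInc r k' by rewrite fetch_inord.
case: (@round_trip B pc true bs T T1 ip o Hip) => //.
rewrite Efp => T' [HT' HS].
exists (Cfg machine (inord k', None) ip T' 0 o); split.
  apply: steps_step HS; first by rewrite /=; lia.
  by rewrite /tm_step /= /mdelta fetch_inord // Ef /= cats0 (minn_idPl Hip) /mhalt /= fetch_inord // Ef.
split=> //; exists ((sweep (IInc r k') true bs).1 ++ sweep_end (IInc r k') (sweep (IInc r k') true bs).2).
have Hinc := sweep_inc k' true bs _ Hr.
have Hsz1 := size_sweep (IInc r k') true bs.
case E: (sweep (IInc r k') true bs) Hinc HT' Hsz1 => [bs' fl'] Hinc HT' /= Hsz1.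
have Er : ((inord r : 'I_K) : nat) = r by rewrite inordK.
have Hcol := Hrep (inord r).
split=> //.
- move=> i /=; move: (Hinc i); rewrite map_cat num_cat size_map Hsz1 /upd.
  case: eqP => [Ei|Ei].
    move=> H; rewrite -Ei (Hrep i) -[_.+1]addn1 -H; case: fl' {HT' Hinc E H} => /=; rewrite ?setbE ?Ei ?eqxx /=; lia.
  move=> ->; rewrite (Hrep i); case: fl' {HT' Hinc E} => //=; last by rewrite muln0 addn0.
  by rewrite setbE ifF ?ffunE ?muln0 ?addn0 //; apply/eqP.
- rewrite size_cat Hsz1; case: fl' HT' Hinc E => /=; last by rewrite addn0.
  move=> _ /(_ (inord r)); rewrite /= Er eqxx -Hcol Er muln1 => H _.
  (* A final carry gives [2 ^ size bs <= (rg r).+1 <= V], so the new column still fits into the [Lm]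
     binary digits of [V]. *)
  rewrite addn1 /Lm ltnS; apply: trunc_log_max => //; lia.
Qed.

Lemma sim_dec k r k' rg ip o c v : k <= m -> fetch k = IDec r k' ->
  rg r = v.+1 -> sim k (Store rg ip o) c ->
  exists c', steps B c c' /\ sim k' (Store (upd rg r v) ip o) c'.
Proof.
move=> Hk Ef HV [-> /= Hip [bs [HT Hrep Hsz]]].
have Hr : r <= K' by apply: (@regs_le k); rewrite Ef mem_head.
set T := c_tape machine c in HT *.
pose pc : 'I_m.+1 := inord k.
pose T1 j := if j == 0 then cmark else T j.
have Efp : fetch pc = IDec r k' by rewrite fetch_inord.
case: (@round_trip B pc true bs T T1 ip o Hip) => //.
rewrite Efp /= cats0 => T' [HT' HS].
exists (Cfg machine (inord k', None) ip T' 0 o); split.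
  apply: steps_step HS; first by rewrite /=; lia.
  by rewrite /tm_step /= /mdelta fetch_inord // Ef /= cats0 (minn_idPl Hip) /mhalt /= fetch_inord // Ef.
split=> //; exists (sweep (IDec r k') true bs).1.
have Hdec := sweep_dec k' true bs _ Hr.
have Hsz1 := size_sweep (IDec r k') true bs.
case E: (sweep (IDec r k') true bs) Hdec HT' Hsz1 => [bs' fl'] Hdec HT' /= Hsz1.
split=> //; last by rewrite Hsz1.
move=> i /=; move: (Hdec i); rewrite /upd; case: eqP => [Ei|_ ->]; last exact: Hrep.
(* The value is positive, so no borrow survives: otherwise [num] of the new column would reach
   [2 ^ size bs]. *)
move: (Hrep i); rewrite Ei HV => <-; have := num_lt [seq f i | f : bits <- bs'].
by rewrite size_map Hsz1; case: fl' {HT' Hdec E}; lia.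
Qed.

Lemma sim_jz k r k1 k2 s c : k <= m -> fetch k = IJz r k1 k2 ->
  sim k s c ->
  exists c', steps B c c' /\ sim (if st_rg s r == 0 then k1 else k2) s c'.
Proof.
move=> Hk Ef [-> /= Hip [bs [HT Hrep Hsz]]].
have Hr : r <= K' by apply: (@regs_le k); rewrite Ef mem_head.
set T := c_tape machine c in HT *.
pose pc : 'I_m.+1 := inord k.
pose T1 j := if j == 0 then cmark else T j.
have Efp : fetch pc = IJz r k1 k2 by rewrite fetch_inord.
case: (@round_trip B pc false bs T T1 (st_ip s) (st_out s) Hip) => //.
rewrite Efp sweep_jz /= cats0 -(Hrep (inord r)) inordK // => T' [HT' HS].
eexists; split.
  apply: steps_step HS; first by rewrite /=; lia.
  by rewrite /tm_step /= /mdelta fetch_inord // Ef /= cats0 (minn_idPl Hip) /mhalt /= fetch_inord // Ef.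
by split=> //=; [case: (st_rg s r)|exists bs].
Qed.

Lemma sim_mov k b k' rg ip o c : k <= m -> fetch k = IMov b k' ->
  sim k (Store rg ip o) c ->
  exists c', steps B c c' /\ sim k' (Store rg (move_in w b ip) o) c'.
Proof.
move=> Hk Ef [-> /= Hip [bs [HT Hrep Hsz]]].
exists (Cfg machine (inord (k'), None) (move_in w b ip)
  (fun j => if j == 0 then c_tape machine c 0 else c_tape machine c j) 0 (o)); split.
  apply: (@steps_step _ _ _ _ _ _ (steps_refl _)) => //.
  by rewrite /tm_step /= /mdelta fetch_inord // Ef /= cats0 /mhalt /= fetch_inord // Ef /move_in; case: (b).
by split=> //=; [rewrite /move_in geq_minr | exists bs].
Qed.

Lemma sim_emit k b k' rg ip o c : k <= m -> fetch k = IEmit b k' ->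
  sim k (Store rg ip o) c ->
  exists c', steps B c c' /\ sim k' (Store rg ip (o ++ [:: b])) c'.
Proof.
move=> Hk Ef [-> /= Hip [bs [HT Hrep Hsz]]].
exists (Cfg machine (inord (k'), None) (ip)
  (fun j => if j == 0 then c_tape machine c 0 else c_tape machine c j) 0 (o ++ [:: b])); split.
  apply: (@steps_step _ _ _ _ _ _ (steps_refl _)) => //.
  by rewrite /tm_step /= /mdelta fetch_inord // Ef /= (minn_idPl Hip) /mhalt /= fetch_inord // Ef.
by split=> //=; exists bs.
Qed.

Lemma sim_rd k kN k0 k1 s c : k <= m -> fetch k = IRd kN k0 k1 ->
  sim k s c ->
  exists c', steps B c c' /\
    sim (match read_input w (st_ip s) with
         | None => kN | Some false => k0 | Some true => k1 end) s c'.
Proof.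
move=> Hk Ef [-> /= Hip [bs [HT Hrep Hsz]]].
exists (Cfg machine (inord (match read_input w (st_ip s) with None => kN | Some false => k0 | Some true => k1 end), None) (st_ip s)
  (fun j => if j == 0 then c_tape machine c 0 else c_tape machine c j) 0 (st_out s)); split.
  apply: (@steps_step _ _ _ _ _ _ (steps_refl _)) => //.
  by rewrite /tm_step /= /mdelta fetch_inord // Ef /= cats0 (minn_idPl Hip) /mhalt /= fetch_inord // Ef.
by split=> //=; exists bs.
Qed.

Definition codeat (l : seq instr) (s : nat) :=
  exists pre post, code = pre ++ l ++ post /\ size pre = s.

Lemma codeat_cat l1 l2 s : codeat (l1 ++ l2) s ->
  codeat l1 s /\ codeat l2 (s + size l1).
Proof.
move=> [pre [post [E Es]]]; split.
  by exists pre, (l2 ++ post); rewrite E !catA.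
by exists (pre ++ l1), post; rewrite E !catA size_cat Es.
Qed.

Lemma codeat_head i l s : codeat (i :: l) s -> [/\ fetch s = i, s <= m & codeat l s.+1].
Proof.
move=> [pre [post [E Es]]]; split.
- by rewrite /fetch E nth_cat Es ltnn subnn.
- by rewrite /m E size_cat Es; lia.
- by exists (rcons pre i), post; rewrite E cat_rcons size_rcons Es.
Qed.

(** Induction on the derivation and not on the command: the derivation of a loop contains that of
    its remaining turns, which run at the same address. *)
Lemma exec_sim c st st' s k cfg : exec w V c st st' -> codeat (ccomp c s k) s ->
  sim s st cfg -> exists cfg', steps B cfg cfg' /\ sim k st' cfg'.
Proof.
move=> He; elim: He s k cfg => {c st st'}.
- move=> st s k cfg /codeat_head [Ef Hs _] Hsim.
  by have [c' [H1 H2]] := sim_rd Hs Ef Hsim; exists c'; move: H2; case: read_input => [[]|].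
- by move=> r rg i o Hv s k cfg /codeat_head [Ef Hs _] Hsim; apply: (sim_inc Hs Ef).
- by move=> b rg i o s k cfg /codeat_head [Ef Hs _] Hsim; apply: (sim_mov Hs Ef).
- by move=> b rg i o s k cfg /codeat_head [Ef Hs _] Hsim; apply: (sim_emit Hs Ef).
- move=> c1 c2 s1 s2 s3 _ IH1 _ IH2 s k cfg /codeat_cat []; rewrite size_ccomp => H1 H2 Hsim.
  have [c' [S1 /(IH2 _ _ _ H2) [c'' [S2 Hs2]]]] := IH1 _ _ _ H1 Hsim.
  by exists c''; split=> //; apply: steps_trans S2.
- move=> r c st Hr s k cfg /codeat_head [Ef Hs _] Hsim.
  by have := sim_jz Hs Ef Hsim; rewrite Hr.
- move=> r c rg i o v s1 s2 Hr _ IH1 _ IH2 s k cfg Hc Hsim.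
  have [Ef Hs /codeat_head [Ef1 Hs1 Hc1]] := codeat_head Hc.
  have [c1 [S1]] := sim_jz Hs Ef Hsim; rewrite /= Hr /= => H1.
  have [c2 [S2 H2]] := sim_dec Hs1 Ef1 Hr H1.
  have [c3 [S3 H3]] := IH1 _ _ _ Hc1 H2.
  have [c4 [S4 H4]] := IH2 _ _ _ Hc H3.
  by exists c4; split=> //; do 3 (apply: steps_trans; first eassumption).
- move=> r c1 c2 st st' _ IH s k cfg /codeat_head [Ef Hs /codeat_cat []]; rewrite size_ccomp => Hc1 Hc2 Hsim.
  have [c' [S1 H1]] := sim_jz Hs Ef Hsim.
  case: (st_rg st r == 0) IH H1 => IH H1.
    by have [c'' [S2 H2]] := IH _ _ _ Hc1 H1; exists c''; split=> //; apply: steps_trans S2.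
  by have [c'' [S2 H2]] := IH _ _ _ Hc2 H1; exists c''; split=> //; apply: steps_trans S2.
- move=> cN c0 c1 st st' _ IH s k cfg /codeat_head [Ef Hs /codeat_cat []]; rewrite size_ccomp => HcN.
  move=> /codeat_cat []; rewrite size_ccomp => Hc0 Hc1 Hsim.
  have [c' [S1 H1]] := sim_rd Hs Ef Hsim.
  case: (read_input w (st_ip st)) IH H1 => [[]|] IH H1.
  + by have [c'' [S2 H2]] := IH _ _ _ Hc1 H1; exists c''; split=> //; apply: steps_trans S2.
  + by have [c'' [S2 H2]] := IH _ _ _ Hc0 H1; exists c''; split=> //; apply: steps_trans S2.
  + by have [c'' [S2 H2]] := IH _ _ _ HcN H1; exists c''; split=> //; apply: steps_trans S2.
- move=> c st Hr s k cfg /codeat_head [Ef Hs _] Hsim.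
  by have := sim_rd Hs Ef Hsim; rewrite Hr.
- move=> c s1 s2 s3 Hr _ IH1 _ IH2 s k cfg Hc Hsim.
  have [Ef Hs Hc1] := codeat_head Hc.
  have [c1 [S1 H1]] := sim_rd Hs Ef Hsim.
  have {}H1 : sim s.+1 s1 c1 by move: H1; case: read_input Hr => [[]|].
  have [c3 [S3 H3]] := IH1 _ _ _ Hc1 H1.
  have [c4 [S4 H4]] := IH2 _ _ _ Hc H3.
  by exists c4; split=> //; do 2 (apply: steps_trans; first eassumption).
Qed.

End Sim.
End Machine.

Definition prog_code (c : cmd) (r : nat) : seq instr :=
  ccomp c 0 (clen c) ++ [:: IJz r (clen c).+1 (clen c).+2; IHalt false; IHalt true].
Definition prog (c : cmd) (r : nat) : TM :=
  machine (prog_code c r) (maxn r (maxreg c)).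

Lemma tm_run_halted (M : TM) w t t' : tm_halt M (c_q M (tm_run M w t)) -> t <= t' ->
  tm_run M w t' = tm_run M w t.
Proof.
move=> Hh Ht; rewrite -(subnK Ht) /tm_run iterD; elim: (t' - t) => //= d ->.
by rewrite /tm_step -/(tm_run M w t) Hh.
Qed.

(** The space bound extends to all times because a halted configuration is frozen. Register [r]
    gives the verdict. *)
Lemma prog_run c r w V rg ip o :
  exec w V c (Store (fun=> 0) 0 [::]) (Store rg ip o) ->
  (forall t, c_wpos _ (tm_run (prog c r) w t) < (trunc_log 2 V) + 4) /\
  exists t, [/\ tm_halt _ (c_q _ (tm_run (prog c r) w t)),
    c_out _ (tm_run (prog c r) w t) = o &
    tm_acc _ (c_q _ (tm_run (prog c r) w t)) = (rg r != 0)].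
Proof.
move=> Hex; set code := prog_code c r; set K' := maxn r (maxreg c).
have Hrg : all (fun i => all (fun t => t <= K') (regs_of i)) code.
  by rewrite /code all_cat ccomp_regs ?leq_maxr //= leq_maxl.
have H0 : @sim code K' w V 0 (Store (fun=> 0) 0 [::]) (tm_init (prog c r)).
  split=> //=; first by congr Cfg; congr (_, _); apply/val_inj; rewrite /= inordK.
  by exists [::]; split=> // j.
have Hc : codeat code (ccomp c 0 (clen c)) 0.
  by exists [::], [:: IJz r (clen c).+1 (clen c).+2; IHalt false; IHalt true].
have [c1 [S1 H1]] := exec_sim Hrg Hex Hc H0.
have Hsz : size code = clen c + 3 by rewrite size_cat size_ccomp.
have Hf i : nth (IHalt false) code (clen c + i) =
   nth (IHalt false) [:: IJz r (clen c).+1 (clen c).+2; IHalt false; IHalt true] i.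
  by rewrite nth_cat size_ccomp ltnNge leq_addr /= addKn.
have Hk : clen c <= size code by rewrite Hsz; lia.
have Ef : nth (IHalt false) code (clen c) = IJz r (clen c).+1 (clen c).+2.
  by rewrite -[clen c]addn0 Hf addn0.
have [c2 [S2 H2]] := sim_jz Hrg Hk Ef H1.
have [T [ET HT]] := steps_trans S1 S2.
have {}ET : tm_run (prog c r) w T = c2 by [].
case: H2 => /= E2 _ _.
have Hh : tm_halt _ (c_q _ (tm_run (prog c r) w T)) /\
    tm_acc _ (c_q _ (tm_run (prog c r) w T)) = (rg r != 0).
  rewrite ET E2 /=; case: eqP => _; rewrite /mhalt /macc /= inordK ?Hsz; try lia.
    by rewrite -addn1 Hf.
  by rewrite -addn2 Hf.
case: Hh => Hh Ha; split; last by exists T; split=> //; rewrite ET E2.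
move=> t; case: (leqP t T) => Ht; first by rewrite addn4; apply: HT.
by rewrite (tm_run_halted Hh (ltnW Ht)) addn4; apply: HT.
Qed.

(** * Functions computed in linear space *)

Ltac upd_ext :=
  apply: functional_extensionality => ?; rewrite /upd /=;
  repeat (case: eqP => //= ?); subst; rewrite ?eqxx; try lia; try congruence.

Lemma updE rg r v : upd rg r v r = v.
Proof. by rewrite /upd eqxx. Qed.

Lemma updN rg r v i : i != r -> upd rg r v i = rg i.
Proof. by rewrite /upd => /negbTE ->. Qed.

Lemma map_upd rg r v env : r \notin env -> map (upd rg r v) env = map rg env.
Proof.
by move=> Hr; apply/eq_in_map => i Hi; rewrite updN //; apply: contraNneq Hr => <-.
Qed.

Lemma exec_zero w V r rg ip o :
  exec w V (CLoop r CSkip) (Store rg ip o) (Store (upd rg r 0) ip o).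
Proof.
move E: (rg r) => v; elim: v rg E => [|v IH] rg E.
  have -> : upd rg r 0 = rg by upd_ext.
  exact: ex_loop0.
apply: (ex_loopS E (ex_skip _ _ _)).
have -> : upd rg r 0 = upd (upd rg r v) r 0 by upd_ext.
by apply: IH; rewrite updE.
Qed.

Lemma exec_move w V x d rg ip o : x != d -> rg d + rg x <= V ->
  exec w V (CLoop x (CInc d)) (Store rg ip o)
    (Store (upd (upd rg d (rg d + rg x)) x 0) ip o).
Proof.
move=> Hxd; move E: (rg x) => v; elim: v rg E => [|v IH] rg E HV.
  have -> : upd (upd rg d (rg d + 0)) x 0 = rg by upd_ext.
  by apply: ex_loop0.
apply: (ex_loopS E).
  by apply: ex_inc; rewrite updN 1?eq_sym //; lia.
have H := IH (upd (upd rg x v) d (upd rg x v d).+1).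
move: H; rewrite ?updE ?(updN _ _ (_ : d != x)) 1?eq_sym //.
rewrite updN // updE => /(_ erefl); rewrite addSnnS => /(_ HV).
congr exec; congr Store; upd_ext.
Qed.

(** As a loop consumes its counter, [x] is also saved in [t] and then restored. *)
Definition CCopy x d t : cmd :=
  CSeq (CLoop x (CSeq (CInc d) (CInc t))) (CLoop t (CInc x)).

Lemma exec_copy w V x d t rg ip o : x != d -> x != t -> d != t -> rg t = 0 ->
  rg d + rg x <= V ->
  exec w V (CCopy x d t) (Store rg ip o) (Store (upd rg d (rg d + rg x)) ip o).
Proof.
move=> Hxd Hxt Hdt Ht HV.
have [E1 E2 E3] : [/\ (x == d) = false, (x == t) = false & (d == t) = false].
  by split; apply/negbTE.
have [E4 E5 E6] : [/\ (d == x) = false, (t == x) = false & (t == d) = false].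
  by split; rewrite eq_sym.
pose rg1 := upd (upd (upd rg d (rg d + rg x)) t (rg t + rg x)) x 0.
apply: (@ex_seq _ _ _ _ _ (Store rg1 ip o)).
- rewrite /rg1; have : rg t + rg x <= V by lia.
  move: HV {Ht rg1}; move E: (rg x) => v; elim: v rg E => [|v IH] rg E HV HV'.
    have -> : upd (upd (upd rg d (rg d + 0)) t (rg t + 0)) x 0 = rg by upd_ext.
    by apply: ex_loop0.
  apply: (ex_loopS E).
    apply: ex_seq.
      by apply: ex_inc; rewrite /upd E4; lia.
    by apply: ex_inc; rewrite /upd E6 E5; lia.
  have := IH (upd (upd (upd rg x v) d (rg d).+1) t (rg t).+1).
  rewrite /upd !eqxx E1 E2 E3 => /(_ erefl); rewrite !addSnnS => /(_ HV HV').
  by congr exec; congr Store; apply: functional_extensionality => i;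
    rewrite ?E4 ?E5 ?E6 ?E1 ?E2 ?E3; do !case: ifP.
- have := @exec_move w V t x rg1 ip o; rewrite E5 => /(_ erefl).
  rewrite /rg1 /upd !eqxx E5 Ht !add0n => H.
  have {}H := H (leq_trans (leq_addl _ _) HV).
  by move: H; congr exec; congr Store; apply: functional_extensionality => i;
    case: (i =P x) => [->|_]; rewrite ?E1 ?E2 ?eqxx //; case: (i =P t) => [->|_] //; rewrite ?E6 ?Ht.
Qed.

Definition usable (env : seq nat) (d b : nat) : Prop :=
  [/\ all (fun r => r < b) env, d < b & d \notin env].

Definition zero_from (b : nat) (rg : nat -> nat) : Prop := forall r, b <= r -> rg r = 0.

(* The class of linear-space computable functions of numbers with oracle [w]:
   the command adds the value to register [d] and uses registers from [b] on
   as scratch; every number met is polynomial in [size w] and the arguments. *)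
Definition E2 (f : seq bool -> seq nat -> nat) : Prop :=
  exists a, (forall w e, f w e <= (size w + sumn e + 2) ^ a) /\
  forall env d b, usable env d b -> exists c, forall w rg out V,
    zero_from b rg -> rg d + (size w + sumn (map rg env) + 2) ^ a <= V ->
    exec w V c (Store rg 0 out)
      (Store (upd rg d (rg d + f w (map rg env))) 0 out).

Lemma E2_ext f g : (forall w e, f w e = g w e) -> E2 f -> E2 g.
Proof.
by move=> H; have -> : f = g by do 2!apply: functional_extensionality => ?.
Qed.

Lemma nth_sumn e i : nth 0 e i <= sumn e.
Proof.
elim: e i => [|x e IH] [|i] //=; first exact: leq_addr.
exact: leq_trans (IH i) (leq_addl _ _).
Qed.

Lemma E2_var i : E2 (fun _ e => nth 0 e i).
Proof.
exists 1; split=> [w e|env d b [Henv Hd Hde]].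
  by rewrite expn1; move: (nth_sumn e i); lia.
case: (ltnP i (size env)) => Hi; last first.
  exists CSkip => w rg out V _ _; rewrite nth_default ?size_map // addn0.
  have -> : upd rg d (rg d) = rg by upd_ext.
  exact: ex_skip.
set x := nth 0 env i; have Hx : x \in env by rewrite mem_nth.
have Hxb : x < b by move/allP/(_ x Hx): Henv.
exists (CCopy x d b) => w rg out V Hz HV; rewrite (nth_map 0) // -/x.
apply: exec_copy.
- by apply: contraNneq Hde => <-.
- by rewrite neq_ltn Hxb.
- by rewrite neq_ltn Hd.
- by rewrite Hz.
- have := nth_sumn (map rg env) i; rewrite (nth_map 0) // -/x.
  move: HV; rewrite expn1; lia.
Qed.

Lemma E2_succ f : E2 f -> E2 (fun w e => (f w e).+1).
Proof.
move=> [a [Hb Hf]]; exists a.+1; split=> [w e|env d b Hu].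
  rewrite expnS; have := Hb w e; set X := _ ^ a.
  have : 0 < X by rewrite expn_gt0 addn2.
  move: X => X; nia.
have [c Hc] := Hf _ _ _ Hu; exists (CSeq c (CInc d)) => w rg out V Hz HV.
have Hb1 := Hb w (map rg env); move: HV Hb1.
rewrite expnS; set X := _ ^ a => HV Hb1.
have X0 : 0 < X by rewrite expn_gt0 addn2.
apply: ex_seq; first by apply: Hc => //; rewrite -/X; nia.
set f0 := f _ _ in Hb1 *.
have -> : upd rg d (rg d + f0.+1) =
  upd (upd rg d (rg d + f0)) d (upd rg d (rg d + f0) d).+1 by upd_ext.
apply: ex_inc; rewrite updE; nia.
Qed.

Lemma E2_0 : E2 (fun _ _ => 0).
Proof.
exists 0; split=> [w e|env d b _] //; exists CSkip => w rg out V _ _; rewrite addn0.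
have -> : upd rg d (rg d) = rg by upd_ext.
exact: ex_skip.
Qed.

Lemma E2_const k : E2 (fun _ _ => k).
Proof. by elim: k => [|k /E2_succ]; [apply: E2_0|]. Qed.

Lemma leq_Xpow X a b : 1 < X -> a <= b -> X ^ a <= X ^ b.
Proof. by move=> H; rewrite leq_exp2l. Qed.

Lemma pow_sum3 X a1 a2 a3 x1 x2 x3 : 1 < X ->
  x1 <= X ^ a1 -> x2 <= X ^ a2 -> x3 <= X ^ a3 ->
  x1 + x2 + x3 <= X ^ (a1 + a2 + a3 + 2).
Proof.
move=> HX H1 H2 H3; rewrite expnD; set A := a1 + a2 + a3.
have K i : i <= A -> X ^ i <= X ^ A by apply: leq_Xpow.
have := K a1; have := K a2; have := K a3; rewrite /A => /(_ _) K3 /(_ _) K2 /(_ _) K1.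
have {}K1 : X ^ a1 <= X ^ A by apply: K1; lia.
have {}K2 : X ^ a2 <= X ^ A by apply: K2; lia.
have {}K3 : X ^ a3 <= X ^ A by apply: K3; lia.
have HXX : 4 <= X ^ 2 by rewrite (@leq_exp2r 2 X 2).
rewrite -/A; move: (X ^ A) (X ^ 2) HXX K1 K2 K3 => Y Z; nia.
Qed.

(** Composition in the form of a binding: the value of [g] goes to the first scratch register, which
    is then one more argument of [h], and is cleared at the end since no register but [d] may
    change. *)
Lemma E2_let g h : E2 g -> E2 h -> E2 (fun w e => h w (g w e :: e)).
Proof.
move=> [a1 [Hb1 Hg]] [a2 [Hb2 Hh]].
have HX (w : seq bool) e : size w + (g w e + sumn e) + 2 <= (size w + sumn e + 2) ^ (a1 + 3).
  have -> : size w + (g w e + sumn e) + 2 = g w e + (size w + sumn e + 2) + 0 by lia.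
  have -> : a1 + 3 = a1 + 1 + 0 + 2 by lia.
  by apply: pow_sum3; rewrite ?Hb1 ?expn1 //; lia.
have HX2 w e : (size w + (g w e + sumn e) + 2) ^ a2 <= (size w + sumn e + 2) ^ (a1 + (a1 + 3) * a2).
  apply: leq_trans (_ : (size w + sumn e + 2) ^ ((a1 + 3) * a2) <= _); last by apply: leq_Xpow; lia.
  rewrite expnM; case: a2 {Hb2 Hh} => // a2; by rewrite leq_exp2r.
exists (a1 + (a1 + 3) * a2); split=> [w e|env d b [Henv Hd Hde]].
  apply: leq_trans (Hb2 _ _) _; exact: HX2.
have Hbenv : b \notin env by apply/negP => /(allP Henv); rewrite ltnn.
have Hu1 : usable env b b.+1.
  by split=> //; apply: sub_all Henv => r; apply: ltnW.
have [c1 Hc1] := Hg _ _ _ Hu1.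
have Hu2 : usable (b :: env) d b.+1.
  split; [|lia|by rewrite inE negb_or Hde neq_ltn Hd].
  by rewrite /= ltnSn; apply: sub_all Henv => r; apply: ltnW.
have [c2 Hc2] := Hh _ _ _ Hu2.
exists (CSeq c1 (CSeq c2 (CLoop b CSkip))) => w rg out V Hz HV.
have Hb0 : rg b = 0 by rewrite Hz.
apply: ex_seq.
  apply: Hc1; first by move=> r Hr; rewrite Hz //; lia.
  rewrite Hb0; apply: leq_trans (leq_trans (leq_addl (rg d) _) HV).
  by apply: leq_Xpow; lia.
rewrite Hb0 add0n; set gv := g w _.
have Emap : map (upd rg b gv) (b :: env) = gv :: map rg env.
  by rewrite /= updE map_upd.
apply: ex_seq.
  apply: Hc2.
    by move=> r Hr; rewrite updN ?Hz //; [lia|rewrite neq_ltn Hr orbT].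
  rewrite Emap updN ?neq_ltn ?Hd //=.
  apply: leq_trans HV; rewrite leq_add2l; exact: HX2.
rewrite Emap.
have -> : upd rg d (rg d + h w (gv :: map rg env)) =
  upd (upd (upd rg b gv) d (upd rg b gv d + h w (gv :: map rg env))) b 0.
  rewrite (updN _ _ (_ : d != b)) ?neq_ltn ?Hd //; upd_ext.
exact: exec_zero.
Qed.

(* [T d env] selects registers of [env], with [d] as a default. *)
Lemma E2_env (T : nat -> seq nat -> seq nat) k f :
  (forall rg d env, rg d = 0 -> map rg (T d env) = T 0 (map rg env)) ->
  (forall d env r, r \in T d env -> r = d \/ r \in env) ->
  (forall e, sumn (T 0 e) <= k * sumn e) -> E2 f -> E2 (fun w e => f w (T 0 e)).
Proof.
move=> Hnat Hin Hsum [a [Hb Hf]].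
have HX (w : seq bool) e : (size w + sumn (T 0 e) + 2) ^ a <= (size w + sumn e + 2) ^ (k.+1 * a).
  rewrite expnM; case: a {Hb Hf} => // a; rewrite leq_exp2r //.
  have Hk : k < 2 ^ k by apply: ltn_expl.
  apply: (@leq_trans (k.+1 * (size w + sumn e + 2))); first by have := Hsum e; nia.
  rewrite [_ ^ k.+1]expnSr leq_mul2r (leq_trans Hk) ?orbT //.
  by case: (k) => // k'; rewrite leq_exp2r //; lia.
exists (k.+1 * a); split=> [w e|env d b [/allP Henv Hd Hde]].
  exact: leq_trans (Hb w _) (HX w e).
(* Register [b], which holds zero, stands for the arguments that are out of range. *)
have Hu : usable (T b env) d b.+1.
  split; [by apply/allP => r /Hin [->|/Henv /ltnW] | exact: ltnW |].
  by apply/negP => /Hin [E|]; [rewrite E ltnn in Hd | apply/negP].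
have [c Hc] := Hf _ _ _ Hu; exists c => w rg out V Hz HV.
have Hb0 : rg b = 0 by apply: Hz.
rewrite -(Hnat _ b) //; apply: Hc; first by move=> r Hr; apply: Hz; lia.
rewrite Hnat //; apply: leq_trans HV; rewrite leq_add2l; exact: HX.
Qed.

Lemma E2_ren s f : E2 f -> E2 (fun w e => f w [seq nth 0 e i | i <- s]).
Proof.
apply: (@E2_env (fun d e => [seq nth d e i | i <- s]) (size s)) => [rg d env Hd|d env r|e].
- rewrite -map_comp; apply: eq_map => i /=; case: (ltnP i (size env)) => Hi.
    by rewrite (nth_map d).
  by rewrite !nth_default ?size_map.
- move/mapP=> [i _ ->]; case: (ltnP i (size env)) => Hi; first by right; rewrite mem_nth.
  by left; rewrite nth_default.
- by elim: s => //= i s IH; rewrite mulSn leq_add // nth_sumn.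
Qed.

Lemma E2_drop k f : E2 f -> E2 (fun w e => f w (drop k e)).
Proof.
apply: (@E2_env (fun _ e => drop k e) 1) => [rg d env _|d env r /mem_drop|e].
- by rewrite map_drop.
- by right.
- rewrite mul1n; elim: k e => [|k IH] [|x e] //=.
  exact: leq_trans (IH e) (leq_addl _ _).
Qed.

Lemma E2_skip f : E2 f -> E2 (fun w e => f w (nth 0 e 0 :: behead (behead e))).
Proof.
apply: (@E2_env (fun d e => nth d e 0 :: behead (behead e)) 1) => [rg d|d|e].
- by case=> [|x [|y env]] Hd /=; rewrite ?Hd.
- move=> env r; rewrite in_cons => /orP [/eqP ->|H].
    by case: env => [|x env]; [left|right; apply: mem_head].
  by right; case: env H => [|x [|y env]] //=; rewrite !inE => ->; rewrite !orbT.
- by case: e => [|x [|y e]] /=; lia.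
Qed.

(** The values are pushed one by one in front of the environment; [drop] hides from each function
    what has been pushed before it, and a final renaming keeps only the pushed values. *)
Lemma E2_comp (gs : seq (seq bool -> seq nat -> nat)) f :
  E2 f -> foldr (fun g P => E2 g /\ P) True gs ->
  E2 (fun w e => f w [seq g w e | g <- gs]).
Proof.
move=> Hf Hgs.
have H : forall f, E2 f -> E2 (fun w e => f w ([seq g w e | g <- gs] ++ e)).
  elim: gs Hgs {f Hf} => [|g gs IH] //= [Hg Hgs] f Hf.
  have H1 := E2_let (E2_drop (size gs) Hg) Hf.
  apply: E2_ext (IH Hgs _ H1) => w e /=.
  by rewrite -[in drop _ _](size_map (fun g => g w e) gs) drop_size_cat.
apply: E2_ext (H _ (E2_ren (iota 0 (size gs)) Hf)) => w e /=; congr (f w _).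
have -> : iota 0 (size gs) = iota 0 (size [seq g w e | g <- gs]) by rewrite size_map.
move: [seq g w e | g <- gs] => l.
by rewrite map_nth_iota0 ?size_cat ?leq_addr // take_size_cat.
Qed.

Lemma E2_app1 (F : seq bool -> nat -> nat) f :
  E2 (fun w e => F w (nth 0 e 0)) -> E2 f -> E2 (fun w e => F w (f w e)).
Proof. by move=> HF Hf; apply: (E2_comp (gs := [:: f]) HF). Qed.

Lemma E2_app2 (F : seq bool -> nat -> nat -> nat) f1 f2 :
  E2 (fun w e => F w (nth 0 e 0) (nth 0 e 1)) -> E2 f1 -> E2 f2 ->
  E2 (fun w e => F w (f1 w e) (f2 w e)).
Proof. by move=> HF H1 H2; apply: (E2_comp (gs := [:: f1; f2]) HF). Qed.

Lemma E2_app3 (F : seq bool -> nat -> nat -> nat -> nat) f1 f2 f3 :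
  E2 (fun w e => F w (nth 0 e 0) (nth 0 e 1) (nth 0 e 2)) -> E2 f1 -> E2 f2 -> E2 f3 ->
  E2 (fun w e => F w (f1 w e) (f2 w e) (f3 w e)).
Proof. by move=> HF H1 H2 H3; apply: (E2_comp (gs := [:: f1; f2; f3]) HF). Qed.

Lemma E2_app4 (F : seq bool -> nat -> nat -> nat -> nat -> nat) f1 f2 f3 f4 :
  E2 (fun w e => F w (nth 0 e 0) (nth 0 e 1) (nth 0 e 2) (nth 0 e 3)) ->
  E2 f1 -> E2 f2 -> E2 f3 -> E2 f4 ->
  E2 (fun w e => F w (f1 w e) (f2 w e) (f3 w e) (f4 w e)).
Proof. by move=> HF H1 H2 H3 H4; apply: (E2_comp (gs := [:: f1; f2; f3; f4]) HF). Qed.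

Fixpoint nrec (n g : nat) (h : nat -> nat -> nat) : nat :=
  if n is m.+1 then h m (nrec m g h) else g.

Lemma all_lt_weak env b c : b <= c -> all (fun r => r < b) env -> all (fun r => r < c) env.
Proof. by move=> H; apply: sub_all => r Hr; apply: leq_trans H. Qed.

Lemma notin_ge env b r : all (fun r => r < b) env -> b <= r -> r \notin env.
Proof. by move=> /allP H Hr; apply/negP => /H; lia. Qed.

Lemma upd_id rg r v : rg r = v -> upd rg r v = rg.
Proof. by move=> H; apply: functional_extensionality => i; rewrite /upd; case: eqP => [->|]. Qed.

Ltac upd_cases S Hzr Hb0 :=
  apply: functional_extensionality => ?; rewrite /S /upd;
  repeat (case: eqP => ?); subst; rewrite ?Hzr ?Hb0; lia.

(** The bound is asked for all intermediate values, as these are what the registers hold. Registers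
    [b] to [b + 3] contain the number of turns left, the index, the current value and the next
    value. *)
Lemma E2_rec n g h : E2 n -> E2 g ->
  E2 (fun w e => h w (behead (behead e)) (nth 0 e 0) (nth 0 e 1)) ->
  (exists a, forall w e m, m <= n w e ->
     nrec m (g w e) (h w e) <= (size w + sumn e + 2) ^ a) ->
  E2 (fun w e => nrec (n w e) (g w e) (h w e)).
Proof.
move=> [an [Hbn Hn]] [ag [Hbg Hg]] [ah [Hbh Hh]] [ar Hr].
pose X (w : seq bool) e := size w + sumn e + 2.
have X1 w e : 1 < X w e by rewrite /X; lia.
set ax := an + ar + 1 + 2.
have HX w e m v : m <= X w e ^ an -> v <= X w e ^ ar ->
    size w + sumn [:: m, v & e] + 2 <= X w e ^ ax.
  move=> H1 H2; have -> : size w + sumn [:: m, v & e] + 2 = m + v + X w e.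
    by rewrite /X /=; lia.
  by apply: pow_sum3; rewrite ?expn1.
set A := an + ag + ar + ax * ah + 1.
have Hle w e a : a <= A -> X w e ^ a <= X w e ^ A by apply: leq_Xpow.
exists A; split=> [w e|env d b [Henv Hd Hde]].
  apply: leq_trans (Hr w e _ (leqnn _)) (Hle _ _ _ _); rewrite /A; lia.
have Henv4 := all_lt_weak (leq_addr 4 b) Henv.
have Hun : usable env b (b + 4) by split=> //; [lia|apply: notin_ge Henv _].
have Hug : usable env (b + 2) (b + 4) by split=> //; [lia|apply: notin_ge Henv _; lia].
have Huh : usable [:: b + 1, b + 2 & env] (b + 3) (b + 4).
  split=> //=; [by rewrite Henv4; lia|by lia|].
  by rewrite !inE (negbTE (notin_ge Henv _)) ?orbF; lia.
have [cn Hcn] := Hn _ _ _ Hun.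
have [cg Hcg] := Hg _ _ _ Hug.
have [ch Hch] := Hh _ _ _ Huh.
exists (CSeq cn (CSeq cg (CSeq
  (CLoop b (CSeq ch (CSeq (CLoop (b + 2) CSkip) (CSeq (CLoop (b + 3) (CInc (b + 2))) (CInc (b + 1))))))
  (CSeq (CLoop (b + 2) (CInc d)) (CLoop (b + 1) CSkip))))).
move=> w rg out V Hz HV.
set e := map rg env in HV *; set nv := n w e; set gv := g w e; pose f m := nrec m gv (h w e).
have HXV a : a <= A -> X w e ^ a <= V.
  by move=> /(Hle w e) Ha; apply: leq_trans (leq_trans (leq_addl (rg d) _) HV).
pose S k m v := upd (upd (upd rg b k) (b + 1) m) (b + 2) v.
have Hzr i : rg (b + i) = 0 by rewrite Hz ?leq_addr.
have Hb0 : rg b = 0 by rewrite Hz.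
have HSe k m v : map (S k m v) env = e.
  by rewrite /S !map_upd //; apply: notin_ge Henv _; lia.
have HSz k m v : zero_from (b + 4) (S k m v).
  by move=> r Hbr; rewrite /S !updN ?Hz //; lia.
have E1 : upd rg b nv = S nv 0 0.
  by upd_cases S Hzr Hb0.
apply: ex_seq.
  apply: Hcn; first by move=> r Hbr; rewrite Hz //; lia.
  rewrite Hb0 -/e; apply: HXV; rewrite /A; lia.
rewrite Hb0 add0n -/e -/nv E1.
apply: ex_seq.
  apply: Hcg => //; rewrite HSe /S updE; apply: HXV; rewrite /A; lia.
rewrite HSe -/gv {2}/S updE add0n.
have -> : upd (S nv 0 0) (b + 2) gv = S nv 0 (f 0) by rewrite /S; upd_ext.
have Hf m : m <= nv -> f m <= X w e ^ ar by apply: Hr.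
have Hnv : nv <= X w e ^ an by apply: Hbn.
have Hbody k m : m + k.+1 = nv -> exec w V
    (CSeq ch (CSeq (CLoop (b + 2) CSkip) (CSeq (CLoop (b + 3) (CInc (b + 2))) (CInc (b + 1)))))
    (Store (S k m (f m)) 0 out) (Store (S k m.+1 (f m.+1)) 0 out).
  move=> Hmk.
  have Em : map (S k m (f m)) [:: b + 1, b + 2 & env] = [:: m, f m & e].
    by rewrite /= HSe /S updE updN ?updE //; lia.
  have S3 : S k m (f m) (b + 3) = 0 by rewrite /S !updN ?Hzr //; lia.
  have Hfm := Hf m.+1; apply: ex_seq.
    apply: Hch => //; rewrite Em S3.
    apply: leq_trans (HXV (ax * ah) _); last by rewrite /A; lia.
    rewrite add0n expnM; case: (ah) => // ah'; rewrite leq_exp2r //.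
    by apply: HX; [lia|apply: Hf; lia].
  rewrite Em S3 add0n /= -/(f m.+1).
  apply: ex_seq; first exact: exec_zero.
  set S' := upd _ (b + 2) 0.
  have S'3 : S' (b + 3) = f m.+1.
    by rewrite /S' updN ?updE //; lia.
  have S'2 : S' (b + 2) = 0 by rewrite /S' updE.
  apply: ex_seq.
    apply: exec_move; first by lia.
    rewrite S'3 S'2 add0n; apply: leq_trans (Hfm _) _; first by lia.
    by apply: HXV; rewrite /A; lia.
  rewrite S'3 S'2 add0n.
  have -> : upd (upd S' (b + 2) (f m.+1)) (b + 3) 0 = S k m (f m.+1).
    rewrite /S'; apply: functional_extensionality => r; rewrite /S /upd;  repeat (case: eqP => ?); subst; rewrite ?Hzr ?Hb0; try lia.
  have -> : S k m.+1 (f m.+1) = upd (S k m (f m.+1)) (b + 1) (S k m (f m.+1) (b + 1)).+1.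
    rewrite /S (updN _ _ (_ : b + 1 != b + 2)) ?updE; last by lia.
    by upd_ext; lia.
  apply: ex_inc; rewrite /S updN ?updE; last by lia.
  have : X w e ^ an <= V by apply: HXV; rewrite /A; lia.
  by lia.
apply: (@ex_seq _ _ _ _ _ (Store (S 0 nv (f nv)) 0 out)).
  suff H k m : m + k = nv -> exec w V
    (CLoop b (CSeq ch (CSeq (CLoop (b + 2) CSkip) (CSeq (CLoop (b + 3) (CInc (b + 2))) (CInc (b + 1))))))
    (Store (S k m (f m)) 0 out) (Store (S 0 nv (f nv)) 0 out) by apply: H.
  elim: k m => [|k IH] m Hk.
    have -> : m = nv by lia.
    by apply: ex_loop0; rewrite /S /= 2?updN ?updE //; lia.
  apply: (ex_loopS (v := k)).
  - by rewrite /S 2?updN ?updE //; lia.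
  - have -> : upd (S k.+1 m (f m)) b k = S k m (f m).
      by rewrite /S; upd_ext.
    by apply: Hbody; lia.
  - by apply: IH; lia.
have Sd : S 0 nv (f nv) d = rg d by rewrite /S !updN //; lia.
have S2 : S 0 nv (f nv) (b + 2) = f nv by rewrite /S updE.
apply: ex_seq.
  apply: exec_move; first by lia.
  rewrite Sd S2; apply: leq_trans HV; rewrite leq_add2l.
  by apply: leq_trans (Hf _ (leqnn _)) (Hle _ _ _ _); rewrite /A; lia.
rewrite Sd S2.
have -> : upd rg d (rg d + f nv) = upd (upd (upd (S 0 nv (f nv)) d (rg d + f nv)) (b + 2) 0) (b + 1) 0.
  by upd_cases S Hzr Hb0.
exact: exec_zero.
Qed.

(** * Access to the input *)

Definition inp (w : seq bool) (i : nat) : nat :=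
  if read_input w i.+1 is Some b then b.+1 else 0.

(** The first move leaves the right endmarker, which would otherwise stop the loop at once. *)
Definition CRewind : cmd := CSeq (CMov false) (CWhileIn (CMov false)).

Lemma exec_rewind w V rg i o : i <= size w ->
  exec w V CRewind (Store rg i.+1 o) (Store rg 0 o).
Proof.
move=> Hi; apply: ex_seq; first exact: ex_mov.
have -> : move_in w false i.+1 = i by rewrite /move_in /=; lia.
elim: i Hi => [|i IH] Hi; first exact: ex_whilein0.
apply: ex_whileinS.
- by rewrite /= Hi.
- exact: ex_mov.
- have -> : move_in w false i.+1 = i by rewrite /move_in /=; lia.
  by apply: IH; lia.
Qed.

Lemma E2_inp_var : E2 (fun w e => inp w (nth 0 e 0)).
Proof.
exists 1; split=> [w e|env d b [Henv Hd Hde]].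
  by rewrite /inp; case: read_input => [[]|]; rewrite expn1 /=; lia.
have [c Hc] : exists c, forall w rg out V, zero_from b rg ->
    size w + sumn (map rg env) + 2 <= V ->
    exec w V c (Store rg 0 out) (Store (upd rg b (nth 0 (map rg env) 0)) 0 out).
  case: env Henv Hde => [|x env] Henv Hde.
    exists CSkip => w rg out V Hz _ /=.
    have -> : upd rg b 0 = rg by rewrite upd_id ?Hz.
    exact: ex_skip.
  exists (CCopy x b b.+1) => w rg out V Hz /= HV.
  have -> : rg x = rg b + rg x by rewrite (Hz b).
  by move: Henv => /= /andP [Hx _]; apply: exec_copy; rewrite ?(Hz b) ?(Hz b.+1) //; lia.
exists (CSeq c (CSeq (CLoop b (CMov true)) (CSeq (CMov true)
  (CSeq (CIfIn CSkip (CInc d) (CSeq (CInc d) (CInc d))) CRewind)))).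
move=> w rg out V Hz; rewrite expn1 => HV.
apply: ex_seq; first by apply: Hc => //; lia.
set x := nth 0 _ 0.
apply: (@ex_seq _ _ _ _ _ (Store rg (minn x (size w).+1) out)).
  have H k i : exec w V (CLoop b (CMov true)) (Store (upd rg b k) (minn i (size w).+1) out)
                (Store rg (minn (i + k) (size w).+1) out).
    elim: k i => [|k IH] i.
      have -> : upd rg b 0 = rg by rewrite upd_id ?Hz.
      by rewrite addn0; apply: ex_loop0; rewrite /= Hz.
    apply: (ex_loopS (v := k)); first exact: updE.
      have -> : upd (upd rg b k.+1) b k = upd rg b k by upd_ext.
      exact: ex_mov.
    have -> : move_in w true (minn i (size w).+1) = minn i.+1 (size w).+1.
      by rewrite /move_in /=; lia.
    by rewrite -addSnnS.
  by have := H x 0; rewrite min0n add0n.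
apply: ex_seq; first exact: ex_mov.
have -> : move_in w true (minn x (size w).+1) = (minn x (size w)).+1.
  by rewrite /move_in /=; lia.
(* An index past the end is clamped at the right endmarker, which reads as [None] like every
   position beyond the input. *)
have Hrd : read_input w (minn x (size w)).+1 = read_input w x.+1.
  by rewrite /=; case: (ltnP x (size w)) => Hx; rewrite ?(minn_idPl (ltnW Hx)) ?(minn_idPr Hx) ?Hx // ltnn.
apply: (@ex_seq _ _ _ _ _ (Store (upd rg d (rg d + inp w x)) (minn x (size w)).+1 out)).
  apply: ex_ifin; rewrite [st_ip _]/= Hrd /inp; case: read_input => [[]|].
  - apply: ex_seq; first by apply: ex_inc; lia.
    have -> : upd rg d (rg d + true.+1) = upd (upd rg d (rg d).+1) d (upd rg d (rg d).+1 d).+1.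
      by rewrite updE; upd_ext.
    by apply: ex_inc; rewrite updE; lia.
  - by rewrite addn1; apply: ex_inc; lia.
  - have -> : upd rg d (rg d + 0) = rg by upd_ext.
    exact: ex_skip.
by apply: exec_rewind; lia.
Qed.

Lemma E2_inp f : E2 f -> E2 (fun w e => inp w (f w e)).
Proof. exact: E2_app1 E2_inp_var. Qed.

Lemma E2_size : E2 (fun w _ => size w).
Proof.
exists 1; split=> [w e|env d b [Henv Hd Hde]]; first by rewrite expn1; lia.
exists (CSeq (CMov true) (CSeq (CWhileIn (CSeq (CInc d) (CMov true))) CRewind)).
move=> w rg out V Hz; rewrite expn1 => HV.
apply: ex_seq; first exact: ex_mov.
apply: (@ex_seq _ _ _ _ _ (Store (upd rg d (rg d + size w)) (size w).+1 out)); last first.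
  by apply: exec_rewind.
have -> : move_in w true 0 = 1 by rewrite /move_in /=; lia.
suff H k i : i + k = size w -> exec w V (CWhileIn (CSeq (CInc d) (CMov true)))
    (Store (upd rg d (rg d + i)) i.+1 out)
    (Store (upd rg d (rg d + size w)) (size w).+1 out).
  have := H (size w) 0 erefl; congr exec; congr Store; upd_ext.
elim: k i => [|k IH] i Hi.
  have -> : i = size w by lia.
  by apply: ex_whilein0; rewrite /= ltnn.
apply: ex_whileinS.
- by rewrite /= ifT //; lia.
- apply: ex_seq; first by apply: ex_inc; rewrite updE; lia.
  exact: ex_mov.
- have -> : move_in w true i.+1 = i.+2 by rewrite /move_in /=; lia.
  have -> : upd (upd rg d (rg d + i)) d (upd rg d (rg d + i) d).+1 = upd rg d (rg d + i.+1).
    by rewrite updE; upd_ext.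
  by apply: IH; lia.
Qed.

Notation E2b p := (E2 (fun w e => nat_of_bool (p w e))).

Definition poly_bounded (f : seq bool -> seq nat -> nat) : Prop :=
  exists a, forall w e, f w e <= (size w + sumn e + 2) ^ a.

Lemma E2_pb f : E2 f -> poly_bounded f.
Proof. by move=> [a [H _]]; exists a. Qed.

Lemma pb_add f g : poly_bounded f -> poly_bounded g -> poly_bounded (fun w e => f w e + g w e).
Proof.
move=> [a Ha] [b Hb]; exists (a + b + 0 + 2) => w e.
rewrite -[X in X <= _]addn0; apply: pow_sum3 => //; lia.
Qed.

Lemma pb_mul f g : poly_bounded f -> poly_bounded g -> poly_bounded (fun w e => f w e * g w e).
Proof. by move=> [a Ha] [b Hb]; exists (a + b) => w e; rewrite expnD leq_mul. Qed.

Lemma E2_recb n g h p : poly_bounded p ->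
  (forall w e m, m <= n w e -> nrec m (g w e) (h w e) <= p w e) ->
  E2 n -> E2 g -> E2 (fun w e => h w (behead (behead e)) (nth 0 e 0) (nth 0 e 1)) ->
  E2 (fun w e => nrec (n w e) (g w e) (h w e)).
Proof.
move=> [a Hp] H Hn Hg Hh; apply: E2_rec => //; exists a => w e m Hm.
exact: leq_trans (H _ _ _ Hm) (Hp _ _).
Qed.

Lemma E2_behead f : E2 f -> E2 (fun w e => f w (behead e)).
Proof. by move/(E2_drop 1); apply: E2_ext => w [|x e] //=; rewrite drop0. Qed.

Ltac e2var := refine (E2_ext _ (E2_var _)); intros; rewrite ?nth_behead; reflexivity.

Lemma E2_add f g : E2 f -> E2 g -> E2 (fun w e => f w e + g w e).
Proof.
move=> Hf Hg; have H m x : nrec m x (fun _ => succn) = m + x.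
  by elim: m => //= m ->.
apply: (@E2_ext (fun w e => nrec (f w e) (g w e) (fun _ => succn))).
  by move=> w e; rewrite H.
apply: (E2_recb (p := fun w e => f w e + g w e)) => //.
- by apply: pb_add; apply: E2_pb.
- by move=> w e m Hm; rewrite H leq_add2r.
- by apply: E2_succ; e2var.
Qed.

Lemma E2_mul f g : E2 f -> E2 g -> E2 (fun w e => f w e * g w e).
Proof.
apply: (@E2_app2 (fun _ x y => x * y)).
have H m x : nrec m 0 (fun _ v => v + x) = m * x.
  by elim: m => //= m ->; rewrite mulSn addnC.
apply: (@E2_ext (fun w e => nrec (nth 0 e 0) 0 (fun _ v => v + nth 0 e 1))).
  by move=> w e; rewrite H.
apply: (E2_recb (p := fun w e => nth 0 e 0 * nth 0 e 1)).
- by apply: pb_mul; apply/E2_pb/E2_var.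
- by move=> w e m Hm; rewrite H leq_mul2r Hm orbT.
- exact: E2_var.
- exact: E2_0.
- by apply: E2_add; e2var.
Qed.

Lemma E2_if c f g : E2b c -> E2 f -> E2 g ->
  E2 (fun w e => if c w e then f w e else g w e).
Proof.
move=> Hc Hf Hg.
apply: (@E2_ext (fun w e => nrec (c w e) (g w e) (fun _ _ => f w e))).
  by move=> w e; case: (c w e).
apply: (E2_recb (p := fun w e => f w e + g w e)) => //.
- by apply: pb_add; apply: E2_pb.
- by move=> w e [|m] _ /=; [apply: leq_addl | apply: leq_addr].
- by apply: (@E2_behead (fun w e => f w (behead e))); apply: E2_behead.
Qed.

Lemma E2_pred f : E2 f -> E2 (fun w e => (f w e).-1).
Proof.
apply: (@E2_app1 (fun _ x => x.-1)).
apply: (@E2_ext (fun w e => nrec (nth 0 e 0) 0 (fun m _ => m))).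
  by move=> w e; case: (nth 0 e 0).
apply: (E2_recb (p := fun w e => nth 0 e 0)).
- exact/E2_pb/E2_var.
- by move=> w e [|m] //=; lia.
- exact: E2_var.
- exact: E2_0.
- by e2var.
Qed.

Lemma E2_sub f g : E2 f -> E2 g -> E2 (fun w e => f w e - g w e).
Proof.
apply: (@E2_app2 (fun _ x y => x - y)).
have H m x : nrec m x (fun _ => predn) = x - m.
  by elim: m => [|m /= ->]; rewrite ?subn0 // subnS.
apply: (@E2_ext (fun w e => nrec (nth 0 e 1) (nth 0 e 0) (fun _ => predn))).
  by move=> w e; rewrite H.
apply: (E2_recb (p := fun w e => nth 0 e 0)); try exact: E2_var.
- exact/E2_pb/E2_var.
- by move=> w e m _; rewrite H leq_subr.
- by apply: E2_pred; e2var.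
Qed.

Lemma E2b_eq0 f : E2 f -> E2b (fun w e => f w e == 0).
Proof.
move=> Hf; apply: (@E2_ext (fun w e => 1 - f w e)).
  by move=> w e; case: (f w e).
by apply: E2_sub => //; apply: E2_const.
Qed.

Lemma E2b_leq f g : E2 f -> E2 g -> E2b (fun w e => f w e <= g w e).
Proof. by move=> Hf Hg; apply: E2b_eq0; apply: E2_sub. Qed.

Lemma E2b_ltn f g : E2 f -> E2 g -> E2b (fun w e => f w e < g w e).
Proof. by move=> Hf Hg; apply: E2b_leq => //; apply: E2_succ. Qed.

Lemma E2b_not p : E2b p -> E2b (fun w e => ~~ p w e).
Proof.
move=> Hp; apply: (@E2_ext (fun w e => nat_of_bool ((p w e : nat) == 0))).
  by move=> w e; case: (p w e).
exact: E2b_eq0.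
Qed.

Lemma E2b_and p q : E2b p -> E2b q -> E2b (fun w e => p w e && q w e).
Proof.
move=> Hp Hq; apply: (@E2_ext (fun w e => p w e * q w e)); last exact: E2_mul.
by move=> w e; case: (p w e); case: (q w e).
Qed.

Lemma E2b_or p q : E2b p -> E2b q -> E2b (fun w e => p w e || q w e).
Proof.
move=> Hp Hq; apply: (@E2_ext (fun w e => nat_of_bool (~~ (~~ p w e && ~~ q w e)))).
  by move=> w e; case: (p w e); case: (q w e).
by apply: E2b_not; apply: E2b_and; apply: E2b_not.
Qed.

Lemma E2b_eq f g : E2 f -> E2 g -> E2b (fun w e => f w e == g w e).
Proof.
move=> Hf Hg; apply: (@E2_ext (fun w e => nat_of_bool ((f w e <= g w e) && (g w e <= f w e)))).
  by move=> w e; rewrite eqn_leq.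
by apply: E2b_and; apply: E2b_leq.
Qed.

Lemma E2b_if c p q : E2b c -> E2b p -> E2b q ->
  E2b (fun w e => if c w e then p w e else q w e).
Proof.
move=> Hc Hp Hq; apply: E2_ext (E2_if Hc Hp Hq) => w e; by case: (c w e).
Qed.

(** * Bounded search and division *)

Definition bfind (n : nat) (p : nat -> bool) := find p (iota 0 n).
Definition bex (n : nat) (p : nat -> bool) := has p (iota 0 n).
Definition ball (n : nat) (p : nat -> bool) := all p (iota 0 n).

Lemma E2_bfind n p : E2 n -> E2b (fun w e => p w (behead e) (nth 0 e 0)) ->
  E2 (fun w e => bfind (n w e) (p w e)).
Proof.
move=> Hn Hp.
(* As long as nothing is found the value equals the index [m]; this distinguishes a running search
   from a finished one without a second register. *)
pose h w e m v := if v == m then (if p w e m then m else m.+1) else v.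
have H m w e : nrec m 0 (h w e) = find (p w e) (iota 0 m).
  elim: m => // m IH; have -> : iota 0 m.+1 = iota 0 m ++ [:: m] by rewrite -addn1 iotaD.
  rewrite [LHS]/= IH find_cat size_iota /h /=.
  rewrite -[X in _ == X](size_iota 0 m) has_find.
  have := find_size (p w e) (iota 0 m).
  by rewrite size_iota; case: ltngtP => // _ _; case: (p w e m); rewrite ?addn0 ?addn1.
apply: (@E2_ext (fun w e => nrec (n w e) 0 (h w e))) => //.
apply: (E2_recb (p := n)) => //.
- exact: E2_pb.
- by move=> w e m Hm; rewrite H; apply: leq_trans Hm; rewrite -[X in _ <= X](size_iota 0 m) find_size.
- exact: E2_0.
- rewrite /h; apply: E2_if; first by apply: E2b_eq; e2var.
    apply: E2_if; last by apply: E2_succ; e2var.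
      by apply: E2_ext (E2_skip Hp) => w e /=.
    by e2var.
  by e2var.
Qed.

Lemma E2b_bex n p : E2 n -> E2b (fun w e => p w (behead e) (nth 0 e 0)) ->
  E2b (fun w e => bex (n w e) (p w e)).
Proof.
move=> Hn Hp; apply: (@E2_ext (fun w e => nat_of_bool (bfind (n w e) (p w e) < n w e))).
  by move=> w e; rewrite /bfind -[X in _ < X](size_iota 0) -has_find.
by apply: E2b_ltn => //; apply: E2_bfind.
Qed.

Lemma E2b_ball n p : E2 n -> E2b (fun w e => p w (behead e) (nth 0 e 0)) ->
  E2b (fun w e => ball (n w e) (p w e)).
Proof.
move=> Hn Hp; apply: (@E2_ext (fun w e => nat_of_bool (~~ bex (n w e) (fun x => ~~ p w e x)))).
  by move=> w e; rewrite /bex -all_predC; congr nat_of_bool; apply: eq_all => x /=; rewrite negbK.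
apply: E2b_not; apply: (E2b_bex (p := fun w e x => ~~ p w e x)) => //.
exact: E2b_not.
Qed.

Lemma E2_div f g : E2 f -> E2 g -> E2 (fun w e => f w e %/ g w e).
Proof.
apply: (@E2_app2 (fun _ x y => x %/ y)).
apply: (@E2_ext (fun w e => if nth 0 e 1 == 0 then 0 else
   bfind (nth 0 e 0) (fun k => nth 0 e 0 < k.+1 * nth 0 e 1))).
  move=> w e; move: (nth 0 e 0) (nth 0 e 1) => x y.
  case: (posnP y) => [->|Hy]; rewrite ?divn0 //=. 
  have Hq : x %/ y <= x by apply: leq_div.
  rewrite /bfind; have -> : iota 0 x = iota 0 (x %/ y) ++ iota (x %/ y) (x - x %/ y).
    by rewrite -[X in iota _ X = _](subnKC Hq) iotaD.
  rewrite find_cat size_iota ifN.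
    case E: (x - x %/ y) => [|d] /=; first by rewrite addn0.
    by rewrite ltn_ceil // addn0.
  apply/hasPn => k; rewrite mem_iota add0n => /andP [_ Hk].
  by rewrite -leqNgt -leq_divRL.
apply: E2_if; first by apply: E2b_eq0; apply: E2_var.
  exact: E2_0.
apply: (E2_bfind (p := fun w e k => nth 0 e 0 < k.+1 * nth 0 e 1)).
  exact: E2_var.
by apply: E2b_ltn; [e2var|apply: E2_mul; [apply: E2_succ|]; e2var].
Qed.

Lemma E2_mod f g : E2 f -> E2 g -> E2 (fun w e => f w e %% g w e).
Proof.
move=> Hf Hg; apply: (@E2_ext (fun w e => f w e - f w e %/ g w e * g w e)).
  by move=> w e; rewrite {1}(divn_eq (f w e) (g w e)) addKn.
by apply: E2_sub => //; apply: E2_mul => //; apply: E2_div.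
Qed.

Lemma E2b_odd f : E2 f -> E2b (fun w e => odd (f w e)).
Proof.
move=> Hf; apply: (@E2_ext (fun w e => f w e %% 2)); last first.
  by apply: E2_mod => //; apply: E2_const.
by move=> w e; rewrite modn2.
Qed.

Lemma E2_half f : E2 f -> E2 (fun w e => (f w e)./2).
Proof.
move=> Hf; apply: (@E2_ext (fun w e => f w e %/ 2)); last first.
  by apply: E2_div => //; apply: E2_const.
by move=> w e; rewrite divn2.
Qed.

Lemma E2_double f : E2 f -> E2 (fun w e => (f w e).*2).
Proof.
move=> Hf; apply: (@E2_ext (fun w e => f w e + f w e)); last by apply: E2_add.
by move=> w e; rewrite addnn.
Qed.

Lemma E2_minn f g : E2 f -> E2 g -> E2 (fun w e => minn (f w e) (g w e)).
Proof.
move=> Hf Hg; apply: (@E2_ext (fun w e => if f w e < g w e then f w e else g w e)).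
  by move=> w e; rewrite /minn.
by apply: E2_if => //; apply: E2b_ltn.
Qed.

Lemma E2_expc f k : E2 f -> E2 (fun w e => f w e ^ k).
Proof.
move=> Hf; elim: k => [|k IH]; first exact: E2_const.
apply: (@E2_ext (fun w e => f w e * f w e ^ k)); last exact: E2_mul.
by move=> w e; rewrite expnS.
Qed.

(** Through such fixed tables the transition function of the simulated machine enters the
    reduction. *)
Lemma E2_table (s : seq nat) f : E2 f -> E2 (fun w e => nth 0 s (f w e)).
Proof.
apply: (@E2_app1 (fun _ x => nth 0 s x)); elim: s => [|a s IH].
  by apply: (@E2_ext (fun _ _ => 0)); [move=> w e; rewrite nth_nil|apply: E2_0].
apply: (@E2_ext (fun w e => if nth 0 e 0 == 0 then a else nth 0 s (nth 0 e 0).-1)).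
  by move=> w e; case: (nth 0 e 0).
apply: E2_if; [by apply: E2b_eq0; apply: E2_var|exact: E2_const|].
by apply: (E2_app1 (F := fun _ x => nth 0 s x)) => //; apply: E2_pred; apply: E2_var.
Qed.

(** * String generation and space bounds *)

(** All registers are restored, so generators can be sequenced and looped. [V] limits the registers
    and not the length of the output. *)
Definition Gen (g : seq bool -> seq nat -> seq bool) : Prop :=
  exists a, forall env b, all (fun r => r < b) env -> exists c, forall w rg out V,
    zero_from b rg -> (size w + sumn (map rg env) + 2) ^ a <= V ->
    exec w V c (Store rg 0 out) (Store rg 0 (out ++ g w (map rg env))).

Lemma Gen_ext f g : (forall w e, f w e = g w e) -> Gen f -> Gen g.
Proof.
by move=> H; have -> : f = g by do 2!apply: functional_extensionality => ?.
Qed.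

Lemma Gen_nil : Gen (fun _ _ => [::]).
Proof. by exists 0 => env b _; exists CSkip => w rg out V _ _; rewrite cats0; apply: ex_skip. Qed.

Lemma Gen_cat f g : Gen f -> Gen g -> Gen (fun w e => f w e ++ g w e).
Proof.
move=> [a1 H1] [a2 H2]; exists (a1 + a2) => env b Henv.
have [c1 Hc1] := H1 _ _ Henv; have [c2 Hc2] := H2 _ _ Henv.
exists (CSeq c1 c2) => w rg out V Hz HV.
have HX : 1 < size w + sumn (map rg env) + 2 by lia.
apply: ex_seq.
  by apply: Hc1 => //; apply: leq_trans HV; apply: leq_Xpow => //; lia.
rewrite catA; apply: Hc2 => //; apply: leq_trans HV; apply: leq_Xpow => //; lia.
Qed.

Lemma Gen_const s : Gen (fun _ _ => s).
Proof.
elim: s => [|x s IH]; first exact: Gen_nil.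
apply: (@Gen_cat (fun _ _ => [:: x]) (fun _ _ => s)) => //.
by exists 0 => env b _; exists (CEmit x) => w rg out V _ _; apply: ex_emit.
Qed.

Lemma Gen_if p f g : E2b p -> Gen f -> Gen g ->
  Gen (fun w e => if p w e then f w e else g w e).
Proof.
move=> [a0 [Hb Hp]] [a1 H1] [a2 H2]; exists (a0 + a1 + a2) => env b Henv.
have Henv1 := all_lt_weak (leqnSn b) Henv.
have Hu : usable env b b.+1 by split=> //; apply: notin_ge Henv _.
have [c0 Hc0] := Hp _ _ _ Hu.
have [c1 Hc1] := H1 _ _ Henv1; have [c2 Hc2] := H2 _ _ Henv.
exists (CSeq c0 (CIf b c2 (CSeq c1 (CLoop b CSkip)))) => w rg out V Hz HV.
have HX a : a <= a0 + a1 + a2 -> (size w + sumn (map rg env) + 2) ^ a <= V.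
  by move=> Ha; apply: leq_trans HV; apply: leq_Xpow => //; lia.
have Hz1 : zero_from b.+1 rg by move=> r Hr; apply: Hz; lia.
have Hb0 : rg b = 0 by apply: Hz.
apply: ex_seq.
  by apply: Hc0 => //; rewrite Hb0; apply: HX; lia.
rewrite Hb0 add0n; apply: ex_if; rewrite /= updE.
have Em x : map (upd rg b x) env = map rg env.
  by rewrite map_upd //; apply: notin_ge Henv _.
case: (p w _) => /=; last first.
  by rewrite upd_id //; apply: Hc2 => //; apply: HX; lia.
apply: ex_seq.
  apply: Hc1; first by move=> r Hr; rewrite updN ?Hz1 //; lia.
  by rewrite Em; apply: HX; lia.
rewrite Em; set o := out ++ _.
have -> : Store rg 0 o = Store (upd (upd rg b 1) b 0) 0 o.
  by congr Store; upd_ext.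
exact: exec_zero.
Qed.

Lemma Gen_for n g : E2 n -> Gen (fun w e => g w (behead e) (nth 0 e 0)) ->
  Gen (fun w e => flatten [seq g w e i | i <- iota 0 (n w e)]).
Proof.
move=> [an [Hbn Hn]] [ag Hg].
pose X (w : seq bool) e := size w + sumn e + 2.
set A := an + (an + 1 + 0 + 2) * ag + 1.
exists A => env b Henv.
have Henv2 := all_lt_weak (leq_addr 2 b) Henv.
have Hun : usable env b (b + 2) by split=> //; [lia|apply: notin_ge Henv _].
have Hug : all (fun r => r < b + 2) (b + 1 :: env) by rewrite /= Henv2; lia.
have [cn Hcn] := Hn _ _ _ Hun; have [cg Hcg] := Hg _ _ Hug.
exists (CSeq cn (CSeq (CLoop b (CSeq cg (CInc (b + 1)))) (CLoop (b + 1) CSkip))).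
move=> w rg out V Hz HV; set e := map rg env in HV *.
have X1 : 1 < X w e by rewrite /X; lia.
have HXV a : a <= A -> X w e ^ a <= V.
  by move=> Ha; apply: leq_trans HV; apply: leq_Xpow.
have Hzr i : rg (b + i) = 0 by rewrite Hz ?leq_addr.
have Hb0 : rg b = 0 by rewrite Hz.
apply: ex_seq.
  apply: Hcn; first by move=> r Hr; rewrite Hz //; lia.
  by rewrite Hb0; apply: HXV; rewrite /A; lia.
rewrite Hb0 add0n -/e; set nv := n w e.
have Hnv : nv <= X w e ^ an by apply: Hbn.
pose S k m := upd (upd rg b k) (b + 1) m.
have -> : upd rg b nv = S nv 0 by upd_cases S Hzr Hb0.
have HSe k m : map (S k m) env = e.
  by rewrite /S !map_upd //; apply: notin_ge Henv _; lia.
have Hstep k m o : m + k.+1 = nv -> exec w V (CSeq cg (CInc (b + 1)))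
   (Store (S k m) 0 o) (Store (S k m.+1) 0 (o ++ g w e m)).
  move=> Hmk.
  have Em : map (S k m) (b + 1 :: env) = m :: e.
    by rewrite /= HSe /S updE.
  apply: ex_seq.
    apply: Hcg; first by move=> r Hr; rewrite /S !updN ?Hz //; lia.
    rewrite Em; apply: leq_trans (HXV ((an + 1 + 0 + 2) * ag) _); last by rewrite /A; lia.
    rewrite expnM; case: (ag) => // ag'; rewrite leq_exp2r //.
    have -> : size w + sumn (m :: e) + 2 = m + X w e + 0 by rewrite /X /=; lia.
    by apply: pow_sum3; rewrite ?expn1 //; lia.
  rewrite Em /=.
  have -> : S k m.+1 = upd (S k m) (b + 1) (S k m (b + 1)).+1.
    by rewrite /S updE; upd_ext.
  apply: ex_inc; rewrite /S updE.
  have : X w e ^ an <= V by apply: HXV; rewrite /A; lia.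
  by lia.
apply: (@ex_seq _ _ _ _ _ (Store (S 0 nv) 0 (out ++ flatten [seq g w e i | i <- iota 0 nv]))).
  suff H k m o : m + k = nv -> exec w V (CLoop b (CSeq cg (CInc (b + 1))))
     (Store (S k m) 0 o) (Store (S 0 nv) 0 (o ++ flatten [seq g w e i | i <- iota m k])).
    by apply: H.
  elim: k m o => [|k IH] m o Hk.
    have -> : m = nv by lia.
    rewrite cats0; apply: ex_loop0; rewrite /S /= updN ?updE //; lia.
  apply: (ex_loopS (v := k)).
  - by rewrite /S updN ?updE //; lia.
  - have -> : upd (S k.+1 m) b k = S k m by rewrite /S; upd_ext.
    by apply: Hstep; lia.
  - by rewrite /= catA; apply: IH; lia.
set o := _ ++ _.
have -> : Store rg 0 o = Store (upd (S 0 nv) (b + 1) 0) 0 o.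
  by congr Store; upd_cases S Hzr Hb0.
exact: exec_zero.
Qed.

Definition shr (n i : nat) := nrec i n (fun _ v => v./2).

Lemma shr_le n i : shr n i <= n.
Proof. by elim: i => //= i; rewrite /shr /=; lia. Qed.

Lemma E2_shr f g : E2 f -> E2 g -> E2 (fun w e => shr (f w e) (g w e)).
Proof.
move=> Hf Hg; apply: (E2_recb (p := f)) => //.
- exact: E2_pb.
- by move=> w e m _; apply: shr_le.
- by apply: E2_half; e2var.
Qed.

Lemma shr_half n i : shr n i.+1 = shr n./2 i.
Proof. by elim: i => //= i; rewrite /shr /= => ->. Qed.

(** The digits are enumerated up to index [n] instead of the length of [nbits n], which would have
    to be computed; shifts beyond the top bit are zero and emit nothing. *)
Lemma enc_natE n : enc_nat n =
  flatten [seq (if shr n i == 0 then [::] else [:: false; odd (shr n i)]) | i <- iota 0 n]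
  ++ [:: true; false].
Proof.
rewrite /enc_nat /nbits; congr (_ ++ _); move: {1 5}n => f.
elim: f n => [|f IH] [|n] //=.
  by elim: (iota 1 f) => //= i r <-; have -> : shr 0 i = 0 by have := shr_le 0 i; lia.
rewrite IH -[1]addn0 iotaDl -map_comp; congr [:: _, _ & flatten _].
by apply: eq_map => i; rewrite /= -[in RHS]add1n shr_half.
Qed.

Lemma Gen_bit p : E2b p -> Gen (fun w e => [:: p w e]).
Proof.
move=> Hp; apply: (@Gen_ext (fun w e => if p w e then [:: true] else [:: false])).
  by move=> w e; case: (p w e).
by apply: Gen_if => //; apply: Gen_const.
Qed.

Lemma Gen_enc_nat f : E2 f -> Gen (fun w e => enc_nat (f w e)).
Proof.
move=> Hf; have Hg : Gen (fun w e =>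
  flatten [seq (if shr (f w e) i == 0 then [::] else [:: false; odd (shr (f w e) i)]) | i <- iota 0 (f w e)]).
  apply: (@Gen_for f (fun w e i => if shr (f w e) i == 0 then [::] else [:: false; odd (shr (f w e) i)])) => //.
  have Hs : E2 (fun w e => shr (f w (behead e)) (nth 0 e 0)).
    by apply: E2_shr; [apply: E2_behead|e2var].
  apply: Gen_if; [exact: E2b_eq0|exact: Gen_nil|].
  by apply: (Gen_cat (Gen_const [:: false])); apply: Gen_bit; apply: E2b_odd.
by apply: Gen_ext (Gen_cat Hg (Gen_const [:: true; false])) => w e; rewrite -enc_natE.
Qed.

(** From [n + 2 <= 2 ^ L.+2], which holds for [n = 0] as well, the logarithm of the power is at most
    [L.+2 * a]. *)
Lemma log_bound n a : trunc_log 2 ((n + 2) ^ a) + 4 <= (2 * a + 4) * (trunc_log 2 n).+1.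
Proof.
set L := trunc_log 2 n.
have Hn : n + 2 <= 2 ^ L.+2.
  have := trunc_log_ltn n (isT : 1 < 2); rewrite -/L [2 ^ L.+2]expnS.
  have : 0 < 2 ^ L by rewrite expn_gt0.
  by rewrite !expnS; lia.
have H : (n + 2) ^ a <= 2 ^ (L.+2 * a).
  by rewrite expnM; case: (a) => // a'; rewrite leq_exp2r.
have : trunc_log 2 ((n + 2) ^ a) <= L.+2 * a.
  by rewrite -(trunc_expnK (L.+2 * a) (isT : 1 < 2)); apply: leq_trunc_log.
nia.
Qed.

Theorem Gen_logspace g : Gen g -> logspace_computable (fun w => g w [::]).
Proof.
move=> [a Hg]; have [c Hc] := Hg [::] 0 isT.
have Hex w : exec w ((size w + 2) ^ a) c (Store (fun=> 0) 0 [::]) (Store (fun=> 0) 0 (g w [::])).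
  by have := Hc w (fun=> 0) [::] ((size w + 2) ^ a); rewrite /= addn0; apply.
exists (prog c 0), (2 * a + 4); split=> [w t|w].
  have [H _] := prog_run 0 (Hex w); apply: leq_trans (H t) _; exact: log_bound.
have [_ [t [H1 H2 _]]] := prog_run 0 (Hex w).
by exists t.
Qed.

(** The space bound of [in_PSPACE] uses a single constant as factor, exponent and summand; this one
    is chosen with ample slack. *)
Lemma poly_bound A c n : (n ^ c + c + n + 2) * A + 4 <=
  (A * (c + 10) + c + 10) * n ^ (A * (c + 10) + c + 10) + (A * (c + 10) + c + 10).
Proof.
set C := A * (c + 10) + c + 10.
have H1 : n ^ c <= n ^ C + 1.
  case: (posnP n) => [->|Hn]; first by apply: (@leq_trans 1); [by case: (c) => [//|c2]; rewrite exp0n|lia].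
  by apply: leq_trans (leq_addr _ _); rewrite leq_pexp2l // /C; lia.
have H2 : n <= n ^ C.
  case: (posnP n) => [->//|Hn]; rewrite -{1}[n]expn1 leq_pexp2l // /C; lia.
have : (n ^ c + c + n + 2) * A <= (2 * n ^ C + c + 3) * A by rewrite leq_mul2r; lia.
rewrite /C; move: (n ^ _) => Y; nia.
Qed.

(** A padding argument: given [N = 2 ^ (size w ^ c + c)] as an argument, a function may use values
    polynomial in [N], and these still have polynomially many bits. The program terminates on every
    string, also off the promise. *)
Theorem E2_PSPACE (P : promise_problem) (f : seq bool -> nat -> bool) (c : nat) :
  E2b (fun w e => f w (nth 0 e 0)) ->
  (forall w, P.1 w -> f w (2 ^ (size w ^ c + c))) ->
  (forall w, P.2 w -> ~~ f w (2 ^ (size w ^ c + c))) ->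
  in_PSPACE P.
Proof.
move=> [a [Hb Hf]] HP1 HP2.
have [aE [HbE HE]] : E2 (fun w e => size w ^ c + c).
  by apply: E2_add; [apply: E2_expc E2_size|apply: E2_const].
have [cE HcE] := HE [::] 2 4 (And3 isT isT isT).
have [cf Hcf] := Hf [:: 0] 1 2 (And3 isT isT isT).
(* Register 2 receives the exponent, register 0 the power, built by doublings through register 3,
   and register 1 the answer. *)
pose CD := CSeq (CLoop 0 (CSeq (CInc 3) (CInc 3))) (CLoop 3 (CInc 0)).
pose cc := CSeq cE (CSeq (CInc 0) (CSeq (CLoop 2 CD) cf)).
pose E (w : seq bool) := size w ^ c + c; pose N w := 2 ^ E w.
pose A := aE + a.
pose V w := 2 ^ ((E w + size w + 2) * A.+1).
have HX w : size w + N w + 2 <= 2 ^ (E w + size w + 2).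
  rewrite (expnD 2 (E w + size w)) (expnD 2 (E w)) /N; have := ltn_expl (size w) (isT : 1 < 2).
  have : 0 < 2 ^ E w by rewrite expn_gt0.
  rewrite (_ : 2 ^ 2 = 4) //; move: (2 ^ E w) (size w) (2 ^ size w) => [|x] n [|y] // _ Hn; nia.
have HV w b : b <= A.+1 -> (size w + N w + 2) ^ b <= V w.
  move=> Hb1; apply: (@leq_trans ((2 ^ (E w + size w + 2)) ^ b)).
    by case: b {Hb1} => // b; rewrite leq_exp2r.
  by rewrite /V -expnM leq_exp2l // leq_mul2l Hb1 orbT.
have HNV w : N w <= V w.
  by apply: leq_trans (HV w 1 isT); rewrite expn1; lia.
have Hex w : exists rg, exec w (V w) cc (Store (fun=> 0) 0 [::]) (Store rg 0 [::]) /\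
    (rg 1 != 0) = f w (N w).
  pose S n k := upd (upd (fun=> 0) 0 n) 2 k.
  exists (upd (S (N w) 0) 1 (f w (N w))); split; last first.
    by rewrite updE; case: (f w _).
  apply: ex_seq.
    apply: HcE => //=; rewrite add0n.
    apply: leq_trans (HV w aE _); last by rewrite /A; lia.
    by case: (aE) => // aE'; rewrite leq_exp2r //; lia.
  rewrite add0n -/(E w).
  apply: ex_seq.
    by apply: ex_inc; rewrite updN //; apply: leq_trans (HNV w); rewrite expn_gt0.
  have -> : upd (upd (fun=> 0) 2 (E w)) 0 (upd (fun=> 0) 2 (E w) 0).+1 = S (2 ^ 0) (E w).
    by rewrite /S; upd_ext.
  apply: (@ex_seq _ _ _ _ _ (Store (S (N w) 0) 0 [::])).
    suff H k m : m + k = E w -> exec w (V w) (CLoop 2 CD) (Store (S (2 ^ m) k) 0 [::]) (Store (S (N w) 0) 0 [::]).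
      by apply: H.
    elim: k m => [|k IH] m Hmk.
      by rewrite addn0 in Hmk; rewrite Hmk; apply: ex_loop0.
    apply: (ex_loopS (v := k)) => //; last by apply: (IH m.+1); lia.
    have -> : upd (S (2 ^ m) k.+1) 2 k = S (2 ^ m) k by rewrite /S; upd_ext.
    have HmV : 2 ^ m.+1 <= V w.
      by apply: leq_trans (HNV w); rewrite /N leq_exp2l //; lia.
    have Hm2 : 2 ^ m.+1 = 2 ^ m * 2 by rewrite expnS mulnC.
    apply: (@ex_seq _ _ _ _ _ (Store (upd (S 0 k) 3 (2 ^ m.+1)) 0 [::])).
      have H i j : i * 2 + j = 2 ^ m.+1 -> exec w (V w) (CLoop 0 (CSeq (CInc 3) (CInc 3)))
          (Store (upd (S i k) 3 j) 0 [::]) (Store (upd (S 0 k) 3 (2 ^ m.+1)) 0 [::]).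
        elim: i j => [|i IHi] j Hij.
          by rewrite -Hij; apply: ex_loop0.
        apply: (ex_loopS (v := i)) => //; last by apply: (IHi j.+2); lia.
        apply: ex_seq; first by apply: ex_inc; rewrite /upd /=; lia.
        have -> : upd (S i k) 3 j.+2 = upd (upd (upd (upd (S i.+1 k) 3 j) 0 i) 3 j.+1) 3 j.+2.
          by rewrite /S; upd_ext.
        by apply: ex_inc; rewrite /upd /=; lia.
      have := H (2 ^ m) 0; rewrite addn0 -Hm2 => /(_ erefl).
      by congr exec; congr Store; rewrite /S; upd_ext.
    have -> : S (2 ^ m.+1) k = upd (upd (upd (S 0 k) 3 (2 ^ m.+1)) 0
         (upd (S 0 k) 3 (2 ^ m.+1) 0 + upd (S 0 k) 3 (2 ^ m.+1) 3)) 3 0.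
      by rewrite /S; upd_ext.
    by apply: exec_move.
  have := Hcf w (S (N w) 0) [::] (V w); rewrite /= /S /upd /= addn0 add0n; apply.
    by case=> [|[|[|r]]].
  by apply: HV; rewrite /A; lia.
pose C := A.+1 * (c + 10) + c + 10.
exists (prog cc 1), C; split=> [w t|w].
  have [rg [Hrg _]] := Hex w; have [H _] := prog_run 1 Hrg.
  apply: leq_trans (H t) _; rewrite /V trunc_expnK //; exact: poly_bound.
have [rg [Hrg Ef]] := Hex w; have [_ [t [H1 H2 H3]]] := prog_run 1 Hrg.
split; first by exists t.
split=> [/HP1|/HP2] HP; exists t; rewrite H1 H3 Ef //.
Qed.

(** * Parsing an instance *)

Ltac e2user := fail.
Ltac e2step :=
  lazymatch goal with
  | |- E2 (fun _ _ => ?c) => exact: (E2_const c)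
  | |- E2 (fun w _ => size w) => exact: E2_size
  | |- E2 (fun _ e => nth 0 (@?s e) ?i) => e2var
  | |- E2 (fun w e => addn (@?a w e) (@?b w e)) => apply: (@E2_add a b)
  | |- E2 (fun w e => muln (@?a w e) (@?b w e)) => apply: (@E2_mul a b)
  | |- E2 (fun w e => subn (@?a w e) (@?b w e)) => apply: (@E2_sub a b)
  | |- E2 (fun w e => divn (@?a w e) (@?b w e)) => apply: (@E2_div a b)
  | |- E2 (fun w e => modn (@?a w e) (@?b w e)) => apply: (@E2_mod a b)
  | |- E2 (fun w e => minn (@?a w e) (@?b w e)) => apply: (@E2_minn a b)
  | |- E2 (fun w e => expn (@?a w e) ?k) => apply: (@E2_expc a k)
  | |- E2 (fun w e => S (@?a w e)) => apply: (@E2_succ a)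
  | |- E2 (fun w e => predn (@?a w e)) => apply: (@E2_pred a)
  | |- E2 (fun w e => half (@?a w e)) => apply: (@E2_half a)
  | |- E2 (fun w e => double (@?a w e)) => apply: (@E2_double a)
  | |- E2 (fun w e => nth 0 ?s (@?a w e)) => apply: (@E2_table s a)
  | |- E2 (fun w e => inp w (@?a w e)) => apply: (@E2_inp a)
  | |- E2 (fun w e => bfind (@?n w e) (@?p w e)) => apply: (@E2_bfind n p)
  | |- E2 (fun w e => nat_of_bool (negb (@?a w e))) => apply: (@E2b_not a)
  | |- E2 (fun w e => nat_of_bool (andb (@?a w e) (@?b w e))) => apply: (@E2b_and a b)
  | |- E2 (fun w e => nat_of_bool (orb (@?a w e) (@?b w e))) => apply: (@E2b_or a b)
  | |- E2 (fun w e => nat_of_bool (eq_op (@?a w e) (@?b w e))) => apply: (@E2b_eq a b)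
  | |- E2 (fun w e => nat_of_bool (leq (@?a w e) (@?b w e))) => apply: (@E2b_leq a b)
  | |- E2 (fun w e => nat_of_bool (odd (@?a w e))) => apply: (@E2b_odd a)
  | |- E2 (fun w e => nat_of_bool (bex (@?n w e) (@?p w e))) => apply: (@E2b_bex n p)
  | |- E2 (fun w e => nat_of_bool (ball (@?n w e) (@?p w e))) => apply: (@E2b_ball n p)
  | |- _ => first [e2user | apply: E2b_if | apply: E2_if]
  end; cbv beta.
Ltac e2 := repeat e2step.

(* Read two by two, the bits of an encoding are the digits 0 and 1, the end 2
   of a number and the end 3 of a list. *)
Definition tok (w : seq bool) (i : nat) : nat :=
  (inp w i.*2 == 2).*2 + (inp w i.*2.+1 == 2).

Lemma E2_tok f : E2 f -> E2 (fun w e => tok w (f w e)).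
Proof. by apply: E2_app1; rewrite /tok; e2. Qed.

Definition tok_end (x : nat) w p := p + bfind (size w) (fun i => tok w (p + i) == x).
Definition past x w p := (tok_end x w p).+1.
Definition past_iter x w j p := nrec j p (fun _ => past x w).

Ltac e2user ::= lazymatch goal with
  | |- E2 (fun w e => tok w (@?a w e)) => apply: (@E2_tok a)
  end.

Lemma E2_tok_end x f : E2 f -> E2 (fun w e => tok_end x w (f w e)).
Proof. by apply: (E2_app1 (F := tok_end x)); rewrite /tok_end; e2. Qed.

Lemma E2_past x f : E2 f -> E2 (fun w e => past x w (f w e)).
Proof. by move=> H; apply: E2_succ; apply: E2_tok_end. Qed.

Lemma bfind_le n p : bfind n p <= n.
Proof. by rewrite /bfind -[X in _ <= X](size_iota 0 n) find_size. Qed.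

Lemma past_iter_le x w j p : past_iter x w j p <= p + j * (size w).+1.
Proof.
elim: j => [|j IH]; first by rewrite addn0.
have -> : past_iter x w j.+1 p = past x w (past_iter x w j p) by [].
rewrite /past /tok_end; have := bfind_le (size w) (fun i => tok w (past_iter x w j p + i) == x).
rewrite mulSn; lia.
Qed.

Lemma E2_past_iter x f g : E2 f -> E2 g -> E2 (fun w e => past_iter x w (f w e) (g w e)).
Proof.
apply: (E2_app2 (F := past_iter x)).
apply: (E2_recb (p := fun w e => nth 0 e 1 + nth 0 e 0 * (size w).+1)); e2.
- by apply: E2_pb; e2.
- move=> w e m Hm; apply: leq_trans (past_iter_le _ _ _ _) _.
  by rewrite leq_add2l leq_mul2r Hm orbT.
- by apply: E2_past; e2.
Qed.

Ltac e2user ::= lazymatch goal with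
  | |- E2 (fun w e => tok w (@?a w e)) => apply: (@E2_tok a)
  | |- E2 (fun w e => tok_end ?x w (@?a w e)) => apply: (@E2_tok_end x a)
  | |- E2 (fun w e => past ?x w (@?a w e)) => apply: (@E2_past x a)
  | |- E2 (fun w e => past_iter ?x w (@?a w e) (@?b w e)) => apply: (@E2_past_iter x a b)
  end.

(** Horner's rule from the most significant digit, which stands last. The cap [N] provides the bound
    that recursion requires on every input string. *)
Definition num_at w N p :=
  nrec (tok_end 2 w p - p) 0 (fun m v => minn N (v.*2 + tok w (tok_end 2 w p - m.+1))).

Lemma E2_pnum f g : E2 f -> E2 g -> E2 (fun w e => num_at w (f w e) (g w e)).
Proof.
apply: E2_app2; apply: (E2_recb (p := fun w e => nth 0 e 0)); e2.
- by apply: E2_pb; e2.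
- by move=> w e [|m] Hm //=; apply: geq_minl.
Qed.

Definition mem_nats w N p x := bex (size w) (fun j =>
  (past_iter 2 w j p < tok_end 3 w p) && (num_at w N (past_iter 2 w j p) == x)).
Definition mem_trans w N p q a q' := bex (size w) (fun j =>
  [&& past_iter 2 w (3 * j) p < tok_end 3 w p, num_at w N (past_iter 2 w (3 * j) p) == q,
      num_at w N (past 2 w (past_iter 2 w (3 * j) p)) == a &
      num_at w N (past 2 w (past 2 w (past_iter 2 w (3 * j) p))) == q']).
(* [2 ^ x] capped by [N], since recursion must stay polynomial in its arguments. *)
Definition cap_pow2 N x := nrec x 1 (fun _ v => minn N v.*2).

Lemma E2_pw f g : E2 f -> E2 g -> E2 (fun w e => cap_pow2 (f w e) (g w e)).
Proof.
apply: (@E2_app2 (fun w => cap_pow2)); apply: (E2_recb (p := fun w e => (nth 0 e 0).+1)); e2.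
- by apply: E2_pb; e2.
- by move=> w e [|m] Hm //=; apply: leq_trans (geq_minl _ _) _.
Qed.

(** The base is [2 ^ size w] because a number written inside [w] has fewer than [size w] bits. *)
Definition aut_state (w : seq bool) N u i := (u %/ cap_pow2 N (size w * i)) %% cap_pow2 N (size w).
(* The encoding of an automaton contains exactly three end-of-list tokens. *)
Definition aut_pos w i := past_iter 3 w (3 * i) (past 2 w 0).
(** An automaton begins with a number, whose first token is a digit or a 2; a 3 in this place can
    only close the list of automata. *)
Definition aut_count w := bfind (size w) (fun i => tok w (aut_pos w i) == 3).

Ltac e2user ::= lazymatch goal with
  | |- E2 (fun w e => tok w (@?a w e)) => apply: (@E2_tok a)
  | |- E2 (fun w e => tok_end ?x w (@?a w e)) => apply: (@E2_tok_end x a)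
  | |- E2 (fun w e => past ?x w (@?a w e)) => apply: (@E2_past x a)
  | |- E2 (fun w e => past_iter ?x w (@?a w e) (@?b w e)) => apply: (@E2_past_iter x a b)
  | |- E2 (fun w e => num_at w (@?a w e) (@?b w e)) => apply: (@E2_pnum a b)
  | |- E2 (fun w e => cap_pow2 (@?a w e) (@?b w e)) => apply: (@E2_pw a b)
  | |- E2 (fun w e => aut_state w (@?a w e) (@?b w e) (@?c w e)) => rewrite /aut_state
  | |- E2 (fun w e => aut_pos w (@?a w e)) => rewrite /aut_pos
  | |- E2 (fun w e => aut_count w) => rewrite /aut_count
  end.

Lemma E2_mem1 f g h : E2 f -> E2 g -> E2 h ->
  E2b (fun w e => mem_nats w (f w e) (g w e) (h w e)).
Proof.
by move=> Hf Hg Hh; apply: (E2_app3 (F := fun w x y z => nat_of_bool (mem_nats w x y z))) => //; rewrite /mem_nats; e2.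
Qed.

Definition isinit w N u := ball (aut_count w) (fun i => mem_nats w N (past 2 w (aut_pos w i)) (aut_state w N u i)).
Definition isfin w N u := ball (aut_count w) (fun i => mem_nats w N (past 3 w (aut_pos w i)) (aut_state w N u i)).
Definition letstep w N u v a :=
  ball (aut_count w) (fun i => mem_trans w N (past 3 w (past 3 w (aut_pos w i))) (aut_state w N u i) a (aut_state w N v i)).
(** Made reflexive so that paths of length at most [2 ^ k] and of length exactly [2 ^ k] connect the
    same pairs, as halving requires. *)
Definition isstep w N u v := (u == v) || bex (cap_pow2 N (size w)) (letstep w N u v).

Lemma E2_isinit : E2b (fun w e => isinit w (nth 0 e 0) (nth 0 e 1)).
Proof.
rewrite /isinit; apply: (E2b_ball (p := fun w e i => mem_nats w _ _ _)); first by e2.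
by apply: E2_mem1; e2.
Qed.

Lemma E2_isfin : E2b (fun w e => isfin w (nth 0 e 0) (nth 0 e 1)).
Proof.
rewrite /isfin; apply: (E2b_ball (p := fun w e i => mem_nats w _ _ _)); first by e2.
by apply: E2_mem1; e2.
Qed.

Lemma E2_letstep f g h k : E2 f -> E2 g -> E2 h -> E2 k ->
  E2b (fun w e => letstep w (f w e) (g w e) (h w e) (k w e)).
Proof.
move=> Hf Hg Hh Hk.
by apply: (E2_app4 (F := fun w x y z t => nat_of_bool (letstep w x y z t))) => //; rewrite /letstep /mem_trans; e2.
Qed.

Lemma E2_isstep f g h : E2 f -> E2 g -> E2 h ->
  E2b (fun w e => isstep w (f w e) (g w e) (h w e)).
Proof.
move=> Hf Hg Hh.
apply: (E2_app3 (F := fun w x y z => nat_of_bool (isstep w x y z))) => //; rewrite /isstep.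
apply: E2b_or; first by e2.
apply: (E2b_bex (p := fun w e x => letstep w _ _ _ x)); first by e2.
by apply: E2_letstep; e2.
Qed.

(** * Savitch's algorithm on an odometer *)

(** [P j] stands for [D ^ j]. It is kept abstract because the program works with the capped
    [dig_weight], and the proof with true powers. *)
Definition dgt (P : nat -> nat) (j A : nat) := (A %/ P j) %% P 1.
(** Going up from a leaf of value [v], a node is settled by its last child, or by [v] itself: true
    settles a disjunction ([j] odd), false a conjunction. The result is the first level at which a
    sibling is still to be visited, and [T] if even the root is settled. *)
Definition lev (P : nat -> nat) (T A : nat) (v : bool) :=
  bfind T (fun j => ~~ ((dgt P j A == (P 1).-1) || (if odd j then v else ~~ v))).
(** Once the root is settled the position becomes [P T] or [(P T).+1], according to the value of the
    root, and stays there: the counter itself carries the answer. *)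
Definition nextA (P : nat -> nat) (T N : nat) (lf : nat -> bool) (A : nat) :=
  if P T <= A then A else
  minn N (if lev P T A (lf A) == T then P T + lf A
          else (A %/ P (lev P T A (lf A))).+1 * P (lev P T A (lf A))).
Definition odometer (P : nat -> nat) (T N : nat) (lf : nat -> bool) : nat :=
  nrec (P T) 0 (fun _ => nextA P T N lf).
(* A position of the odometer is a play: at each round, a midpoint and then the
   half, second (odd digit) or first, that remains to be connected.  The current
   left (resp. right) end is the last midpoint chosen with an odd (resp. even)
   digit. *)
Definition last_mid (P : nat -> nat) (k : nat) (b : bool) (A u : nat) := nrec k u (fun m c =>
  if odd (dgt P (2 * (k - m.+1)) A) == b :> nat then dgt P (2 * (k - m.+1)).+1 A else c).

Section Odometer.
Variables (D T N : nat) (lf : nat -> bool).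
Hypotheses (D0 : 0 < D) (HN : D ^ T < N).
Let P j := D ^ j.

(* The value of a node of the game tree: leaves are numbered by their base-D
   expansion, and the players alternate with the parity of the height. *)
Fixpoint gval (j A : nat) : bool :=
  if j is i.+1 then
    (if odd i then has else all) (fun d => gval i (A * D + d)) (iota 0 D)
  else lf A.

Let sc (j : nat) (v : bool) := if odd j then v else ~~ v.

(** The structural form of [nextA]: [A] is a node of height [j] just found to have value [v], with
    [f] levels above it. *)
Fixpoint climb (f j A : nat) (v : bool) : nat :=
  if f is f'.+1 then
    if (A %% D == D.-1) || sc j v then climb f' j.+1 (A %/ D) v else A.+1 * D ^ j
  else D ^ T + v.

Lemma climb_find f j A v : climb f j (A %/ D ^ j) v =
  let i := find (fun j => ~~ ((dgt P j A == (P 1).-1) || sc j v)) (iota j f) in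
  if i == f then D ^ T + v else (A %/ D ^ (j + i)).+1 * D ^ (j + i).
Proof.
elim: f j => [//|f IH] j.
rewrite [climb _ _ _ _]/= [iota _ _]/= [find _ _]/=.
have -> : (dgt P j A == (P 1).-1) = ((A %/ D ^ j) %% D == D.-1).
  by rewrite /dgt /P expn1.
case: ifP => Hc /=; last by rewrite addn0.
by rewrite -divnMA -expnSr IH /= eqSS addSnnS.
Qed.

Lemma nextA_climb A : A < D ^ T -> nextA P T N lf A = climb T 0 A (lf A).
Proof.
move=> HA; rewrite /nextA {1}/P leqNgt HA /=.
have := climb_find T 0 A (lf A); rewrite expn0 divn1 => -> /=; rewrite -/(bfind T _) -/(lev P T A (lf A)).
set l := lev _ _ _ _; rewrite add0n; apply/minn_idPr.
case: eqP => Hl; first by case: (lf A); rewrite /P; lia.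
apply: leq_trans (ltnW HN).
have HlT : l < T by rewrite ltn_neqAle bfind_le andbT; apply/eqP.
rewrite /P -(subnK (ltnW HlT)) expnD leq_mul2r.
by rewrite ltn_divLR ?expn_gt0 ?D0 // -expnD subnK ?HA ?orbT // ltnW.
Qed.

(** Started on the leftmost leaf below the node [Q] of height [j], the odometer leaves the subtree
    after at most [D ^ j] steps, exactly as if [Q] were a leaf of value [gval j Q]. *)
Lemma climb_claim j Q : j <= T -> Q < D ^ (T - j) ->
  exists2 t, t <= D ^ j & iter t (nextA P T N lf) (Q * D ^ j) = climb (T - j) j Q (gval j Q).
Proof.
elim: j Q => [|j IH] Q Hj HQ.
  exists 1; rewrite ?expn0 // muln1 subn0 /= nextA_climb //.
  by rewrite subn0 in HQ.
have HTj : T - j = (T - j.+1).+1 by lia.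
(* [e] counts the children of [Q] still to be visited. A short cut or the last child leads upwards,
   any other child to its right neighbour. *)
have H e : 0 < e <= D -> exists2 t, t <= e * D ^ j &
   iter t (nextA P T N lf) ((Q * D + (D - e)) * D ^ j) =
   climb (T - j.+1) j.+1 Q ((if odd j then has else all) (fun d => gval j (Q * D + d)) (iota (D - e) e)).
  elim: e => [//|e IHe] He.
  set d := D - e.+1; have HdD : d < D by rewrite /d; lia.
  have HQd : Q * D + d < D ^ (T - j).
    rewrite HTj expnSr; apply: (@leq_trans (Q.+1 * D)); first by rewrite mulSn; lia.
    by rewrite leq_mul2r HQ orbT.
  have [t Ht Et] := IH (Q * D + d) (ltnW Hj) HQd.
  have Emod : (Q * D + d) %% D = d by rewrite modnMDl modn_small.
  have Ediv : (Q * D + d) %/ D = Q by rewrite divnMDl // divn_small // addn0.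
  move: Et; rewrite HTj [climb _.+1 _ _ _]/= Emod Ediv.
  case: ifP => [Hc Et|/negbT Hc Et].
    exists t; first by apply: leq_trans Ht _; rewrite mulSn leq_addr.
    rewrite Et; congr climb; move: Hc; rewrite /sc /=.
    case: (posnP e) => [E0 _|He0]; first by rewrite E0 /=; case: (odd j) => /=; rewrite ?orbF ?andbT.
    have -> : (d == D.-1) = false by rewrite /d; lia.
    by case: (odd j) => /=; case: (gval j (Q * D + d)).
  have He0 : 0 < e by move: Hc; rewrite negb_or /d => /andP [+ _]; lia.
  have [t' Ht' Et'] : exists2 t, t <= e * D ^ j &
   iter t (nextA P T N lf) ((Q * D + (D - e)) * D ^ j) =
   climb (T - j.+1) j.+1 Q ((if odd j then has else all) (fun d => gval j (Q * D + d)) (iota (D - e) e)).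
    by apply: IHe; lia.
  exists (t' + t); first by rewrite mulSn; lia.
  rewrite iterD Et -addnS; have -> : d.+1 = D - e by rewrite /d; lia.
  rewrite Et'; congr climb; move: Hc; rewrite negb_or /sc /= => /andP [_].
  have -> : d.+1 = D - e by rewrite /d; lia.
  by case: (odd j) => /=; case: (gval j (Q * D + d)).
have [t Ht Et] := H D (introT andP (conj D0 (leqnn D))).
exists t; first by rewrite expnS.
by move: Et; rewrite subnn addn0 -mulnA -expnS.
Qed.

Lemma odometerE : odometer P T N lf = D ^ T + gval T 0.
Proof.
have HT0 : 0 < D ^ (T - T) by rewrite expn_gt0 D0.
have [t Ht] := climb_claim (leqnn T) HT0; rewrite mul0n subnn [RHS]/= => Et.
have E n : nrec n 0 (fun _ => nextA P T N lf) = iter n (nextA P T N lf) 0.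
  by elim: n => //= n ->.
have EP : P T = (D ^ T - t) + t by rewrite subnK.
rewrite /odometer E EP iterD Et.
(* Positions from [D ^ T] on are fixed points, so the remaining turns are idle. *)
by elim: (_ - t) => //= n ->; rewrite /nextA {1}/P leq_addr.
Qed.
End Odometer.

(** * Savitch's recursion as the value of a game *)

Section Savitch.
Variables (D k N : nat) (st : nat -> nat -> bool).
Hypotheses (D1 : 1 < D) (HN : D ^ (2 * k) < N) (st_refl : forall x, st x x).
Let P j := D ^ j.
Let D0 : 0 < D := ltnW D1.

Fixpoint savitch (i x y : nat) : bool :=
  if i is j.+1 then has (fun m => savitch j x m && savitch j m y) (iota 0 D)
  else st x y.

Variables (u v : nat).
Let lf A := st (last_mid P k true A u) (last_mid P k false A v).
Let mid A i b x := nrec (k - i) x (fun m c =>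
  if odd (dgt P (2 * (k - m.+1)) A) == b :> nat then dgt P (2 * (k - m.+1)).+1 A else c).

Lemma dgt_prefix i j A A' : A %/ D ^ i = A' %/ D ^ i -> i <= j -> dgt P j A = dgt P j A'.
Proof.
move=> E Hij; rewrite /dgt /P -(subnKC Hij) expnD !divnMA; by rewrite E.
Qed.

Lemma mid_prefix i A A' b x : A %/ D ^ (2 * i) = A' %/ D ^ (2 * i) ->
  mid A i b x = mid A' i b x.
Proof.
move=> E; rewrite /mid.
have H m : m < k - i -> dgt P (2 * (k - m.+1)) A = dgt P (2 * (k - m.+1)) A' /\
  dgt P (2 * (k - m.+1)).+1 A = dgt P (2 * (k - m.+1)).+1 A'.
  by move=> Hm; split; apply: (dgt_prefix E); lia.
elim: (k - i) H => //= n IH H.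
by have [-> ->] := H n (ltnSn n); rewrite IH // => m Hm; apply: H; apply: leqW.
Qed.

(** A round uses two digits: the upper one, at an odd level, is the existential choice of a
    midpoint; the parity of the lower one is the universal choice of a half. The current ends depend
    only on the digits above, by [mid_prefix]. *)
Lemma gval_savitch i A : i <= k ->
  gval D lf (2 * i) (A %/ D ^ (2 * i)) = savitch i (mid A i true u) (mid A i false v).
Proof.
elim: i A => [|i IH] A Hi.
  by rewrite muln0 expn0 divn1 /= /lf /last_mid /mid subn0.
have -> : 2 * i.+1 = (2 * i).+2 by lia.
set Q := A %/ _; rewrite [LHS]/= mul2n odd_double /=.
have Hval d b : d < D -> b < D -> gval D lf i.*2 ((Q * D + d) * D + b) =
   if odd b then savitch i d (mid A i.+1 false v) else savitch i (mid A i.+1 true u) d.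
  move=> Hd Hb; set B := (_ * D + b); pose A' := B * D ^ (2 * i).
  have EB : A' %/ D ^ (2 * i) = B by rewrite /A' mulnK // expn_gt0 D0.
  have Ed0 : dgt P (2 * i) A' = b.
    by rewrite /dgt /P EB expn1 /B modnMDl modn_small.
  have Ed1 : dgt P (2 * i).+1 A' = d.
    by rewrite /dgt /P expnSr divnMA EB expn1 /B divnMDl // (divn_small Hb) addn0 modnMDl modn_small.
  have EQ : A' %/ D ^ (2 * i.+1) = A %/ D ^ (2 * i.+1).
    have -> : 2 * i.+1 = (2 * i).+2 by lia.
    rewrite 2!expnSr !divnMA EB /B divnMDl // (divn_small Hb) addn0 divnMDl // (divn_small Hd) addn0.
    by rewrite /Q 2!expnSr !divnMA.
  have := IH A' (ltnW Hi); rewrite EB mul2n => ->.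
  have Ek : k - i = (k - i.+1).+1 by rewrite subnSK.
  have Ei : k - (k - i.+1).+1 = i by rewrite -Ek subKn // ltnW.
  have Emid e x : mid A' i e x = if odd b == e :> nat then d else mid A i.+1 e x.
    by rewrite -(mid_prefix _ _ EQ) {1}/mid Ek /= Ei Ed0 Ed1.
  by rewrite !Emid; case: (odd b).
apply: eq_in_has => d; rewrite mem_iota add0n => /andP [_ Hd].
apply/allP/andP => [H|[H1 H2] b].
  (* Only the parity of the lower digit counts, and [1 < D] provides both parities. *)
  have := H 0; have := H 1; rewrite !mem_iota !add0n D1 D0 !Hval //= => -> // -> //.
rewrite mem_iota add0n => /andP [_ Hb]; rewrite Hval //; by case: (odd b).
Qed.

Lemma odometer_savitch : odometer P (2 * k) N lf = D ^ (2 * k) + savitch k u v.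
Proof.
rewrite odometerE //; have := gval_savitch 0 (leqnn k); rewrite div0n => ->.
by rewrite /mid subnn.
Qed.
End Savitch.

(** A path without repetition has fewer than [D <= 2 ^ k] edges; reflexivity of [st] fills up the
    shorter ones. *)
Lemma savitch_connect (D k : nat) (st : nat -> nat -> bool) (x y : 'I_D) :
  (forall x, st x x) -> D <= 2 ^ k ->
  savitch D st k x y = connect (fun x y : 'I_D => st x y) x y.
Proof.
move=> Hrefl HD; apply/idP/idP.
  elim: k {HD} x y => [|k IH] x y /=; first exact: connect1.
  move=> /hasP [m]; rewrite mem_iota add0n => /andP [_ Hm] /andP [H1 H2].
  exact: connect_trans (IH x (Ordinal Hm) H1) (IH (Ordinal Hm) y H2).
move=> /connectP [p /shortenP [q Hq Hu _] ->].
have Hsz : size q <= 2 ^ k.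
  apply: leq_trans HD; have := card_uniqP Hu => /= Hc.
  by have := max_card (mem (x :: q)); rewrite card_ord Hc; lia.
elim: k x q Hq {Hu HD p} Hsz => [|k IH] x q Hq Hsz.
  by case: q Hq Hsz => [|a [|b q]] //=; rewrite andbT.
rewrite /=; apply/hasP; pose q1 := take (2 ^ k) q.
have Eq : q = q1 ++ drop (2 ^ k) q by rewrite cat_take_drop.
move: Hq; rewrite Eq cat_path last_cat => /andP [Hq1 Hq2].
exists (val (last x q1)); first by rewrite mem_iota add0n ltn_ord.
rewrite !IH //.
  by rewrite size_drop; move: Hsz; rewrite expnS; lia.
by rewrite size_take; case: ltnP.
Qed.

Lemma bfind_eq n (P : nat -> bool) i : i < n -> P i -> (forall j, j < i -> ~~ P j) ->
  bfind n P = i.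
Proof.
move=> Hi HP Hlt; rewrite /bfind.
have Hh : has P (iota 0 n) by apply/hasP; exists i => //; rewrite mem_iota.
have Hf : find P (iota 0 n) < n by move: Hh; rewrite has_find size_iota.
case: (ltngtP (find P (iota 0 n)) i) => // H.
  by have := Hlt _ H; have := nth_find 0 Hh; rewrite nth_iota // add0n => ->.
by have := before_find 0 H; rewrite nth_iota // add0n HP.
Qed.

(** * Token strings and the correctness of parsing *)

Definition nat_toks (q : nat) : seq nat := map nat_of_bool (nbits q) ++ [:: 2].
Definition seq_toks (T : Type) (f : T -> seq nat) (s : seq T) : seq nat := flatten (map f s) ++ [:: 3].
Definition trans_toks (t : nat * nat * nat) := nat_toks t.1.1 ++ nat_toks t.1.2 ++ nat_toks t.2.
Definition nfa_toks A := nat_toks (n_states A) ++ seq_toks nat_toks (n_init A) ++ seq_toks nat_toks (n_final A) ++ seq_toks trans_toks (n_trans A).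
Definition inst_toks I := nat_toks (i_alpha I) ++ seq_toks nfa_toks (i_auts I).

Definition tok_bits (t : nat) : seq bool := [:: 1 < t; odd t].
Definition bits_of (ts : seq nat) := flatten (map tok_bits ts).

Lemma bits_of_cat s t : bits_of (s ++ t) = bits_of s ++ bits_of t.
Proof. by rewrite /bits_of map_cat flatten_cat. Qed.

Lemma bits_of_tn q : bits_of (nat_toks q) = enc_nat q.
Proof.
rewrite bits_of_cat /enc_nat; congr (_ ++ _); rewrite /bits_of -map_comp.
by congr flatten; apply: eq_map => -[].
Qed.

Lemma bits_of_tl T (f : T -> seq nat) g s : (forall x, bits_of (f x) = g x) ->
  bits_of (seq_toks f s) = enc_seq g s.
Proof.
move=> H; rewrite bits_of_cat /enc_seq; congr (_ ++ _).
by elim: s => //= x s IH; rewrite bits_of_cat H IH.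
Qed.

Lemma bits_of_nfa A : bits_of (nfa_toks A) = enc_nfa A.
Proof.
rewrite /nfa_toks (bits_of_cat (nat_toks _)) (bits_of_cat (seq_toks nat_toks (n_init A))) (bits_of_cat (seq_toks nat_toks (n_final A))).
rewrite bits_of_tn !(bits_of_tl _ bits_of_tn) /enc_nfa; do 3 congr (_ ++ _).
by apply: bits_of_tl => t; rewrite /trans_toks (bits_of_cat (nat_toks t.1.1)) (bits_of_cat (nat_toks t.1.2)) !bits_of_tn.
Qed.

Lemma bits_of_inst I : bits_of (inst_toks I) = enc_inst I.
Proof.
by rewrite /inst_toks (bits_of_cat (nat_toks _)) bits_of_tn (bits_of_tl _ bits_of_nfa).
Qed.

Lemma inpE w i : (inp w i == 2) = nth false w i.
Proof.
rewrite /inp /=; case: (ltnP i (size w)) => Hi; last by rewrite nth_default.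
by case: (nth _ _ _).
Qed.

Lemma tok_bits_of ts i : all (fun t => t < 4) ts -> tok (bits_of ts) i = nth 0 ts i.
Proof.
move=> H; rewrite /tok !inpE.
have [-> ->] : nth false (bits_of ts) i.*2 = (1 < nth 0 ts i) /\
    nth false (bits_of ts) i.*2.+1 = odd (nth 0 ts i).
  by elim: ts i {H} => [|t ts IH] [|i] //=; rewrite ?nth_nil //; apply: IH.
case: (ltnP i (size ts)) => Hi; last by rewrite nth_default.
by move/(all_nthP 0)/(_ i Hi): H; case: (nth 0 ts i) => [|[|[|[|]]]].
Qed.

Lemma size_bits ts : size (bits_of ts) = (size ts).*2.
Proof. by elim: ts => //= t ts ->. Qed.

(** The bound by [size w], generous since a token takes two bits, makes every search range of the
    parser long enough. *)
Definition toks_at w p ts := p + size ts <= size w /\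
  forall i, i < size ts -> tok w (p + i) = nth 0 ts i.

Lemma at_bits ts : all (fun t => t < 4) ts -> toks_at (bits_of ts) 0 ts.
Proof.
move=> H; split=> [|i Hi]; first by rewrite size_bits; lia.
by rewrite tok_bits_of.
Qed.

Lemma at_cat w p s t : toks_at w p (s ++ t) -> toks_at w (p + size s) t.
Proof.
move=> [H1 H2]; split; first by move: H1; rewrite size_cat; lia.
move=> i Hi; rewrite -addnA H2; last by rewrite size_cat; lia.
by rewrite nth_cat ltnNge leq_addr /= addKn.
Qed.

Lemma at_find w p s x t : toks_at w p (s ++ x :: t) -> x \notin s ->
  bfind (size w) (fun i => tok w (p + i) == x) = size s.
Proof.
move=> [H1 H2] Hx; rewrite size_cat /= in H1 H2; apply: bfind_eq; first by lia.
  by rewrite H2 ?nth_cat ?ltnn ?subnn //; lia.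
move=> j Hj; rewrite H2 ?nth_cat ?Hj; last by lia.
by apply: contraNneq Hx => <-; rewrite mem_nth.
Qed.

Lemma at_f3 w p s t : toks_at w p (s ++ 3 :: t) -> 3 \notin s -> tok_end 3 w p = p + size s.
Proof. by move=> H Hs; rewrite /tok_end (at_find H Hs). Qed.

Lemma at_sk w p s t : toks_at w p (s ++ 3 :: t) -> 3 \notin s -> toks_at w (past 3 w p) t.
Proof.
move=> H Hs; rewrite /past (at_f3 H Hs).
have := @at_cat w p (s ++ [:: 3]) t; rewrite -catA size_cat addn1 addnS; exact.
Qed.

Lemma tn_no3 q : 3 \notin nat_toks q.
Proof. by rewrite mem_cat negb_or andbC /=; apply/mapP => -[[]]. Qed.

Lemma bits_no2 q : 2 \notin map nat_of_bool (nbits q).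
Proof. by apply/mapP => -[[]]. Qed.

Lemma at_f2 w p q t : toks_at w p (nat_toks q ++ t) -> tok_end 2 w p = p + size (nbits q).
Proof.
rewrite /nat_toks -catA => H; rewrite /tok_end.
by rewrite (at_find (t := t) H (bits_no2 q)) size_map.
Qed.

Lemma size_tn q : size (nat_toks q) = (size (nbits q)).+1.
Proof. by rewrite size_cat size_map addn1. Qed.

Lemma nxtE w p q t : toks_at w p (nat_toks q ++ t) -> past 2 w p = p + size (nat_toks q).
Proof. by move=> H; rewrite /past (at_f2 H) size_tn addnS. Qed.

Lemma at_nxt w p q t : toks_at w p (nat_toks q ++ t) -> toks_at w (past 2 w p) t.
Proof. by move=> H; rewrite (nxtE H); apply: at_cat. Qed.

Lemma num_nbits q : num (nbits q) = q.
Proof.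
rewrite /nbits; move: {2 3}q (leqnn q) => f; elim: f q => [|f IH] [|q] //= H.
rewrite IH; last by rewrite leq_uphalf_double; lia.
by rewrite uphalf_half; have := odd_double_half q; case: (odd q) => /=; lia.
Qed.

Lemma num_drop i s : num (drop i s) <= num s.
Proof. by elim: i s => [|i IH] [|b s] //=; have := IH s; lia. Qed.

Lemma at_pnum w N p q t : toks_at w p (nat_toks q ++ t) -> q <= N -> num_at w N p = q.
Proof.
move=> H Hq; rewrite /num_at (at_f2 H) addKn; set L := size (nbits q).
(* After [m] turns the [m] top digits have been read. Such a partial value never exceeds [q <= N],
   so the cap has no effect. *)
suff E m : m <= L -> nrec m 0 (fun m v => minn N (v.*2 + tok w (p + L - m.+1))) = num (drop (L - m) (nbits q)).
  by rewrite E // subnn drop0 num_nbits.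
elim: m => [|m IH] Hm; first by rewrite subn0 drop_size.
rewrite /= IH ?(ltnW Hm) //.
have Hi : L - m.+1 < L by lia.
have -> : p + L - m.+1 = p + (L - m.+1) by lia.
have -> : tok w (p + (L - m.+1)) = nth false (nbits q) (L - m.+1).
  case: H => _ H; rewrite H; last by rewrite size_cat size_tn -/L; lia.
  by rewrite nth_cat size_tn -/L leqW // /nat_toks nth_cat size_map -/L Hi (nth_map false).
rewrite (drop_nth false Hi) /=.
have -> : (L - m.+1).+1 = L - m by lia.
rewrite addnC; apply/minn_idPr; apply: leq_trans Hq.
have := num_drop (L - m.+1) (nbits q); rewrite (drop_nth false Hi) /= num_nbits.
by have -> : (L - m.+1).+1 = L - m by lia.
Qed.

Definition nats_toks (s : seq nat) := flatten (map nat_toks s).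

Lemma tns_no3 s : 3 \notin nats_toks s.
Proof. by elim: s => //= q s IH; rewrite /nats_toks /= mem_cat negb_or tn_no3. Qed.

Lemma size_tns s : size s <= size (nats_toks s).
Proof. by elim: s => //= q s IH; rewrite /nats_toks /= size_cat size_tn; move: IH; rewrite /nats_toks; lia. Qed.

Lemma at_itn w p s t j : toks_at w p (nats_toks s ++ t) -> j <= size s ->
  toks_at w (past_iter 2 w j p) (nats_toks (drop j s) ++ t) /\
  past_iter 2 w j p + size (nats_toks (drop j s)) = p + size (nats_toks s).
Proof.
move=> H; elim: j => [|j IH] Hj; first by rewrite drop0.
have [H1 H2] := IH (ltnW Hj).
move: H1 H2; rewrite (drop_nth 0 Hj) /nats_toks /= -catA => H1 H2.
have E : past_iter 2 w j.+1 p = past 2 w (past_iter 2 w j p) by [].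
split; first by rewrite E; apply: at_nxt H1.
by move: H2; rewrite E (nxtE H1) size_cat; lia.
Qed.

Lemma itn_incr w p j d : past_iter 2 w j p <= past_iter 2 w (j + d) p.
Proof.
elim: d => [|d IH]; first by rewrite addn0.
apply: (leq_trans IH); rewrite addnS.
have -> : past_iter 2 w (j + d).+1 p = past 2 w (past_iter 2 w (j + d) p) by [].
by rewrite /past /tok_end; lia.
Qed.

Lemma itn_lt w p s t j : toks_at w p (nats_toks s ++ 3 :: t) ->
  (past_iter 2 w j p < tok_end 3 w p) = (j < size s).
Proof.
move=> H; rewrite (at_f3 H (tns_no3 s)); case: (ltnP j (size s)) => Hj.
  have [_ <-] := at_itn H (ltnW Hj).
  by rewrite (drop_nth 0 Hj) /nats_toks /= size_cat size_tn; lia.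
have [_ E] := at_itn H (leqnn (size s)).
move: E; rewrite drop_size /= addn0 => <-.
by rewrite ltnNge -(subnKC Hj) itn_incr.
Qed.

Lemma at_small w p s t q : toks_at w p (nats_toks s ++ t) -> q \in s -> q < 2 ^ size w.
Proof.
move=> [H _] Hq; rewrite -{1}[q]num_nbits; apply: leq_trans (num_lt _) _.
rewrite leq_exp2l //; apply: leq_trans (leq_trans (leq_addl p _) H).
rewrite size_cat; apply: leq_trans (leq_addr _ _).
elim: s Hq {H} => //= a s IH; rewrite inE /nats_toks /= size_cat size_tn => /orP [/eqP ->|/IH].
  by lia.
by rewrite /nats_toks; lia.
Qed.

Lemma mem1P w N p s t x : toks_at w p (nats_toks s ++ 3 :: t) -> 2 ^ size w <= N ->
  mem_nats w N p x = (x \in s).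
Proof.
move=> H HN; have Hsm := at_small H; apply/hasP/idP.
  move=> [j]; rewrite mem_iota add0n => /andP [_ Hj]; rewrite (itn_lt j H) => /andP [Hjs].
  have [H1 _] := at_itn H (ltnW Hjs); move: H1; rewrite (drop_nth 0 Hjs) /nats_toks /= -catA => H1.
  rewrite (at_pnum H1) => [/eqP <-|]; first by rewrite mem_nth.
  by apply: leq_trans HN; apply: ltnW; apply: Hsm; rewrite mem_nth.
move=> Hx; have Hj : index x s < size s by rewrite index_mem.
have Hs := size_tns s; exists (index x s).
  rewrite mem_iota add0n; case: H => H _; move: H; rewrite size_cat /=; lia.
rewrite (itn_lt _ H) Hj /=.
have [H1 _] := at_itn H (ltnW Hj); move: H1; rewrite (drop_nth 0 Hj) /nats_toks /= -catA nth_index // => H1.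
by rewrite (at_pnum H1) //; apply: leq_trans HN; apply: ltnW; apply: Hsm.
Qed.

(** A list of transitions is parsed as a flat list of numbers, in which transition [j] begins at
    entry [3 * j]. *)
Definition flat3 (s : seq (nat * nat * nat)) := flatten [seq [:: t.1.1; t.1.2; t.2] | t <- s].

Lemma flat3E s : flatten (map trans_toks s) = nats_toks (flat3 s).
Proof.
elim: s => //= t s; rewrite /nats_toks => ->.
by rewrite /flat3 /= /trans_toks -!catA.
Qed.

Lemma size_flat3 s : size (flat3 s) = 3 * size s.
Proof. by elim: s => //= t s IH; rewrite /flat3 /= -/(flat3 s) IH mulnS. Qed.

Lemma drop_flat3 j s : drop (3 * j) (flat3 s) = flat3 (drop j s).
Proof.
elim: j s => [|j IH] [|t s]; rewrite ?muln0 ?drop0 //.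
by rewrite mulnS /= -IH.
Qed.

Lemma mem3P w N p s t x : toks_at w p (nats_toks (flat3 s) ++ 3 :: t) -> 2 ^ size w <= N ->
  mem_trans w N p x.1.1 x.1.2 x.2 = (x \in s).
Proof.
move=> H HN; have Hsm := at_small H.
have Hin y : y \in s -> [/\ y.1.1 <= N, y.1.2 <= N & y.2 <= N].
  move=> Hy; split; apply: leq_trans HN; apply: ltnW; apply: Hsm;
    by apply/flattenP; exists [:: y.1.1; y.1.2; y.2]; rewrite ?inE ?eqxx ?orbT //; apply/mapP; exists y.
have Hj3 j : (past_iter 2 w (3 * j) p < tok_end 3 w p) = (j < size s).
  by rewrite (itn_lt _ H) size_flat3 ltn_pmul2l.
have Hval j : j < size s -> let y := nth (0,0,0) s j in
   [&& num_at w N (past_iter 2 w (3 * j) p) == x.1.1, num_at w N (past 2 w (past_iter 2 w (3 * j) p)) == x.1.2 &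
      num_at w N (past 2 w (past 2 w (past_iter 2 w (3 * j) p))) == x.2] = (x == y).
  move=> Hj y; have Hy : y \in s by rewrite mem_nth.
  have [N1 N2 N3] := Hin y Hy.
  have Hj' : 3 * j <= size (flat3 s) by rewrite size_flat3 leq_mul2l ltnW.
  have [H1 _] := at_itn H Hj'; move: H1.
  rewrite drop_flat3 (drop_nth (0,0,0) Hj) -/y /flat3 /nats_toks /= -!(catA (nat_toks _)) => H1.
  rewrite (at_pnum H1) // (at_pnum (at_nxt H1)) // (at_pnum (at_nxt (at_nxt H1))) //.
  by case: x y {Hy N1 N2 N3 H1} => [[a b] c] [[a' b'] c'] /=; rewrite !xpair_eqE /= -andbA eq_sym [b == _]eq_sym [c == _]eq_sym.
apply/hasP/idP.
  move=> [j _]; rewrite Hj3 => /andP [Hj]; rewrite Hval // => /eqP ->.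
  by rewrite mem_nth.
move=> Hx; have Hj : index x s < size s by rewrite index_mem.
have Hs := size_tns (flat3 s); exists (index x s).
  rewrite mem_iota add0n; case: H => H _; move: H Hs; rewrite size_cat size_flat3 /=; lia.
by rewrite Hj3 Hj /= Hval // nth_index // eqxx.
Qed.

Lemma no3_init A : 3 \notin nat_toks (n_states A) ++ nats_toks (n_init A).
Proof. by rewrite mem_cat negb_or tn_no3 tns_no3. Qed.

Lemma tnfaE A t : nfa_toks A ++ t = (nat_toks (n_states A) ++ nats_toks (n_init A)) ++
  3 :: nats_toks (n_final A) ++ 3 :: nats_toks (flat3 (n_trans A)) ++ 3 :: t.
Proof.
rewrite /nfa_toks /seq_toks -flat3E /nats_toks; move: (nat_toks _) (flatten (map nat_toks (n_init A))) (flatten (map nat_toks (n_final A))) (flatten _) => a b c d.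
by rewrite -!catA.
Qed.

Lemma at_nfa w p A t : toks_at w p (nfa_toks A ++ t) ->
  [/\ exists t', toks_at w (past 2 w p) (nats_toks (n_init A) ++ 3 :: t'),
      exists t', toks_at w (past 3 w p) (nats_toks (n_final A) ++ 3 :: t'),
      exists t', toks_at w (past 3 w (past 3 w p)) (nats_toks (flat3 (n_trans A)) ++ 3 :: t') &
      toks_at w (past 3 w (past 3 w (past 3 w p))) t].
Proof.
rewrite tnfaE => H; have H1 := at_sk H (no3_init A); have H2 := at_sk H1 (tns_no3 _).
have H3 := at_sk H2 (tns_no3 _); split=> //.
- by move: H; rewrite -catA => /at_nxt H; eexists; exact: H.
- by eexists; exact: H1.
- by eexists; exact: H2.
Qed.

Section Instance.
Variable I : instance.
Let w := enc_inst I.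
Let n := size w.
Let auts := i_auts I.
Let A0 := NFA 0 [::] [::] [::].
Let A i := nth A0 auts i.

Lemma tinst_lt4 : all (fun t => t < 4) (inst_toks I).
Proof.
have H q : all (fun t => t < 4) (nat_toks q) by rewrite all_cat andbT all_map; apply/allP => -[].
have Hs s : all (fun t => t < 4) (nats_toks s) by elim: s => //= q s IH; rewrite /nats_toks /= all_cat H.
rewrite /inst_toks all_cat H /seq_toks all_cat andbT; elim: (i_auts I) => //= B s IH.
by rewrite all_cat IH andbT -[nfa_toks B]cats0 tnfaE !(all_cat, Hs, H) /= !(all_cat, Hs) /= !(all_cat, Hs).
Qed.

Lemma at_apos i : i <= size auts -> toks_at w (aut_pos w i) (flatten (map nfa_toks (drop i auts)) ++ [:: 3]).
Proof.
have H0 : toks_at w 0 (inst_toks I).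
  by rewrite /w -bits_of_inst; apply: at_bits tinst_lt4.
elim: i => [|i IH] Hi; first by rewrite drop0; apply: at_nxt H0.
have := IH (ltnW Hi); rewrite (drop_nth A0 Hi) /= -catA => /at_nfa [_ _ _].
by rewrite /aut_pos mulnS.
Qed.

Lemma auts_size : size auts < n.
Proof.
have [+ _] := at_apos (leq0n _); rewrite drop0 size_cat /=.
suff : size auts <= size (flatten (map nfa_toks auts)) by rewrite -/n; lia.
elim: auts => //= B s IH; have HB : 0 < size (nfa_toks B) by rewrite /nfa_toks size_cat size_tn.
by rewrite size_cat; lia.
Qed.

Lemma nautE : aut_count w = size auts.
Proof.
have Hhd i : i < size auts -> tok w (aut_pos w i) != 3.
  move=> Hi; have [_ H] := at_apos (ltnW Hi).
  have := H 0; rewrite addn0 => ->.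
    rewrite (drop_nth A0 Hi) /= /nfa_toks /nat_toks; case: (nbits _) => [|b s] //=; by case: b.
  by rewrite size_cat addn1.
apply: bfind_eq => //; first exact: auts_size.
have [_ H] := at_apos (leqnn _).
by have := H 0; rewrite addn0 drop_size => ->.
Qed.

Variable N : nat.
Hypothesis HN : 2 ^ n <= N.

Lemma at_aut i : i < size auts -> exists t, toks_at w (aut_pos w i) (nfa_toks (A i) ++ t).
Proof.
move=> Hi; have := at_apos (ltnW Hi); rewrite (drop_nth A0 Hi) /= -catA => H.
by eexists; exact: H.
Qed.

Lemma isinitE u : isinit w N u = ball (size auts) (fun i => aut_state w N u i \in n_init (A i)).
Proof.
rewrite /isinit nautE; apply: eq_in_all => i; rewrite mem_iota add0n => /andP [_ Hi].
have [t /at_nfa [[t' H] _ _ _]] := at_aut Hi.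
exact: (mem1P _ H HN).
Qed.

Lemma isfinE u : isfin w N u = ball (size auts) (fun i => aut_state w N u i \in n_final (A i)).
Proof.
rewrite /isfin nautE; apply: eq_in_all => i; rewrite mem_iota add0n => /andP [_ Hi].
have [t /at_nfa [_ [t' H] _ _]] := at_aut Hi.
exact: (mem1P _ H HN).
Qed.

Lemma letstepE u v a : letstep w N u v a =
  ball (size auts) (fun i => (aut_state w N u i, a, aut_state w N v i) \in n_trans (A i)).
Proof.
rewrite /letstep nautE; apply: eq_in_all => i; rewrite mem_iota add0n => /andP [_ Hi].
have [t /at_nfa [_ _ [t' H] _]] := at_aut Hi.
exact: (mem3P (_, _, _) H HN).
Qed.

Lemma trans_small i t : i < size auts -> t \in n_trans (A i) ->
  [/\ t.1.1 < 2 ^ n, t.1.2 < 2 ^ n & t.2 < 2 ^ n].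
Proof.
move=> Hi Ht; have [t1 /at_nfa [_ _ [t' H] _]] := at_aut Hi.
split; apply: (at_small H); apply/flattenP; exists [:: t.1.1; t.1.2; t.2];
  rewrite ?inE ?eqxx ?orbT //; by apply/mapP; exists t.
Qed.

Lemma init_small i q : i < size auts -> q \in n_init (A i) -> q < 2 ^ n.
Proof.
move=> Hi Hq; have [t1 /at_nfa [[t' H] _ _ _]] := at_aut Hi.
exact: (at_small H).
Qed.

End Instance.

(** * Membership in polynomial space *)

Fixpoint nrun (A : nfa) (q : nat) (wd : seq nat) (q' : nat) : Prop :=
  if wd is a :: wd' then exists2 q1, (q, a, q1) \in n_trans A & nrun A q1 wd' q'
  else q = q'.

Lemma nfa_stepP A S a q' :
  reflect (exists2 q, q \in S & (q, a, q') \in n_trans A) (q' \in nfa_step A S a).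
Proof.
apply: (iffP mapP) => [[[[q b] q1]]|[q Hq Ht]].
  by rewrite mem_filter /= => /andP [/andP [Hq /eqP ->] Ht] ->; exists q.
by exists (q, a, q') => //; rewrite mem_filter /= Hq eqxx.
Qed.

Lemma foldl_nrun A wd S q' :
  q' \in foldl (nfa_step A) S wd <-> exists2 q, q \in S & nrun A q wd q'.
Proof.
elim: wd S => [|a wd IH] S /=.
  by split=> [H|[q H <-]] //; exists q'.
rewrite IH; split.
  by move=> [q1 /nfa_stepP [q Hq Ht] Hr]; exists q => //; exists q1.
by move=> [q Hq [q1 Ht Hr]]; exists q1 => //; apply/nfa_stepP; exists q.
Qed.

Lemma nfa_acceptsP A wd : nfa_accepts A wd <->
  exists q0 q, [/\ q0 \in n_init A, q \in n_final A & nrun A q0 wd q].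
Proof.
rewrite /nfa_accepts; split.
  by move/hasP=> [q /foldl_nrun [q0 Hq0 Hr] Hf]; exists q0, q.
by move=> [q0 [q [H0 Hf Hr]]]; apply/hasP; exists q => //; apply/foldl_nrun; exists q0.
Qed.

Lemma finite_choice m (P : nat -> nat -> Prop) :
  (forall i, i < m -> exists x, P i x) -> exists f, forall i, i < m -> P i (f i).
Proof.
elim: m => [|m IH] H; first by exists id.
have [f Hf] := IH (fun i Hi => H i (leqW Hi)); have [x Hx] := H m (ltnSn m).
exists (fun i => if i == m then x else f i) => i; rewrite ltnS leq_eqVlt.
by case: eqP => [->|_ /Hf].
Qed.

Fixpoint tuple_code (B m : nat) (s : nat -> nat) : nat :=
  if m is k.+1 then s 0 + B * tuple_code B k (fun i => s i.+1) else 0.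

Lemma cod_lt B m s : (forall i, i < m -> s i < B) -> tuple_code B m s < B ^ m.
Proof.
elim: m s => //= m IH s H; rewrite expnS.
have H0 := H 0 (ltn0Sn m); have H1 := IH _ (fun i Hi => H i.+1 Hi).
apply: leq_trans (_ : B * (tuple_code B m (fun i => s i.+1)).+1 <= _); first by rewrite mulnS ltn_add2r.
by rewrite leq_mul2l H1 orbT.
Qed.

Lemma cod_dig B m s i : (forall i, i < m -> s i < B) -> i < m ->
  (tuple_code B m s %/ B ^ i) %% B = s i.
Proof.
elim: m s i => //= m IH s i H Hi; have H0 := H 0 (ltn0Sn m).
case: i Hi => [|i] Hi.
  by rewrite expn0 divn1 addnC mulnC modnMDl modn_small.
rewrite expnS divnMA addnC mulnC divnMDl ?(leq_ltn_trans _ H0) // (divn_small H0) addn0.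
by apply: IH => // k Hk; apply: H.
Qed.

Lemma cod_eq B m s t : (forall i, i < m -> s i = t i) -> tuple_code B m s = tuple_code B m t.
Proof.
elim: m s t => //= m IH s t H; rewrite H //; congr (_ + _ * _).
by apply: IH => i Hi; apply: H.
Qed.

Lemma pwE N x : 2 ^ x <= N -> cap_pow2 N x = 2 ^ x.
Proof.
elim: x => //= x IH; rewrite expnS => H; rewrite /cap_pow2 /= -/(cap_pow2 N x) IH; last by lia.
by rewrite -mul2n; apply/minn_idPr.
Qed.

Definition dig_weight (w : seq bool) N j := cap_pow2 N (size w * size w * j).
(** The odometer stops at [D ^ (2 * k)] plus the truth value of reachability, hence the comparison
    with the successor. *)
Definition reach w N u v :=
  odometer (dig_weight w N) (2 * (size w * size w)) N
    (fun A => isstep w N (last_mid (dig_weight w N) (size w * size w) true A u)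
                         (last_mid (dig_weight w N) (size w * size w) false A v))
  == (dig_weight w N (2 * (size w * size w))).+1.
Definition answer w N :=
  bex (dig_weight w N 1) (fun u => isinit w N u &&
    bex (dig_weight w N 1) (fun v => isfin w N v && reach w N u v)).

Lemma dgt_le P j A : dgt P j A <= A.
Proof. exact: leq_trans (leq_mod _ _) (leq_div _ _). Qed.

Ltac e2user ::= lazymatch goal with
  | |- E2 (fun w e => cap_pow2 (@?a w e) (@?b w e)) => apply: (@E2_pw a b)
  | |- E2 (fun w e => dig_weight w (@?a w e) (@?b w e)) => rewrite /dig_weight
  | |- E2 (fun w e => dgt _ _ _) => rewrite /dgt
  end.

Lemma E2_last_mid b f g h : E2 f -> E2 g -> E2 h ->
  E2 (fun w e => last_mid (dig_weight w (f w e)) (size w * size w) b (g w e) (h w e)).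
Proof.
move=> Hf Hg Hh.
apply: (E2_app3 (F := fun w x y z => last_mid (dig_weight w x) (size w * size w) b y z)) => //.
apply: (E2_recb (p := fun w e => nth 0 e 1 + nth 0 e 2)); e2.
- by apply: E2_pb; e2.
- move=> w e m _; elim: m => [|m IH] /=; first exact: leq_addl.
  by case: ifP => // _; apply: leq_trans (dgt_le _ _ _) (leq_addr _ _).

Qed.

Definition leafA w N u v A := isstep w N (last_mid (dig_weight w N) (size w * size w) true A u)
                         (last_mid (dig_weight w N) (size w * size w) false A v).

Lemma E2_leafA f g h k : E2 f -> E2 g -> E2 h -> E2 k ->
  E2b (fun w e => leafA w (f w e) (g w e) (h w e) (k w e)).
Proof.
move=> Hf Hg Hh Hk; apply: E2_isstep => //.
  exact: (E2_last_mid true Hf Hk Hg).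
exact: (E2_last_mid false Hf Hk Hh).
Qed.

Definition nextw w N u v A :=
  nextA (dig_weight w N) (2 * (size w * size w)) N (leafA w N u v) A.

Lemma E2_lev f g p : E2 f -> E2 g -> E2b p ->
  E2 (fun w e => lev (dig_weight w (f w e)) (2 * (size w * size w)) (g w e) (p w e)).
Proof.
move=> Hf Hg Hp.
apply: (E2_bfind (p := fun w e j => ~~ ((dgt (dig_weight w (f w e)) j (g w e) == (dig_weight w (f w e) 1).-1)
  || (if odd j then p w e else ~~ p w e)))); first by e2.
have Hf' := E2_behead Hf; have Hg' := E2_behead Hg; have Hp' : E2b (fun w e => p w (behead e)) by apply: E2_behead Hp.
by do 40? (first [exact: Hf' | exact: Hg' | exact: Hp' | e2step]).
Qed.

Lemma E2_nextw f g h k : E2 f -> E2 g -> E2 h -> E2 k ->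
  E2 (fun w e => nextw w (f w e) (g w e) (h w e) (k w e)).
Proof.
move=> Hf Hg Hh Hk.
apply: (E2_app4 (F := nextw)) => //; rewrite /nextw /nextA.
have Hl : E2b (fun w e => leafA w (nth 0 e 0) (nth 0 e 1) (nth 0 e 2) (nth 0 e 3)).
  by apply: E2_leafA; e2.
have Hlev := E2_lev (E2_var 0) (E2_var 3) Hl.
by do 40? (first [exact: Hl | exact: Hlev | e2step]).
Qed.

Lemma E2_reach f g h : E2 f -> E2 g -> E2 h ->
  E2b (fun w e => reach w (f w e) (g w e) (h w e)).
Proof.
move=> Hf Hg Hh.
apply: (E2_app3 (F := fun w x y z => nat_of_bool (reach w x y z))) => //; rewrite /reach.
apply: E2b_eq; last by e2.
rewrite /odometer; apply: (@E2_recb (fun w e => dig_weight w (nth 0 e 0) (2 * (size w * size w)))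
  (fun _ _ => 0) (fun w e _ A => nextw w (nth 0 e 0) (nth 0 e 1) (nth 0 e 2) A)
  (fun w e => nth 0 e 0)).
- by apply: E2_pb; e2.
- move=> w e m _; elim: m => [|m IH] //; rewrite [nrec _ _ _]/= {1}/nextw /nextA.
  by case: ifP => // _; exact: geq_minl.
- by e2.
- by e2.
- by apply: E2_nextw; e2.
Qed.

Lemma E2_answer : E2b (fun w e => answer w (nth 0 e 0)).
Proof.
rewrite /answer; apply: (E2b_bex (p := fun w e u => isinit w _ u && _)); first by e2.
apply: E2b_and.
  by apply: (E2_app2 (F := fun w x y => nat_of_bool (isinit w x y)) E2_isinit); e2.
apply: (E2b_bex (p := fun w e v => isfin w _ v && reach w _ _ v)); first by e2.
apply: E2b_and.
  by apply: (E2_app2 (F := fun w x y => nat_of_bool (isfin w x y)) E2_isfin); e2.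
by apply: E2_reach; e2.
Qed.

Lemma nrec_ext n g h h' : (forall m v, m < n -> h m v = h' m v) -> nrec n g h = nrec n g h'.
Proof.
elim: n => //= n IH H; rewrite IH ?H // => m v Hm; apply: H; exact: leqW.
Qed.

Section PowExt.
Variables (P P' : nat -> nat) (k : nat).
Hypothesis (HP : forall j, j <= 2 * k -> P j = P' j) (Hk : 0 < k).

Lemma dgt_ext j A : j <= 2 * k -> dgt P j A = dgt P' j A.
Proof. by move=> Hj; rewrite /dgt !HP //; lia. Qed.

Lemma last_mid_ext b A u : last_mid P k b A u = last_mid P' k b A u.
Proof. by apply: nrec_ext => m v Hm; rewrite !dgt_ext //; lia. Qed.

Lemma lev_ext A v : lev P (2 * k) A v = lev P' (2 * k) A v.
Proof.
rewrite /lev /bfind.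
suff H s : all (fun j => j <= 2 * k) s ->
  find (fun j => ~~ ((dgt P j A == (P 1).-1) || (if odd j then v else ~~ v))) s =
  find (fun j => ~~ ((dgt P' j A == (P' 1).-1) || (if odd j then v else ~~ v))) s.
  by apply: H; apply/allP => j; rewrite mem_iota; lia.
elim: s => //= j s IH /andP [Hj Hs]; rewrite IH // dgt_ext // (HP (j := 1)) //; lia.
Qed.

(** The odometer consults only weights up to [2 * k], where the capped powers agree with the true
    ones. *)
Lemma odometer_ext N lf lf' : lf =1 lf' -> odometer P (2 * k) N lf = odometer P' (2 * k) N lf'.
Proof.
move=> Hlf; rewrite /odometer (HP (leqnn _)); apply: nrec_ext => m v _.
rewrite /nextA (HP (leqnn _)) Hlf lev_ext HP //.
by rewrite /lev bfind_le.
Qed.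
End PowExt.

(** * Correctness of the decision procedure *)

Section Correct.
Variable I : instance.
Hypothesis Hwf : List.Forall (nfa_wf (i_alpha I)) (i_auts I).
Let w := enc_inst I.
Let n := size w.
Let auts := i_auts I.
Let m := size auts.
Let A i := nth (NFA 0 [::] [::] [::]) auts i.
(** The game tree has [D ^ (2 * k) = 2 ^ (2 * n ^ 4)] leaves, which has to be less than [N]; the
    summand 5 settles [n = 1] and strictness. [k] is both the bit length of a code, as fewer than
    [n] states of at most [n] bits are stored, and the number of halvings. *)
Let N := 2 ^ (n ^ 5 + 5).
Let k := n * n.
Let D := 2 ^ k.

Lemma n_gt0 : 0 < n.
Proof. exact: leq_ltn_trans (leq0n _) (auts_size I). Qed.

Lemma Npow x : x <= n ^ 5 + 5 -> 2 ^ x <= N.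
Proof. by move=> H; rewrite leq_exp2l. Qed.

Lemma PPE j : j <= 2 * k -> dig_weight w N j = D ^ j.
Proof.
move=> Hj; rewrite /dig_weight -/n -/k /D -expnM pwE //; apply: Npow.
rewrite /k in Hj *; apply: leq_trans (_ : n * n * (2 * (n * n)) <= _); first by rewrite leq_mul2l Hj orbT.
have -> : n * n * (2 * (n * n)) = 2 * n ^ 4 by rewrite !expnS expn0; lia.
rewrite [n ^ 5]expnS; move: n_gt0; case: n => [|[|n']] // _.
by apply: leq_trans (leq_addr _ _); rewrite leq_mul2r; lia.
Qed.

Lemma DN : D ^ (2 * k) < N.
Proof.
rewrite /D -expnM ltn_exp2l // /k.
have -> : n * n * (2 * (n * n)) = 2 * n ^ 4 by rewrite !expnS expn0; lia.
rewrite [n ^ 5]expnS; move: n_gt0; case: n => [|[|n']] // _.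
by rewrite -addn1 leq_add // leq_mul2r; lia.
Qed.

Lemma HNn : 2 ^ n <= N.
Proof.
apply: Npow; apply: leq_trans (leq_addr _ _).
by rewrite -{1}[n]expn1 leq_pexp2l // n_gt0.
Qed.

Lemma D_gt1 : 1 < D.
Proof. by rewrite /D -{1}(expn0 2) ltn_exp2l // /k muln_gt0 n_gt0. Qed.

Lemma k_gt0 : 0 < k. Proof. by rewrite /k muln_gt0 n_gt0. Qed.

Lemma isstep_refl x : isstep w N x x. Proof. by rewrite /isstep eqxx. Qed.

Lemma reachE u v : reach w N u v = savitch D (isstep w N) k u v.
Proof.
have E2k : dig_weight w N (2 * (size w * size w)) = D ^ (2 * k) by apply: PPE.
rewrite /reach E2k.
rewrite (@odometer_ext _ (fun j => D ^ j) k PPE k_gt0 N _ (fun A => isstep w N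
  (last_mid (fun j => D ^ j) k true A u) (last_mid (fun j => D ^ j) k false A v))); last first.
  by move=> x; rewrite !(last_mid_ext PPE k_gt0).
rewrite odometer_savitch //; [|exact: D_gt1|exact: DN].
by rewrite -[(D ^ _).+1]addn1 eqn_add2l; case: savitch.
Qed.

Lemma wf_aut i : i < m -> nfa_wf (i_alpha I) (A i).
Proof.
have : all (nfa_wf (i_alpha I)) auts by rewrite /auts; elim: Hwf => //= B s -> _ ->.
by move=> /all_nthP H Hi; apply: H.
Qed.

Lemma digE u i : i <= n -> aut_state w N u i = (u %/ (2 ^ n) ^ i) %% 2 ^ n.
Proof.
move=> Hi; rewrite /aut_state -/n pwE; last first.
  apply: Npow; apply: leq_trans (_ : n ^ 2 <= _).
    by rewrite expnS expn1 leq_mul2l Hi orbT.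
  by apply: leq_trans (leq_addr _ _); rewrite leq_pexp2l ?n_gt0.
by rewrite pwE ?HNn // expnM.
Qed.

(** Some automaton must be present to bound the letter: without any, every number would pass as a
    letter. *)
Lemma letstep_small u v a : 0 < m -> letstep w N u v a -> a < i_alpha I.
Proof.
move=> Hm; rewrite (letstepE HNn) => /allP /(_ 0).
rewrite mem_iota -/m Hm => /(_ isT) Ht; have /and3P [_ _ /allP /(_ _ Ht)] := wf_aut Hm.
by move=> /= /and3P [].
Qed.

Lemma path_word (u v : 'I_D) (p : seq 'I_D) : 0 < m ->
  path (fun x y : 'I_D => isstep w N x y) u p -> last u p = v ->
  exists wd : seq 'I_(i_alpha I), forall i, i < m ->
    nrun (A i) (aut_state w N u i) (map (@nat_of_ord _) wd) (aut_state w N v i).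
Proof.
move=> Hm; elim: p u => [|x p IH] u /=; first by move=> _ ->; exists [::].
move=> /andP [Hs Hp] Hl; have [wd Hwd] := IH x Hp Hl.
case/orP: Hs => [/eqP E|/hasP [a _ Ha]].
  by exists wd => i Hi; rewrite E; apply: Hwd.
exists (Ordinal (letstep_small Hm Ha) :: wd) => i Hi /=.
exists (aut_state w N x i); last exact: Hwd.
by move: Ha; rewrite (letstepE HNn) => /allP /(_ i); rewrite mem_iota; apply.
Qed.

Let cd s := tuple_code (2 ^ n) m s.
Lemma cd_lt s : (forall i, i < m -> s i < 2 ^ n) -> cd s < D.
Proof.
move=> H; apply: leq_trans (cod_lt H) _.
by rewrite -expnM leq_exp2l // leq_mul2l (ltnW (auts_size I)) orbT.
Qed.

Lemma dig_cd s i : (forall i, i < m -> s i < 2 ^ n) -> i < m -> aut_state w N (cd s) i = s i.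
Proof.
move=> H Hi; rewrite digE ?cod_dig //.
exact: ltnW (ltn_trans Hi (auts_size I)).
Qed.

Lemma word_path (wd : seq nat) s t (Hs : forall i, i < m -> s i < 2 ^ n)
    (Ht : forall i, i < m -> t i < 2 ^ n) : 0 < m ->
  (forall i, i < m -> nrun (A i) (s i) wd (t i)) ->
  connect (fun x y : 'I_D => isstep w N x y) (Ordinal (cd_lt Hs)) (Ordinal (cd_lt Ht)).
Proof.
move=> Hm; elim: wd s Hs => [|a wd IH] s Hs /= H.
  have E : Ordinal (cd_lt Hs) = Ordinal (cd_lt Ht).
    by apply: val_inj; apply: cod_eq.
  by rewrite E connect0.
have [f Hf] : exists f, forall i, i < m -> (s i, a, f i) \in n_trans (A i) /\ nrun (A i) (f i) wd (t i).
  apply: (@finite_choice m (fun i x => (s i, a, x) \in n_trans (A i) /\ nrun (A i) x wd (t i))).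
  by move=> i /H [q H1 H2]; exists q.
have Hfs i : i < m -> f i < 2 ^ n.
  by move=> Hi; have [H1 _] := Hf i Hi; have [] := trans_small Hi H1.
apply: connect_trans (IH f Hfs (fun i Hi => proj2 (Hf i Hi))).
apply: connect1 => /=; apply/orP; right; apply/hasP; exists a.
  rewrite mem_iota add0n /= pwE ?HNn //.
  by have [H1 _] := Hf 0 Hm; have [] := trans_small Hm H1.
rewrite (letstepE HNn); apply/allP => i; rewrite mem_iota add0n => /andP [_ Hi].
by rewrite !dig_cd //; have [] := Hf i Hi.
Qed.

Lemma answerP : answer w N <-> inter_nonempty I.
Proof.
have EF (wd : seq 'I_(i_alpha I)) : List.Forall (fun B => nfa_lang B wd) (i_auts I) <->
    forall i, i < m -> nfa_accepts (A i) (map (@nat_of_ord _) wd).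
  rewrite /m /A /auts; elim: (i_auts I) => [|B s [IH1 IH2]] /=; first by split.
  split=> [H|H].
    by move=> [|i] Hi; inversion H; subst => //=; apply: IH1.
  constructor; first by apply: (H 0).
  by apply: IH2 => i Hi; apply: (H i.+1).
have EP1 : dig_weight w N 1 = D by rewrite PPE ?expn1 //; have := k_gt0; lia.
(* Without automata the empty word is a common word, and the code 0 passes all tests vacuously. *)
rewrite /answer EP1; case: (posnP m) => [m0|Hm].
  split=> [_|_]; first by exists [::]; apply/EF; rewrite m0.
  apply/hasP; exists 0; first by rewrite mem_iota (ltnW D_gt1).
  rewrite (isinitE HNn) -/m m0; apply/hasP; exists 0; first by rewrite mem_iota (ltnW D_gt1).
  rewrite (isfinE HNn) -/m m0 reachE /=.
  have D0 := ltnW D_gt1.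
  by rewrite (@savitch_connect D k _ (Ordinal D0) (Ordinal D0) isstep_refl (leqnn _)) connect0.
split.
  move=> /hasP [u]; rewrite mem_iota add0n => /andP [_ Hu] /andP [Hui /hasP [v]].
  rewrite mem_iota add0n => /andP [_ Hv] /andP [Hvf]; rewrite reachE.
  rewrite (@savitch_connect D k _ (Ordinal Hu) (Ordinal Hv) isstep_refl (leqnn _)).
  move=> /connectP [p Hp Hl]; have [wd Hwd] := path_word Hm Hp (esym Hl).
  exists wd; apply/EF => i Hi; apply/nfa_acceptsP; exists (aut_state w N u i), (aut_state w N v i).
  move: Hui Hvf; rewrite (isinitE HNn) (isfinE HNn) => /allP Hui /allP Hvf.
  by split; [apply: Hui|apply: Hvf|apply: Hwd]; rewrite ?mem_iota.
move=> [wd /EF H].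
have [s Hs] : exists s, forall i, i < m -> exists q, [/\ s i \in n_init (A i), q \in n_final (A i) &
    nrun (A i) (s i) (map (@nat_of_ord _) wd) q].
  apply: (@finite_choice m (fun i x => exists q, [/\ x \in n_init (A i), q \in n_final (A i) &
    nrun (A i) x (map (@nat_of_ord _) wd) q])).
  by move=> i /H /nfa_acceptsP.
have [t Ht] := finite_choice Hs.
have Hs' i : i < m -> s i < 2 ^ n.
  by move=> Hi; have [H1 _ _] := Ht i Hi; apply: init_small H1.
have Ht' i : i < m -> t i < 2 ^ n.
  move=> Hi; have [_ _] := Ht i Hi.
  elim: (map _ wd) (s i) (Hs' i Hi) => [|a l IH] q Hq /=; first by move=> <-.
  by move=> [q1 /(trans_small Hi) [_ _ Hq1]]; apply: IH.
apply/hasP; exists (cd s); first by rewrite mem_iota cd_lt.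
rewrite (isinitE HNn); apply/andP; split.
  apply/allP => i; rewrite mem_iota add0n => /andP [_ Hi].
  by rewrite dig_cd //; have [] := Ht i Hi.
apply/hasP; exists (cd t); first by rewrite mem_iota cd_lt.
rewrite (isfinE HNn); apply/andP; split.
  apply/allP => i; rewrite mem_iota add0n => /andP [_ Hi].
  by rewrite dig_cd //; have [] := Ht i Hi.
rewrite reachE (@savitch_connect D k _ (Ordinal (cd_lt Hs')) (Ordinal (cd_lt Ht')) isstep_refl (leqnn _)).
by apply: (word_path (wd := map (@nat_of_ord _) wd)) => // i Hi; have [] := Ht i Hi.
Qed.
End Correct.

Theorem INE_in_PSPACE det bin C : in_PSPACE (INE det bin C).
Proof.
have Hwf I : inst_ok det bin C I -> List.Forall (nfa_wf (i_alpha I)) (i_auts I).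
  move=> [_]; apply: List.Forall_impl => B [+ _].
  by case: det => // /and3P [].
apply: (@E2_PSPACE _ answer 5 E2_answer) => w [I [-> [Hok HI]]].
  by apply/(answerP (Hwf _ Hok)).
by apply/negP => /(answerP (Hwf _ Hok)).
Qed.

(** * Local automata and dot-depth one *)

Section Closure.
Variables (Sigma : finType).
Implicit Types (C : lclass Sigma) (L M : lang Sigma).

Lemma PolCl_mp C L : marked_product C L -> PolCl C L.
Proof.
move=> H; have HE : PolCl C (fun _ => False) by apply: pol_empty => w.
by apply: (pol_union H HE) => w; split=> [|[]]; [left| |].
Qed.

(** Languages are identified only through the equivalences carried by the closure rules, so
    extensionality is read off the union of [L] with itself. *)
Lemma BoolCl_ext C L M : (forall w, M w <-> L w) -> BoolCl C L -> BoolCl C M.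
Proof.
by move=> H HL; apply: (bc_union HL HL) => w; rewrite H; split=> [|[]]; [left| |].
Qed.

Lemma marked_product_mono C C' L : (forall L, C L -> C' L) ->
  marked_product C L -> marked_product C' L.
Proof. by move=> H; elim=> [M /H|M a M' _ IH /H]; [apply: mp_base|apply: mp_step]. Qed.

Lemma PolCl_mono C C' L : (forall L, C L -> C' L) -> PolCl C L -> PolCl C' L.
Proof.
move=> H; elim=> [M|M M' M'' HM _ IH E]; first exact: pol_empty.
by apply: pol_union IH E; apply: marked_product_mono HM.
Qed.

Lemma BoolCl_mono C C' L : (forall L, C L -> C' L) -> BoolCl C L -> BoolCl C' L.
Proof.
move=> H; elim=> [M /H|M M' _ IH E|M M' M'' _ IH1 _ IH2 E]; first exact: bc_base.
- exact: bc_compl IH E.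
- exact: bc_union IH1 IH2 E.
Qed.

Lemma BoolCl_bigU (D : lclass Sigma) (T : eqType) (s : seq T) (F : T -> lang Sigma) :
  (forall x, x \in s -> BoolCl (PolCl D) (F x)) ->
  BoolCl (PolCl D) (fun w => exists2 x, x \in s & F x w).
Proof.
elim: s => [|x s IH] H.
  by apply/bc_base/pol_empty => w [].
apply: (bc_union (H x (mem_head _ _)) (IH _)) => [y Hy|w].
  by apply: H; rewrite inE Hy orbT.
split=> [[y]|[Hx|[y Hy Hw]]].
- by rewrite inE => /orP [/eqP ->|Hy Hw]; [left|right; exists y].
- by exists x => //; apply: mem_head.
- by exists y => //; rewrite inE Hy orbT.
Qed.

Definition words (n : nat) : seq (seq Sigma) := map val (enum {: n.-tuple Sigma}).

Lemma words_mem n w : (w \in words n) = (size w == n).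
Proof.
apply/mapP/eqP => [[t _ ->]|Hw]; first exact: size_tuple.
by exists (Tuple (introT eqP Hw)); rewrite ?mem_enum.
Qed.

Lemma In_mem (T : eqType) (x : T) s : List.In x s <-> x \in s.
Proof.
elim: s => //= y s IH; rewrite inE IH; split=> [[->|->]|/orP [/eqP ->|]];
  by rewrite ?eqxx ?orbT //; auto.
Qed.

End Closure.

(** * Finite and cofinite languages in level one of the Straubing-Therien hierarchy *)

Section ST.
Variable Sigma : finType.

(* The words having [rev r] as a scattered subword. *)
Fixpoint subw (r : seq Sigma) : lang Sigma :=
  if r is a :: r' then mark_concat (subw r') a (fun _ => True) else fun _ => True.

Lemma subw_mp r : marked_product (@ST_basis Sigma) (subw r).
Proof.
elim: r => [|a r IH] /=; first by apply: mp_base; right.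
by apply: mp_step => //; right.
Qed.

Lemma subw_size r w : subw r w -> size r <= size w.
Proof.
elim: r w => //= a r IH w [u [v [-> [/IH H _]]]]; rewrite size_cat /=; lia.
Qed.

Lemma subw_cat r u v : subw r u -> subw r (u ++ v).
Proof.
case: r => //= a r [x [y [-> [H _]]]]; exists x, (y ++ v); split=> //.
by rewrite -catA.
Qed.

Lemma subw_rev w : subw (rev w) w.
Proof.
elim/last_ind: w => // w a IH; rewrite rev_rcons /=; exists w, [::].
by rewrite cats1.
Qed.

Lemma subw_eq r w : subw r w -> size w = size r -> w = rev r.
Proof.
elim: r w => [|a r IH] w /=; first by move=> _ /size0nil ->.
move=> [u [v [-> [H _]]]]; rewrite size_cat /= => Hs.
have Hsu := subw_size H; have Hv : v = [::] by apply/size0nil; lia.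
rewrite Hv cats1 rev_cons; congr rcons; apply: IH => //.
by move: Hs; rewrite Hv /=; lia.
Qed.

Lemma subw_longer n w : n < size w <-> exists2 v, v \in words Sigma n.+1 & subw (rev v) w.
Proof.
split=> [H|[v]]; last by rewrite words_mem => /eqP <- /subw_size; rewrite size_rev.
exists (take n.+1 w); first by rewrite words_mem size_takel.
by rewrite -{2}(cat_take_drop n.+1 w); apply: subw_cat; apply: subw_rev.
Qed.

(** [u] is the only word that has [u] as a scattered subword and is not longer than [u]; the longer
    words are those with some scattered subword of length [(size u).+1]. *)
Lemma ST1_singleton (u : seq Sigma) : BoolCl (PolCl (@ST_basis Sigma)) (fun w => w = u).
Proof.
have H1 : BoolCl (PolCl (@ST_basis Sigma)) (subw (rev u)).
  by apply/bc_base/PolCl_mp/subw_mp.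
have H2 : BoolCl (PolCl (@ST_basis Sigma)) (fun w => size u < size w).
  apply: (BoolCl_ext (subw_longer (size u))); apply: BoolCl_bigU => v _.
  by apply/bc_base/PolCl_mp/subw_mp.
have H3 : BoolCl (PolCl (@ST_basis Sigma)) (fun w => ~ subw (rev u) w).
  by apply: (bc_compl H1).
have H4 : BoolCl (PolCl (@ST_basis Sigma)) (fun w => ~ subw (rev u) w \/ size u < size w).
  by apply: (bc_union H3 H2).
apply: (bc_compl H4) => w; split=> [->|H].
  by case=> [|/[!ltnn] //]; apply; apply: subw_rev.
have Hs : size w <= size u by rewrite leqNgt; apply/negP => Hs; apply: H; right.
case: (ltnP (size w) (size u)) => Hlt.
  exfalso; apply: H; left => /subw_size; rewrite size_rev; lia.
have Hsz : size w = size u by lia.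
apply/eqP; apply: contra_notT H => /eqP Hne; left => Hsub.
by apply: Hne; rewrite -[u]revK; apply: subw_eq => //; rewrite size_rev.
Qed.

Lemma DD_basis_ST1 (L : lang Sigma) : DD_basis L -> ST 1 L.
Proof.
have Hfin (s : seq (seq Sigma)) : BoolCl (PolCl (@ST_basis Sigma)) (fun w => List.In w s).
  apply: (BoolCl_ext (L := fun w => exists2 x, x \in s & w = x)).
    by move=> w; rewrite In_mem; split=> [H|[x H ->]] //; exists w.
  by apply: BoolCl_bigU => x _; apply: ST1_singleton.
case=> [[s Hs]|[s Hs]]; first by apply: BoolCl_ext (Hfin s).
by apply: (bc_compl (Hfin s)).
Qed.

(** Both closures are monotone, and the dot-depth basis is contained in [ST 1]. *)
Lemma DD1_ST2 (L : lang Sigma) : DD 1 L -> ST 2 L.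
Proof. by apply: BoolCl_mono => M; apply: PolCl_mono => K; apply: DD_basis_ST1. Qed.
End ST.

(** * Languages determined by prefix, suffix and factors of fixed length *)

Section Local.
Variables (Sigma : finType).

Lemma DD_finite (s : seq (seq Sigma)) : DD_basis (fun w => w \in s).
Proof. by left; exists s => w; rewrite In_mem. Qed.

Lemma DD_all : DD_basis (fun _ : seq Sigma => True).
Proof. by right; exists [::] => w; split=> // _ []. Qed.

Lemma DD1_finite (s : seq (seq Sigma)) : DD 1 (fun w => w \in s).
Proof. by apply/bc_base/PolCl_mp/mp_base/DD_finite. Qed.

Lemma DD1_prefix (a : Sigma) u : DD 1 (fun w => exists v, w = rcons u a ++ v).
Proof.
apply: (BoolCl_ext (L := mark_concat (fun w => w \in [:: u]) a (fun _ => True))).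
  move=> w; split=> [[v ->]|[x [y [-> [/[!inE] /eqP -> _]]]]].
    by exists u, v; split; [exact: cat_rcons|split=> //; exact: mem_head].
  by exists y; rewrite cat_rcons.
apply/bc_base/PolCl_mp/mp_step; last exact: DD_all.
by apply/mp_base/DD_finite.
Qed.

Lemma DD1_suffix (a : Sigma) u : DD 1 (fun w => exists v, w = v ++ a :: u).
Proof.
apply: (BoolCl_ext (L := mark_concat (fun _ => True) a (fun w => w \in [:: u]))).
  move=> w; split=> [[v ->]|[x [y [-> [_ /[!inE] /eqP ->]]]]].
    by exists v, u; split=> //; split=> //; exact: mem_head.
  by exists x.
apply/bc_base/PolCl_mp/mp_step; last exact: DD_finite.
by apply/mp_base/DD_all.
Qed.

(** The outer letters of the factor are the two marks, with the finite language of its interior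
    between them. This takes a factor of length at least two, whence [0 < N] below for factors of
    length [N.+1]. *)
Lemma DD1_factor (a b : Sigma) u :
  DD 1 (fun w => exists x y, w = x ++ (a :: rcons u b) ++ y).
Proof.
apply: (BoolCl_ext (L := mark_concat (mark_concat (fun _ => True) a (fun w => w \in [:: u]))
   b (fun _ => True))).
  move=> w; split=> [[x [y ->]]|[z [y [-> [[x [u' [-> [_ /[!inE] /eqP ->]]]] _]]]]].
    exists (x ++ a :: u), y; split; first by rewrite /= cat_rcons -catA.
    by split=> //; exists x, u; split=> //; split=> //; exact: mem_head.
  by exists x, y; rewrite /= cat_rcons -catA.
apply/bc_base/PolCl_mp/mp_step; last exact: DD_all.
apply: mp_step; last exact: DD_finite.
by apply/mp_base/DD_all.
Qed.

(** Up to dead states the automaton is definite: [Hsync] says that a surviving run forgets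
    everything but its last [N] letters. *)
Variables (M : nat) (delta : nat -> Sigma -> nat) (dead fin : pred nat) (q0 N : nat).
Hypotheses (Hq0 : q0 < M) (Hdelta : forall q a, q < M -> delta q a < M)
  (Hdead : forall q a, dead q -> dead (delta q a))
  (Hfin : forall q, fin q -> ~~ dead q)
  (Hsync : forall q q' u, q < M -> q' < M -> size u = N ->
     ~~ dead (foldl delta q u) -> ~~ dead (foldl delta q' u) ->
     foldl delta q u = foldl delta q' u)
  (HN : 0 < N).

Let run := foldl delta.

Lemma run_lt q u : q < M -> run q u < M.
Proof. by elim: u q => //= a u IH q Hq; apply/IH/Hdelta. Qed.

Lemma run_dead q u : dead q -> dead (run q u).
Proof. by elim: u q => //= a u IH q Hq; apply/IH/Hdead. Qed.

Let badf (v : seq Sigma) := all (fun q => dead (run q v)) (iota 0 M).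
Let good_pre (v : seq Sigma) := ~~ dead (run q0 v).
Let good_suf (v : seq Sigma) := has (fun q => fin (run q v)) (iota 0 M).

(** For the converse, survival propagates letter by letter. A factor of length [N.+1] that is not
    bad is survived from some state; after its first [N] letters that run has merged with the actual
    one, which therefore survives the last letter too. The suffix condition then transfers
    acceptance in the same way. *)
Lemma local_char w : N < size w ->
  fin (run q0 w) <->
  [/\ good_pre (take N.+1 w), good_suf (drop (size w - N.+1) w) &
      forall x v y, w = x ++ v ++ y -> size v = N.+1 -> ~~ badf v].
Proof.
move=> Hw; split=> [Hf|[H1 H2 H3]].
  have Hnd := Hfin Hf; split.
  - apply: contra Hnd => Hd; rewrite -(cat_take_drop N.+1 w) /run foldl_cat; exact: run_dead.
  - apply/hasP; exists (run q0 (take (size w - N.+1) w)); first by rewrite mem_iota run_lt.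
    by rewrite /run -foldl_cat cat_take_drop.
  - move=> x v y E _; apply/negP => /allP /(_ (run q0 x)); rewrite mem_iota run_lt // => /(_ isT) Hd.
    move: Hnd; rewrite E /run !foldl_cat => /negP; apply; exact: run_dead.
have Hlive n : N < n <= size w -> ~~ dead (run q0 (take n w)).
  elim: n => [//|n IH] /andP [HNn Hn]; case: (ltnP N n) => HNn'; last first.
    by have -> : n.+1 = N.+1 by lia.
  have {}IH : ~~ dead (run q0 (take n w)) by apply: IH; lia.
  pose x := take (n - N) w; pose r := drop (n - N) w.
  have Er : w = x ++ take N.+1 r ++ drop N.+1 r by rewrite !cat_take_drop.
  have Hr : N < size r by rewrite size_drop; lia.
  have := H3 _ _ _ Er; rewrite size_takel // => /(_ erefl) /allPn [q].
  rewrite mem_iota add0n => /andP [_ Hq].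
  have [a Ea] : exists a, take N.+1 r = rcons (take N r) a.
    by case: r {Er} Hr => [|b r'] Hr //; exists (nth b (b :: r') N); rewrite -take_nth.
  have En : take n w = x ++ take N r.
    rewrite -{1}(cat_take_drop (n - N) w) take_cat size_takel; last by lia.
    by rewrite ltnNge leq_subr /=; congr (_ ++ take _ _); lia.
  have En1 : take n.+1 w = rcons (x ++ take N r) a.
    rewrite -{1}(cat_take_drop (n - N) w) take_cat size_takel; last by lia.
    rewrite ltnNge (leq_trans (leq_subr _ _)) //= rcons_cat -Ea.
    by congr (_ ++ take _ _); lia.
  rewrite Ea En1 -!cats1 /run !foldl_cat /= => Hnd.
  have Hnd' : ~~ dead (foldl delta q (take N r)) by apply: contra Hnd; apply: Hdead.
  move: IH; rewrite En /run foldl_cat => IH.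
  have := Hsync Hq (run_lt x Hq0) _ Hnd' IH; rewrite size_takel ?(ltnW Hr) // => /(_ erefl) E.
  by rewrite /run in E; rewrite -E.
have Hlw : ~~ dead (run q0 w) by have := Hlive (size w); rewrite take_size; apply; lia.
move/hasP: H2 => [q]; rewrite mem_iota add0n => /andP [_ Hq].
set s := drop _ w => Hfs.
have Ew : w = take (size w - N.+1) w ++ s by rewrite cat_take_drop.
have Hs : size s = N.+1 by rewrite size_drop; lia.
case: s Hfs Ew Hs => [//|b s] Hfs Ew [Hs].
(* After the letter [b] exactly [N] letters remain, on which the two surviving runs merge. *)
have -> : run q0 w = run q (b :: s); last by [].
rewrite Ew /run foldl_cat /=; apply: Hsync => //; try by apply: Hdelta => //; apply: run_lt.
  by move: Hlw; rewrite {1}Ew /run foldl_cat.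
exact: Hfin Hfs.
Qed.

(** Words of length at most [N] form a finite language; for the others [local_char] is a Boolean
    combination of prefix, suffix and factor languages. *)
Theorem local_DD1 : DD 1 (fun w => fin (run q0 w)).
Proof.
pose Sh := flatten [seq [seq w <- words Sigma n | fin (run q0 w)] | n <- iota 0 N.+1].
have HSh w : (w \in Sh) = (size w <= N) && fin (run q0 w).
  apply/flattenP/andP => [[s /mapP [n]]|[Hs Hf]].
    rewrite mem_iota => /andP [_ Hn] -> ; rewrite mem_filter words_mem => /andP [Hf /eqP ->].
    by split=> //; move: Hn; rewrite add0n ltnS.
  exists [seq w <- words Sigma (size w) | fin (run q0 w)].
    by apply/mapP; exists (size w) => //; rewrite mem_iota add0n ltnS.
  by rewrite mem_filter words_mem Hf eqxx.
pose LP : lang Sigma := fun w => exists2 u, u \in [seq u <- words Sigma N.+1 | good_pre u] & exists v, w = u ++ v.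
pose LS : lang Sigma := fun w => exists2 u, u \in [seq u <- words Sigma N.+1 | good_suf u] & exists v, w = v ++ u.
pose LF : lang Sigma := fun w => exists2 u, u \in [seq u <- words Sigma N.+1 | badf u] & exists x y, w = x ++ u ++ y.
have HP : DD 1 LP.
  apply: BoolCl_bigU => u; rewrite mem_filter words_mem => /andP [_ /eqP].
  by case/lastP: u => [//|u a] _; apply: DD1_prefix.
have HS : DD 1 LS.
  apply: BoolCl_bigU => u; rewrite mem_filter words_mem => /andP [_ /eqP].
  by case: u => [//|a u] _; apply: DD1_suffix.
have HF : DD 1 LF.
  apply: BoolCl_bigU => u; rewrite mem_filter words_mem => /andP [_ /eqP].
  case: u => [//|a u] [Hu]; case/lastP: u Hu => [E|u b _]; last exact: DD1_factor.
  by move: HN; rewrite -E.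
have HL1 : DD 1 (fun w => (~ LP w \/ ~ LS w) \/ LF w).
  have HnP : DD 1 (fun w => ~ LP w) by apply: (bc_compl HP).
  have HnS : DD 1 (fun w => ~ LS w) by apply: (bc_compl HS).
  have HnPS : DD 1 (fun w => ~ LP w \/ ~ LS w) by apply: (bc_union HnP HnS).
  by apply: (bc_union HnPS HF).
have HL2 : DD 1 (fun w => ~ ((~ LP w \/ ~ LS w) \/ LF w)) by apply: (bc_compl HL1).
apply: (bc_union (DD1_finite Sh) HL2) => w; rewrite HSh.
case: (leqP (size w) N) => Hw /=.
  split=> [->|[//|H]]; first by left.
  exfalso; apply: H; left; left => -[u]; rewrite mem_filter words_mem => /andP [_ /eqP Hu] [v E].
  by move: Hw; rewrite E size_cat Hu; lia.
have EP : LP w <-> good_pre (take N.+1 w).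
  split=> [[u]|H].
    by rewrite mem_filter words_mem => /andP [Hg /eqP Hu] [v ->]; rewrite -Hu take_size_cat.
  exists (take N.+1 w); first by rewrite mem_filter words_mem size_takel // eqxx andbT.
  by exists (drop N.+1 w); rewrite cat_take_drop.
have ES : LS w <-> good_suf (drop (size w - N.+1) w).
  split=> [[u]|H].
    rewrite mem_filter words_mem => /andP [Hg /eqP Hu] [v ->].
    by rewrite size_cat Hu addnK drop_size_cat.
  exists (drop (size w - N.+1) w); first by rewrite mem_filter words_mem size_drop subKn // eqxx andbT.
  by exists (take (size w - N.+1) w); rewrite cat_take_drop.
rewrite (local_char Hw); split.
  move=> [H1 H2 H3]; right => -[[|]|[u]]; [by rewrite EP|by rewrite ES|].
  rewrite mem_filter words_mem => /andP [Hb /eqP Hu] [x [y E]].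
  by have := H3 _ _ _ E Hu; rewrite Hb.
case=> // H; split.
- by apply: contra_notT H => Hg; left; left; rewrite EP; apply/negP.
- by apply: contra_notT H => Hg; left; right; rewrite ES; apply/negP.
- move=> x v y E Hv; apply: contra_notN H => Hb; right; exists v.
    by rewrite mem_filter words_mem Hv eqxx andbT.
  by exists x, y.
Qed.
End Local.

(** * Automata for clauses *)

(* Does letter [a] agree with a demand: 0 none, 1 or 2 for the bit 1 or 0,
   and 3 for a demand that is never met. *)
Definition meets (c a : nat) : bool :=
  if c == 0 then true else if c == 1 then a == 1 else (c == 2) && (a == 0).

(* State [4 p + 2 f + g]: [p] is the position in the current block; [f] (resp.
   [g]) tells that the demands on the first (resp. second) block of the window
   starting with the current (resp. previous) block are met so far. *)
Definition cdelta (s : nat) (want : nat -> nat) (q a : nat) : nat :=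
  let sink := 4 * (2 * s).+2 in
  let p := q %/ 4 in
  if sink <= q then sink else
  if (p < 2) || ~~ odd p then (if a == (p < 2) then q + 4 else sink) else
  let f := odd (q %/ 2) && meets (want (p - 3)./2) a in
  let g := odd q && meets (want (s + (p - 3)./2)) a in
  if p.+1 == (2 * s).+2 then (if g then sink else 2 + f)
  else 4 * p.+1 + (2 * f + g).

(** [g0] and [fin] add a virtual block before or after the word, which meets its demands; the same
    automaton thus expresses conditions on the first or the last block. The states 0 to 3 are those
    at a block boundary. *)
Definition cnfa (s : nat) (want : nat -> nat) (g0 fin : bool) : nfa :=
  NFA (4 * (2 * s).+2).+1 [:: 2 + g0] (if fin then [:: 0; 2] else [:: 0; 1; 2; 3])
    (flatten [seq [seq (q, a, cdelta s want q a) | a <- iota 0 2]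
       | q <- iota 0 (4 * (2 * s).+2).+1]).

Definition blk (x : seq bool) : seq nat := [:: 1; 1] ++ flatten [seq [:: 0; nat_of_bool b] | b <- x].

Lemma foldl_mapE (T T' R : Type) (h : T' -> T) (f : R -> T -> R) z u :
  foldl f z (map h u) = foldl (fun z x => f z (h x)) z u.
Proof. by elim: u z => //= x u IH z. Qed.

Section Clause.
Variables (s : nat) (want : nat -> nat) (g0 fin : bool).
Hypothesis Hs : 0 < s.
Let P := (2 * s).+2.
Let S := 4 * P.
Let de := cdelta s want.
Let A := cnfa s want g0 fin.

Let st p (f g : bool) := 4 * p + (2 * f + g).

Lemma st_split q : q = st (q %/ 4) (odd (q %/ 2)) (odd q).
Proof.
rewrite /st; have E1 := divn_eq q 4; have E2 := divn_eq q 2; have E3 := divn_eq (q %/ 2) 2.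
rewrite -divnMA in E3; rewrite !modn2 in E2 E3.
by move: E1 E2 E3; rewrite /= => E1 E2 E3; lia.
Qed.

Lemma st_dec p (f g : bool) : [/\ st p f g %/ 4 = p, odd (st p f g %/ 2) = f & odd (st p f g) = g].
Proof. by rewrite /st; case: f; case: g; split => /=; lia. Qed.

Lemma deE p (f g : bool) a : p < P -> de (st p f g) a =
  if (p < 2) || ~~ odd p then (if a == (p < 2) then st p.+1 f g else S) else
  let f' := f && meets (want (p - 3)./2) a in
  let g' := g && meets (want (s + (p - 3)./2)) a in
  if p.+1 == P then (if g' then S else st 0 true f') else st p.+1 f' g'.
Proof.
move=> Hp; rewrite /de /cdelta -/P -/S; have [-> -> ->] := st_dec p f g.
rewrite ifN; last by rewrite -ltnNge /st /S; case: (f); case: (g) => /=; lia.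
case: ifP => _; first by case: ifP => // _; rewrite /st; lia.
by case: ifP => // _; case: ifP => // _.
Qed.

Lemma de_sink q a : S <= q -> de q a = S.
Proof. by move=> H; rewrite /de /cdelta -/P -/S H. Qed.

Lemma de_lt q a : de q a < S.+1.
Proof.
case: (ltnP q S) => Hq; last by rewrite de_sink.
have Hp : q %/ 4 < P by rewrite ltn_divLR // mulnC.
rewrite (st_split q) deE //; move: (q %/ 4) Hp => p Hp.
have HS : forall p f g, p < P -> st p f g < S.+1.
  by move=> p' f g Hp'; rewrite /st /S; case: f; case: g => /=; lia.
case: ifP => H1.
  case: ifP => // _; apply: HS; move: H1; rewrite /P in Hp *; case: (ltnP p 2) => /=; first by lia.
  move=> _; case: (ltnP p.+1 (2 * s).+2) => // H2 /negP []; have -> : p = (2 * s).+1 by lia.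
  by rewrite /= mul2n odd_double.
by rewrite /=; case: ifP => /eqP H2; [case: ifP => // _; apply: HS|apply: HS; lia].
Qed.

(** The frame of a block: ones at the two marker positions, zeros at the later even positions,
    anything at the odd payload positions. *)
Definition pat (p a : nat) : bool := ~~ ((p < 2) || ~~ odd p) || (a == (p < 2)).

Lemma de_pos q a : q < S -> de q a < S -> pat (q %/ 4) a /\ de q a %/ 4 = (q %/ 4).+1 %% P.
Proof.
move=> Hq; have Hp : q %/ 4 < P by rewrite ltn_divLR // mulnC.
rewrite {1 3}(st_split q) deE // /pat; move: (q %/ 4) (odd (q %/ 2)) (odd q) Hp => p f g Hp.
case: ifP => H1.
  case: ifP => _; rewrite ?ltnn // orbT => _; split=> //; have [-> _ _] := st_dec p.+1 f g.
  rewrite modn_small //; rewrite /P in Hp *; case: (ltnP p.+1 (2 * s).+2) => // H2.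
  move: H1; have -> : p = (2 * s).+1 by lia.
  by rewrite /= mul2n odd_double /=; lia.
move=> /=; case: ifP => [/eqP E|H2].
  by case: ifP; rewrite ?ltnn // => _ _; split=> //; rewrite E modnn; case: (st_dec 0 true (f && meets (want (p - 3)./2) a)).
move=> _; split=> //; case: (st_dec p.+1 (f && meets (want (p - 3)./2) a) (g && meets (want (s + (p - 3)./2)) a)) => -> _ _.
by rewrite modn_small // ltn_neqAle H2.
Qed.

Let run := foldl de.

Lemma run_sink q u : S <= q -> S <= run q u.
Proof. by elim: u q => //= a u IH q Hq; apply: IH; rewrite de_sink. Qed.

Lemma run_pos q u : q < S -> run q u < S ->
  run q u %/ 4 = (q %/ 4 + size u) %% P /\
  forall i, i < size u -> pat ((q %/ 4 + i) %% P) (nth 0 u i).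
Proof.
elim: u q => [|a u IH] q Hq /=.
  by move=> _; rewrite addn0 modn_small // ltn_divLR // mulnC.
move=> Hr; have Hd : de q a < S.
  by rewrite ltnNge; apply/negP => /(run_sink u); rewrite leqNgt Hr.
have [H1 H2] := de_pos Hq Hd; have [H3 H4] := IH _ Hd Hr.
have Hp : q %/ 4 < P by rewrite ltn_divLR // mulnC.
rewrite H3 H2 modnDml addSnnS; split=> // -[_|i Hi /=]; first by rewrite addn0 modn_small.
by have := H4 i Hi; rewrite H2 modnDml addSnnS.
Qed.

(** The letters [110] that open a block do not fit at another offset: one of the positions [r] and
    [r.+1] demands 0, unless [r] is the last position of the block, when [r.+2] falls on the second
    marker letter and demands 1. *)
Lemma pat_conflict r : 0 < r < P -> pat r 1 -> pat (r.+1 %% P) 1 -> pat (r.+2 %% P) 0 -> False.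
Proof.
move=> /andP [H0 HP]; rewrite /pat; case: (ltnP r 2) => H2 /=.
  have -> : r = 1 by lia.
  by rewrite modn_small //=; rewrite /P; lia.
case: (boolP (odd r)) => //= Ho _.
case: (ltnP r.+1 P) => H1.
  by rewrite (modn_small H1) /= Ho (_ : (r.+1 < 2) = false) //; lia.
have ER : r.+2 %% P = 1.
  have -> : r.+2 = P + 1 by lia.
  by rewrite modnDl modn_small // /P; lia.
by rewrite ER.
Qed.

Lemma run_take q u n : S <= run q (take n u) -> S <= run q u.
Proof. by move=> H; rewrite -(cat_take_drop n u) /run foldl_cat; apply: run_sink. Qed.

Lemma de_zero q a : q < S -> de q a < S -> de q a %/ 4 = 0 -> de q a %/ 2 = 1.
Proof.
move=> Hq; have Hp : q %/ 4 < P by rewrite ltn_divLR // mulnC.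
rewrite {1 2 3}(st_split q) deE //; move: (q %/ 4) (odd (q %/ 2)) (odd q) Hp => p f g Hp.
case: ifP => H1.
  by case: ifP => _; [move: (st_dec p.+1 f g) => [-> _ _]|rewrite ltnn].
move=> /=; case: ifP => H2; first by case: ifP; rewrite ?ltnn // => _ _ _; case: (_ && _).
by move: (st_dec p.+1 (f && meets (want (p - 3)./2) a) (g && meets (want (s + (p - 3)./2)) a)) => [-> _ _].
Qed.

(** States that differ at most in [g] keep this relation, and the end of a block forgets [g]: there
    a true [g] kills the run and [f] takes its place. *)
Lemma de_cong q q' a : q < S -> q' < S -> de q a < S -> de q' a < S -> q %/ 2 = q' %/ 2 ->
  de q a %/ 2 = de q' a %/ 2 /\ ((q %/ 4).+1 = P -> de q a = de q' a).
Proof.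
move=> Hq Hq' + + E; have Ef : odd (q %/ 2) = odd (q' %/ 2) by rewrite E.
have Ep : q %/ 4 = q' %/ 4 by rewrite -[4]/(2 * 2) !divnMA E.
have Hp : q %/ 4 < P by rewrite ltn_divLR // mulnC.
rewrite {1 2 4}(st_split q) {1 2 3}(st_split q') -Ep -Ef !deE //.
move: (q %/ 4) (odd (q %/ 2)) (odd q) (odd q') Hp => p f g g' Hp.
have E2 p1 f1 g1 g2 : st p1 f1 g1 %/ 2 = st p1 f1 g2 %/ 2.
  by rewrite /st; case: f1; case: g1; case: g2; lia.
case: ifP => H1.
  case: ifP => _ _ _; split=> // EP; move: H1; rewrite -[p]/(p.+1.-1) EP /P /= mul2n odd_double /=; lia.
move=> /=; case: ifP => /eqP H2; last by split.
by case: ifP; rewrite ?ltnn // => _ _; case: ifP; rewrite ?ltnn.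
Qed.

(** At most [P] letters bring the first run to a boundary, where [pat_conflict] forces the second
    run to be at a boundary as well. There [f] is fresh in both, and the next [P] letters forget
    [g]. *)
Lemma run_sync q q' u : q < S.+1 -> q' < S.+1 -> size u = 3 * P ->
  ~~ (S <= run q u) -> ~~ (S <= run q' u) -> run q u = run q' u.
Proof.
move=> _ _ Hu H1 H2.
have Hal r n : ~~ (S <= run r u) -> run r (take n u) < S.
  by move=> H; rewrite ltnNge; apply: contra H; apply: run_take.
have Hq : q < S by have := Hal q 0 H1; rewrite take0.
have Hq' : q' < S by have := Hal q' 0 H2; rewrite take0.
have P4 : 4 <= P by rewrite /P; lia.
have HpP : q %/ 4 < P by rewrite ltn_divLR // mulnC.
set d := P - q %/ 4; have Hd : 0 < d <= P by rewrite /d; lia.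
have Hr : run q u < S by rewrite ltnNge.
have Hr' : run q' u < S by rewrite ltnNge.
have [_ Hpat] := run_pos Hq Hr; have [_ Hpat'] := run_pos Hq' Hr'.
pose r := (q' %/ 4 + d) %% P.
have Hpos j : (q %/ 4 + (d + j)) %% P = j %% P.
  by have -> : q %/ 4 + (d + j) = P + j by [rewrite /d; lia]; rewrite modnDl.
have Hpos' j : (q' %/ 4 + (d + j)) %% P = (r + j) %% P by rewrite addnA /r modnDml.
have Er : r = 0.
  apply/eqP; rewrite -leqn0 leqNgt; apply/negP => Hr0.
  have HrP : r < P by rewrite /r ltn_mod.
  have L j a : j < 3 -> (pat j (nth 0 u (d + j)) -> nth 0 u (d + j) = a) ->
      pat ((r + j) %% P) a.
    move=> Hj Ha; have Hi : d + j < size u by rewrite Hu; lia.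
    have := Hpat _ Hi; rewrite Hpos modn_small => [/Ha <-|]; last by lia.
    by have := Hpat' _ Hi; rewrite Hpos'.
  apply: (@pat_conflict r); first by rewrite Hr0 HrP.
  - have := L 0 1 isT; rewrite !addn0 modn_small //; apply.
    by rewrite /pat /= => /eqP.
  - have := L 1 1 isT; rewrite !addn1; apply.
    by rewrite /pat /= => /eqP.
  - have := L 2 0 isT; rewrite !addn2; apply.
    by rewrite /pat /= => /eqP.
have Hstep x n : ~~ (S <= run x u) -> n < size u ->
    run x (take n.+1 u) = de (run x (take n u)) (nth 0 u n).
  by move=> _ Hn; rewrite (take_nth 0 Hn) -cats1 /run foldl_cat.
have Hpn x n : x < S -> ~~ (S <= run x u) -> n <= size u ->
    run x (take n u) %/ 4 = (x %/ 4 + n) %% P.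
  move=> Hx Hxu Hn; have [-> _] := run_pos Hx (Hal x n Hxu).
  by rewrite size_takel.
have Hz x : x < S -> ~~ (S <= run x u) -> (x %/ 4 + d) %% P = 0 -> run x (take d u) %/ 2 = 1.
  move=> Hx Hxu E0; have Hdn : d.-1 < size u by rewrite Hu; lia.
  have Ed : d = d.-1.+1 by lia.
  have := Hstep x _ Hxu Hdn; rewrite -Ed => E.
  rewrite E; apply: de_zero; first exact: Hal.
    by rewrite -E; apply: Hal.
  by rewrite -E Hpn // Hu; lia.
have E1 : run q (take d u) %/ 2 = run q' (take d u) %/ 2.
  rewrite !Hz //; have := Hpos 0; rewrite addn0 => ->; by rewrite mod0n.
have E2 n : d + n <= size u -> run q (take (d + n) u) %/ 2 = run q' (take (d + n) u) %/ 2.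
  elim: n => [|n IH] Hn; first by rewrite addn0.
  have Hn' : d + n < size u by lia.
  rewrite addnS !Hstep //; have [] := de_cong (a := nth 0 u (d + n)) (Hal q (d + n) H1) (Hal q' (d + n) H2) _ _ (IH (ltnW Hn')) => //.
    by rewrite -Hstep //; apply: Hal.
  by rewrite -Hstep //; apply: Hal.
pose n := d + P.-1; have Hn : n < size u by rewrite Hu /n; lia.
have E3 : run q (take n.+1 u) = run q' (take n.+1 u).
  rewrite !Hstep //; have [] := de_cong (a := nth 0 u n) (Hal q n H1) (Hal q' n H2) _ _ (E2 P.-1 (ltnW Hn)).
  - by rewrite -Hstep //; apply: Hal.
  - by rewrite -Hstep //; apply: Hal.
  - move=> _; apply; rewrite Hpn ?(ltnW Hn) // Hpos modn_small; lia.
by rewrite -(cat_take_drop n.+1 u) /run !foldl_cat -/run E3.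
Qed.

Lemma in_trans q a q1 : ((q, a, q1) \in n_trans A) = [&& q < S.+1, a < 2 & q1 == de q a].
Proof.
apply/flattenP/and3P => [[l /mapP [q2]]|[Hq Ha /eqP ->]].
  rewrite mem_iota add0n => /andP [_ Hq] -> /mapP [a2]; rewrite mem_iota add0n => /andP [_ Ha] [-> -> ->].
  by split.
exists [seq (q, a, de q a) | a <- iota 0 2]; first by apply/mapP; exists q; rewrite ?mem_iota.
by apply/mapP; exists a; rewrite ?mem_iota.
Qed.

Lemma cnfa_run q wd q' : all (fun a => a < 2) wd -> q < S.+1 ->
  nrun A q wd q' <-> q' = run q wd.
Proof.
elim: wd q => [|a wd IH] q /=; first by move=> _ _; split.
move=> /andP [Ha Hwd] Hq; split.
  move=> [q1]; rewrite in_trans => /and3P [_ _ /eqP ->] /(IH _ Hwd (de_lt q a)) -> //.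
have Hin : (q, a, de q a) \in n_trans A by rewrite in_trans Hq Ha eqxx.
move=> Eq; exists (de q a); first exact: Hin.
exact: (proj2 (IH _ Hwd (de_lt q a)) Eq).
Qed.

Definition cfin (q : nat) : bool := q \in n_final A.

Lemma cnfa_accepts wd : all (fun a => a < 2) wd -> nfa_accepts A wd = cfin (run (2 + g0) wd).
Proof.
move=> Hwd; have Hi : 2 + g0 < S.+1 by rewrite /S /P; case: (g0); lia.
apply/idP/idP => [/nfa_acceptsP [q [q' [+ Hf]]]|Hf].
  by rewrite inE => /eqP -> /(cnfa_run _ Hwd Hi) <-.
apply/nfa_acceptsP; exists (2 + g0), (run (2 + g0) wd); split=> //; first by rewrite inE.
by apply/cnfa_run.
Qed.

Lemma cnfa_dfa : is_dfa 2 A.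
Proof.
have Hi : 2 + g0 < S.+1 by rewrite /S /P; case: (g0); lia.
rewrite /is_dfa; apply/and3P; split=> //.
  apply/and3P; split; first by rewrite /= andbT.
    by rewrite /=; case: (fin) => /=; lia.
  by apply/allP => -[[q a] q1]; rewrite in_trans => /and3P [/= -> -> /eqP ->]; rewrite de_lt.
apply/allP => q; rewrite mem_iota add0n => /andP [_ Hq].
apply/allP => a; rewrite mem_iota add0n => /andP [_ Ha].
have Hin : (q, a, de q a) \in n_trans A by rewrite in_trans Hq Ha eqxx.
have E : count (fun t => (t.1.1 == q) && (t.1.2 == a)) (n_trans A) = count (pred1 (q, a, de q a)) (n_trans A).
  apply: eq_in_count => -[[q2 a2] q3]; rewrite in_trans => /and3P [_ _ /eqP ->] /=.
  rewrite !xpair_eqE; case: (q2 =P q) => //= ->; case: (a2 =P a) => //= ->; by rewrite eqxx.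
rewrite E count_uniq_mem ?Hin //.
apply: (@allpairs_uniq _ _ _ (fun q a => (q, a, de q a))); rewrite ?iota_uniq //.
by move=> [x1 y1] [x2 y2] _ _ /= [-> ->].
Qed.

Lemma cnfa_DD1 : DD 1 (@nfa_lang 2 A).
Proof.
have Hw (w : seq 'I_2) : all (fun a => a < 2) (map (@nat_of_ord 2) w).
  by rewrite all_map; apply/allP => i _ /=; apply: ltn_ord.
have H : DD 1 (fun w : seq 'I_2 => cfin (foldl (fun q (a : 'I_2) => de q a) (2 + g0) w)).
  apply: (@local_DD1 _ S.+1 _ (leq S) cfin (2 + g0) (3 * P)) => //.
  - by rewrite /S /P; case: (g0); lia.
  - by move=> q a _; apply: de_lt.
  - by move=> q a Hq; rewrite de_sink.
  - by move=> q; rewrite -ltnNge /cfin /=; case: (fin); rewrite !inE /S /P; lia.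
  - move=> q q' u Hq Hq' Hu; have E r : foldl (fun q (a : 'I_2) => de q a) r u = run r (map (@nat_of_ord 2) u).
      by rewrite /run foldl_mapE.
    by rewrite !E; apply: run_sync => //; rewrite size_map.
apply: (BoolCl_ext _ H) => w; rewrite /nfa_lang cnfa_accepts // /run foldl_mapE.
by split.
Qed.

Definition allmeet (o : nat) (x : seq bool) : bool :=
  ball s (fun i => meets (want (o + i)) (nth false x i)).

(** The condition at the level of blocks: no window of two consecutive blocks meets all demands,
    where [g] says whether the previous block met its half. *)
Fixpoint chain (g : bool) (xs : seq (seq bool)) : bool :=
  if xs is x :: r then ~~ (g && allmeet s x) && chain (allmeet 0 x) r
  else ~~ (fin && g).

Lemma run_bits i x f g : 0 < size x -> i + size x = s ->
  run (st (2 * i).+2 f g) (flatten [seq [:: 0; nat_of_bool b] | b <- x]) =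
  if g && ball (size x) (fun j => meets (want (s + (i + j))) (nth false x j)) then S
  else st 0 true (f && ball (size x) (fun j => meets (want (i + j)) (nth false x j))).
Proof.
elim: x i f g => [//|b x IH] i f g _ /= Hi.
have E1 : de (st (2 * i).+2 f g) 0 = st (2 * i).+3 f g.
  by rewrite deE /= ?mul2n ?odd_double //; rewrite /P; lia.
have E2 : de (st (2 * i).+3 f g) b =
  let f' := f && meets (want i) b in let g' := g && meets (want (s + i)) b in
  if x == [::] then (if g' then S else st 0 true f') else st (2 * i.+1).+2 f' g'.
  rewrite deE /= ?mul2n ?odd_double /=; last by rewrite /P; lia.
  have -> : (i.*2.+3 - 3)./2 = i by lia.
  have -> : (i.*2.+4 == P) = (x == [::]).
    have -> : (x == [::]) = (size x == 0) by case: (x).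
    by rewrite /P; lia.
  by case: (x == [::]) => //; rewrite mul2n doubleS.
have Eb (h : nat -> nat) : ball (size x).+1 (fun j => meets (want (h j)) (nth false (b :: x) j)) =
   meets (want (h 0)) b && ball (size x) (fun j => meets (want (h j.+1)) (nth false x j)).
  rewrite /ball /= -[1]addn0 iotaDl all_map; congr (_ && _).
rewrite E1 E2 /= !Eb !addn0.
case: x IH Hi {E2 Eb} => [|b' x] IH Hi.
  by rewrite /ball /= !andbT.
have {}IH := IH i.+1 (f && meets (want i) b) (g && meets (want (s + i)) b) isT.
rewrite [size _]/= addSnnS in IH; have {}IH := IH Hi.
rewrite -[_ :: x]/([:: b'] ++ x) in IH *.
rewrite [LHS]IH -!andbA; congr (if _ && (_ && _) then _ else st 0 true (_ && (_ && _)));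
  by apply: eq_all => j; rewrite ?addSnnS.
Qed.

Lemma size_bits2 (x : seq bool) : size (flatten [seq [:: 0; nat_of_bool b] | b <- x]) = 2 * size x.
Proof. by elim: x => //= b x ->; rewrite mulnS. Qed.

Lemma size_blk x : size x = s -> size (blk x) = P.
Proof. by move=> H; rewrite /blk /= size_bits2 H. Qed.

Lemma run_blk x g : size x = s ->
  run (st 0 true g) (blk x) = if g && allmeet s x then S else st 0 true (allmeet 0 x).
Proof.
move=> Hx; rewrite /blk /run foldl_cat -/run /=.
have E1 : de (st 0 true g) 1 = st 1 true g by rewrite deE.
have E2 : de (st 1 true g) 1 = st 2 true g by rewrite deE //= /P; lia.
rewrite E1 E2 -[2]/(2 * 0).+2 run_bits ?Hx //.
Qed.

Lemma cfin_st p f g : cfin (st p f g) = (p == 0) && ~~ (fin && g).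
Proof.
rewrite /cfin /=; case: (fin); rewrite !inE /st; case: f; case: g; case: p => //= p; lia.
Qed.

Lemma run_chain xs g : all (fun x => size x == s) xs ->
  cfin (run (st 0 true g) (flatten (map blk xs))) = chain g xs.
Proof.
elim: xs g => [|x xs IH] g; first by rewrite [run _ _]/= cfin_st.
move=> /andP [/eqP Hx Hxs]; have -> : flatten (map blk (x :: xs)) = blk x ++ flatten (map blk xs) by [].
rewrite [chain _ _]/= /run foldl_cat -/run run_blk //; case: ifP => _; last exact: IH.
apply/negbTE; have := run_sink (flatten (map blk xs)) (leqnn S); move: (run _ _) => q Hq.
by rewrite /cfin /=; case: (fin); rewrite !inE; rewrite /S /P in Hq; lia.
Qed.

Lemma nth_blk x p : size x = s -> p < P ->
  nth 0 (blk x) p = if (p < 2) then 1 else if ~~ odd p then 0 else nat_of_bool (nth false x (p - 3)./2).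
Proof.
move=> Hx; rewrite /blk; case: p => [//|[//|p]] Hp; rewrite [LHS]/= subSS subSS /= negbK.
have H i : nth 0 (flatten [seq [:: 0; nat_of_bool b] | b <- x]) i = 
   if ~~ odd i then 0 else nat_of_bool (nth false x i.-1./2).
  elim: x i {Hx Hp} => [|b x IH] [|[|i]] //=; rewrite ?nth_nil ?if_same //.
  by rewrite IH negbK; case: (boolP (odd i)) => // Ho; case: i Ho.
by rewrite H; case: (odd p) => //=; rewrite subn1.
Qed.

Lemma blocks wd : (forall i, i < size wd -> pat (i %% P) (nth 0 wd i)) ->
  all (fun a => a < 2) wd -> size wd %% P = 0 ->
  exists2 xs, all (fun x => size x == s) xs & wd = flatten (map blk xs).
Proof.
have P0 : 0 < P by [].
move=> Hpat H2 Hsz.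
have [m Hm] : exists m, size wd = m * P by exists (size wd %/ P); rewrite {1}(divn_eq (size wd) P) Hsz addn0.
elim: m wd Hpat H2 Hm {Hsz} => [|m IH] wd Hpat H2 Hm.
  by exists [::] => //; apply/size0nil.
have HP : P <= size wd by rewrite Hm mulSn leq_addr.
have Hd : size (drop P wd) = m * P by rewrite size_drop Hm mulSn addKn.
case: (IH (drop P wd)) => //.
- move=> i Hi; rewrite nth_drop -(modnDl i P); apply: Hpat.
  by move: Hi; rewrite size_drop; lia.
- by apply/allP => a /mem_drop /(allP H2).
move=> xs Hxs Exs; pose x := mkseq (fun i => nth 0 wd (2 * i).+3 == 1) s.
have Hx : size x = s by rewrite size_mkseq.
exists (x :: xs); first by rewrite /= Hx eqxx.
have -> : flatten (map blk (x :: xs)) = blk x ++ flatten (map blk xs) by [].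
rewrite -Exs -{1}(cat_take_drop P wd); congr (_ ++ _).
apply: (@eq_from_nth _ 0); first by rewrite size_blk // size_takel.
move=> i; rewrite size_takel // => Hi; rewrite nth_take // nth_blk //.
have Hiw : i < size wd by apply: leq_trans HP.
have := Hpat i Hiw; rewrite modn_small // /pat.
case: (ltnP i 2) => Hi2 /=; first by move/eqP.
case: (boolP (odd i)) => Ho /=; last by move/eqP.
move=> _; rewrite nth_mkseq; last by rewrite /P in Hi; lia.
have -> : (2 * (i - 3)./2).+3 = i by lia.
by move/(all_nthP 0)/(_ i Hiw): H2; case: (nth 0 wd i) => [|[|]].
Qed.

Lemma cnfa_chain wd : all (fun a => a < 2) wd -> nfa_accepts A wd <->
  exists xs, [/\ all (fun x => size x == s) xs, wd = flatten (map blk xs) & chain g0 xs].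
Proof.
move=> Hwd; rewrite cnfa_accepts //; have -> : 2 + g0 = st 0 true g0 by [].
split=> [Hf|[xs [Hxs -> Hc]]]; last by rewrite run_chain.
have Hst : st 0 true g0 < S by rewrite /st /S /P; case: (g0); lia.
have HfS q : cfin q -> q < S /\ q %/ 4 = 0.
  by rewrite /cfin /=; case: (fin); rewrite !inE => H; split; rewrite /S /P; lia.
have [HrS Hr0] := HfS _ Hf; have [Ep Hpat] := run_pos Hst HrS.
have [E0 _ _] := st_dec 0 true g0; rewrite Hr0 E0 add0n in Ep.
have [xs Hxs Exs] : exists2 xs, all (fun x => size x == s) xs & wd = flatten (map blk xs).
  by apply: blocks => // i /Hpat; rewrite E0.
by exists xs; split=> //; rewrite -run_chain // -Exs.
Qed.
End Clause.

(** Ensures that all automata accepting a word decompose it into the same blocks. *)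
Lemma blk_inj s (xs ys : seq (seq bool)) : all (fun x => size x == s) xs ->
  all (fun x => size x == s) ys -> flatten (map blk xs) = flatten (map blk ys) -> xs = ys.
Proof.
elim: xs ys => [|x xs IH] [|y ys] //= /andP [/eqP Hx Hxs] /andP [/eqP Hy Hys] /eqP.
rewrite !eqseq_cons !eqxx /= eqseq_cat ?size_bits2 ?Hx ?Hy // => /andP [/eqP E /eqP /IH ->] //.
congr (_ :: _); elim: x y E {Hx Hy} => [|a x IHx] [|b y] //= [E /IHx ->].
by case: a E; case: b.
Qed.

(** * The reduction *)

Lemma E2_subst h f : E2 (fun w e => h w (behead e) (nth 0 e 0)) -> E2 f ->
  E2 (fun w e => h w e (f w e)).
Proof. by move=> Hh Hf; apply: (E2_let Hf Hh). Qed.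

Lemma E2_meets f g : E2 f -> E2 g -> E2b (fun w e => meets (f w e) (g w e)).
Proof.
apply: (@E2_app2 (fun _ x y => nat_of_bool (meets x y))); rewrite /meets; e2.
Qed.

Lemma E2_cdelta s h f g : E2 s -> E2 (fun w e => h w (behead e) (nth 0 e 0)) -> E2 f -> E2 g ->
  E2 (fun w e => cdelta (s w e) (h w e) (f w e) (g w e)).
Proof.
move=> Hs Hh Hf Hg.
have HS : E2 (fun w e => 4 * (2 * s w e).+2) by repeat first [exact: Hs | e2step].
have Hp : E2 (fun w e => f w e %/ 4) by repeat first [exact: Hf | e2step].
have Hi : E2 (fun w e => (f w e %/ 4 - 3)./2) by repeat first [exact: Hf | e2step].
have H1 := E2_subst Hh Hi.
have H2 : E2 (fun w e => h w e (s w e + (f w e %/ 4 - 3)./2)).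
  by apply: (E2_subst Hh); repeat first [exact: Hf | exact: Hs | e2step].
have M1 := E2_meets H1 Hg; have M2 := E2_meets H2 Hg.
rewrite /cdelta; repeat first [exact: M1 | exact: M2 | exact: Hf | exact: Hs | exact: Hg | e2step].
Qed.

Definition GenA (F : seq bool -> seq nat -> seq nfa) : Prop :=
  Gen (fun w e => flatten (map enc_nfa (F w e))).

Lemma flatten_map_flatten (T : Type) (U : eqType) (f : T -> seq U) (ss : seq (seq T)) :
  flatten (map f (flatten ss)) = flatten [seq flatten (map f s) | s <- ss].
Proof. by elim: ss => //= s ss IH; rewrite map_cat flatten_cat IH. Qed.

Lemma enc_cnfa s want g0 fin : flatten (map enc_nfa [:: cnfa s want g0 fin]) =
  enc_nat (4 * (2 * s).+2).+1 ++
  (enc_seq enc_nat [:: 2 + g0] ++ enc_seq enc_nat (if fin then [:: 0; 2] else [:: 0; 1; 2; 3])) ++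
  flatten [seq flatten [seq enc_nat q ++ enc_nat a ++ enc_nat (cdelta s want q a)
    | a <- iota 0 2] | q <- iota 0 (4 * (2 * s).+2).+1] ++ [:: true; true].
Proof.
transitivity (enc_nfa (cnfa s want g0 fin)); first exact: cats0.
rewrite -catA; congr (_ ++ (_ ++ (_ ++ _))); rewrite /n_trans /cnfa {1}/enc_seq; congr (_ ++ _).
by rewrite flatten_map_flatten -map_comp.
Qed.

Lemma GenA_cnfa s h g0 fin : E2 s -> E2 (fun w e => h w (behead e) (nth 0 e 0)) ->
  GenA (fun w e => [:: cnfa (s w e) (h w e) g0 fin]).
Proof.
move=> Hs Hh.
have Hn : E2 (fun w e => (4 * (2 * s w e).+2).+1) by repeat first [exact: Hs | e2step].
refine (Gen_ext (fun w e => esym (enc_cnfa (s w e) (h w e) g0 fin)) _).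
apply: Gen_cat; first exact: Gen_enc_nat.
apply: Gen_cat; first exact: Gen_const.
apply: Gen_cat; last exact: Gen_const.
apply: (Gen_for (g := fun w e q => flatten [seq enc_nat q ++ enc_nat a ++ enc_nat (cdelta (s w e) (h w e) q a)
    | a <- iota 0 2]) Hn).
apply: (Gen_for (n := fun _ _ => 2) (g := fun w e a => enc_nat (nth 0 e 0) ++ enc_nat a ++
   enc_nat (cdelta (s w (behead e)) (h w (behead e)) (nth 0 e 0) a))); first exact: E2_const.
apply: Gen_cat; first by apply: Gen_enc_nat; e2.
apply: Gen_cat; first by apply: Gen_enc_nat; e2.
apply: Gen_enc_nat.
apply: (E2_cdelta (h := fun w e => h w (behead (behead e))) (E2_behead (E2_behead Hs))); [|by e2|by e2].
(* Two loop variables stand between the argument of [h] and its environment; each [E2_skip] removes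
   one. *)
by apply: E2_ext (E2_skip (E2_skip Hh)) => w e /=.
Qed.

Definition fam (n : nat) (F : nat -> seq nfa) : seq nfa := flatten [seq F i | i <- iota 0 n].

Lemma GenA_fam n F : E2 n -> GenA (fun w e => F w (behead e) (nth 0 e 0)) ->
  GenA (fun w e => fam (n w e) (F w e)).
Proof.
move=> Hn HF; have := Gen_for (g := fun w e i => flatten (map enc_nfa (F w e i))) Hn HF.
by apply: Gen_ext => w e; rewrite /fam flatten_map_flatten -map_comp.
Qed.

Lemma GenA_cat F G : GenA F -> GenA G -> GenA (fun w e => F w e ++ G w e).
Proof.
move=> HF HG; apply: Gen_ext (Gen_cat HF HG) => w e; by rewrite map_cat flatten_cat.
Qed.

Lemma GenA_if p F : E2b p -> GenA F -> GenA (fun w e => if p w e then F w e else [::]).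
Proof.
move=> Hp HF; apply: Gen_ext (Gen_if Hp HF Gen_nil) => w e; by case: ifP.
Qed.

Lemma Forall_fam P n F : List.Forall P (fam n F) <-> forall i, i < n -> List.Forall P (F i).
Proof.
have H k : List.Forall P (flatten [seq F i | i <- iota k n]) <->
    forall i, k <= i < k + n -> List.Forall P (F i).
  elim: n k => [|n IH] k /=.
    by split=> // _ i; lia.
  have Hc s1 s2 : List.Forall P (s1 ++ s2) <-> List.Forall P s1 /\ List.Forall P s2.
    exact: List.Forall_app.
  rewrite Hc IH; split=> [[H1 H2] i Hi|H].
    by case: (ltngtP i k) => Hik; [lia|apply: H2; lia|rewrite Hik].
  by split=> [|i Hi]; apply: H; lia.
rewrite /fam H; split=> H' i Hi; apply: H'; lia.
Qed.

(** * Clauses as forbidden windows *)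

Lemma chain_path s want fin g x r : chain s want fin g (x :: r) =
  [&& ~~ (g && allmeet s want s x),
      path (fun x y => ~~ (allmeet s want 0 x && allmeet s want s y)) x r &
      ~~ (fin && allmeet s want 0 (last x r))].
Proof.
have E g' x' r' : chain s want fin g' (x' :: r') =
  ~~ (g' && allmeet s want s x') && chain s want fin (allmeet s want 0 x') r' by [].
by elim: r x g => [|y r IH] x g //; rewrite E IH /= -!andbA.
Qed.

Lemma allmeetP s want o x :
  reflect (forall i, i < s -> meets (want (o + i)) (nth false x i)) (allmeet s want o x).
Proof.
apply: (iffP allP) => H i; first by move=> Hi; apply: H; rewrite mem_iota.
by rewrite mem_iota => /andP [_ Hi]; apply: H.
Qed.

(** The forbidden window has all bits of [l] set and bit [e] of the next block unset: the clause is
    an implication from [l] now to [e] next. *)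
Definition want_step (s : nat) (l : seq nat) (e p : nat) : nat :=
  if p \in l then 1 else if p == s + e then 2 else 0.
(** Nothing is demanded of the first block of a window; with a virtual block in front, every block
    of the word is tested for having both bits. *)
Definition want_amo (s a b p : nat) : nat :=
  if (p == s + a) || (p == s + b) then 1 else 0.
(** The impossible demand 3 on the first block disables every window except the virtual one at the
    left end, so only the first block is tested. *)
Definition want_init (s e p : nat) : nat :=
  if p == 0 then 3 else if p == s + e then 2 else 0.
(** Here the impossible demand is on the second block, so only the virtual window at the right end
    counts: the last block must not avoid all accepting states. *)
Definition want_final (s : nat) (acc : seq nat) (p : nat) : nat :=
  if p == s then 3 else if nth 0 acc p == 1 then 2 else 0.

Section Wants.
Variable s : nat.
Hypothesis s0 : 0 < s.

Lemma want_stepE l e x y : (forall p, p \in l -> p < s) -> e < s ->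
  allmeet s (want_step s l e) 0 x && allmeet s (want_step s l e) s y =
  all (nth false x) l && ~~ nth false y e.
Proof.
move=> Hl He; apply/andP/andP => [[/allmeetP HX /allmeetP HY]|[/allP HX HY]]; split.
- apply/allP => p Hp; have := HX p (Hl p Hp); rewrite add0n /want_step Hp.
  by case: (nth _ _ _).
- have := HY e He; rewrite /want_step ifN ?eqxx; first by case: (nth _ _ _).
  by apply/negP => /Hl; lia.
- apply/allmeetP => i Hi; rewrite add0n /want_step; case: ifP => [/HX -> //|_].
  by rewrite ifN //; lia.
- apply/allmeetP => i Hi; rewrite /want_step ifN; last by apply/negP => /Hl; lia.
  by rewrite eqn_add2l; case: eqP => // ->; rewrite (negbTE HY).
Qed.

Lemma want_amoE a b x : a < s -> b < s ->
  allmeet s (want_amo s a b) 0 x = true /\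
  allmeet s (want_amo s a b) s x = nth false x a && nth false x b.
Proof.
move=> Ha Hb; split; first by apply/allmeetP => i Hi; rewrite /want_amo ifN //; lia.
apply/allmeetP/andP => [H|[H1 H2] i Hi].
  by split; [have := H a Ha|have := H b Hb]; rewrite /want_amo !eqxx ?orbT; case: (nth _ _ _).
rewrite /want_amo !eqn_add2l; case: eqP => [->|_]; first by rewrite H1.
by case: eqP => [->|_] //; rewrite H2.
Qed.

Lemma want_initE e x : e < s ->
  allmeet s (want_init s e) 0 x = false /\
  allmeet s (want_init s e) s x = ~~ nth false x e.
Proof.
move=> He; split; first by apply/negbTE/allmeetP => /(_ 0 s0).
apply/allmeetP/idP => [H|H i Hi].
  by have := H e He; rewrite /want_init ifN ?eqxx; [case: (nth _ _ _)|lia].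
rewrite /want_init ifN; last by lia.
by rewrite eqn_add2l; case: eqP => // ->; rewrite (negbTE H).
Qed.

Lemma want_finalE acc x : size acc <= s ->
  allmeet s (want_final s acc) s x = false /\
  allmeet s (want_final s acc) 0 x = ball (size acc) (fun p => (nth 0 acc p == 1) ==> ~~ nth false x p).
Proof.
move=> Hacc; split.
  by apply/negbTE/allmeetP => /(_ 0 s0); rewrite addn0 /want_final eqxx.
apply/allmeetP/allP => [H p|H i Hi].
  rewrite mem_iota add0n => /andP [_ Hp]; apply/implyP => E.
  have Hps : p < s by apply: leq_trans Hacc.
  have := H p Hps; rewrite add0n /want_final ifN ?E; last by lia.
  by case: (nth _ _ _).
rewrite add0n /want_final ifN; last by lia.
case: ifP => // E; have Hp : i < size acc.
  by rewrite ltnNge; apply/negP => Hp; rewrite nth_default in E.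
have := H i; rewrite mem_iota add0n Hp => /(_ isT); rewrite E /=.
by case: (nth _ _ _).
Qed.
End Wants.

(** * The computation of a machine as a system of clauses *)

Section Reduction.
Variables (M : TM) (c : nat).
Let Qn := #|tm_Q M|.
Let Gn := #|tm_G M|.

Definition code_st (q : tm_Q M) : nat := enum_rank q.
Definition code_cell (g : tm_G M) : nat := enum_rank g.
Definition st_of k := nth (tm_q0 M) (enum (tm_Q M)) k.
Definition cell_of k := nth (tm_blank M) (enum (tm_G M)) k.

Lemma qcK q : st_of (code_st q) = q. Proof. exact: nth_enum_rank. Qed.
Lemma gcK g : cell_of (code_cell g) = g. Proof. exact: nth_enum_rank. Qed.
Lemma qc_lt q : code_st q < Qn. Proof. exact: ltn_ord. Qed.
Lemma gc_lt g : code_cell g < Gn. Proof. exact: ltn_ord. Qed.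

Definition code_sym (o : option bool) : nat := match o with None => 0 | Some b => b.+1 end.
Definition sym_of (k : nat) : option bool := match k with 0 => None | 1 => Some false | _ => Some true end.
Definition code_move (m : move) : nat := match m with MoveL => 0 | MoveS => 1 | MoveR => 2 end.
Definition move_by (k p : nat) : nat := if k == 0 then p.-1 else if k == 1 then p else p.+1.

Lemma csK o : sym_of (code_sym o) = o. Proof. by case: o => [[]|]. Qed.
Lemma cs_lt o : code_sym o < 3. Proof. by case: o => [[]|]. Qed.
Lemma mvnE m p : move_by (code_move m) p = mv m p. Proof. by case: m. Qed.

Definition delta4 (q : tm_Q M) (o : option bool) (g : tm_G M) : tm_Q M * tm_G M * move * move :=
  if tm_halt M q then (q, g, MoveS, MoveS) else (tm_delta M q o g).1.

Definition idx (q o g : nat) := (q * 3 + o) * Gn + g.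
(** The machine is fixed, so each component of its transition function is a finite table, flattened
    by [idx]. *)
Definition tab (F : tm_Q M * tm_G M * move * move -> nat) : seq nat :=
  mkseq (fun k => F (delta4 (st_of (k %/ Gn %/ 3)) (sym_of (k %/ Gn %% 3)) (cell_of (k %% Gn)))) (Qn * 3 * Gn).

Lemma tabE F q o g : nth 0 (tab F) (idx (code_st q) (code_sym o) (code_cell g)) = F (delta4 q o g).
Proof.
have Hg := gc_lt g; have Hq := qc_lt q; have Ho := cs_lt o.
have G0 : 0 < Gn by apply: leq_ltn_trans Hg.
have E1 : idx (code_st q) (code_sym o) (code_cell g) %/ Gn = code_st q * 3 + code_sym o.
  by rewrite /idx divnMDl // divn_small // addn0.
have E2 : idx (code_st q) (code_sym o) (code_cell g) %% Gn = code_cell g.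
  by rewrite /idx modnMDl modn_small.
rewrite nth_mkseq.
  rewrite E1 E2 divnMDl // modnMDl (divn_small Ho) addn0 (modn_small Ho).
  by rewrite qcK csK gcK.
rewrite -ltn_divLR // E1; lia.
Qed.

Definition tabQ := tab (fun r => code_st r.1.1.1).
Definition tabG := tab (fun r => code_cell r.1.1.2).
Definition tabI := tab (fun r => code_move r.1.2).
Definition tabW := tab (fun r => code_move r.2).
Definition accQ := mkseq (fun k => nat_of_bool (tm_halt M (st_of k) && tm_acc M (st_of k))) Qn.

Lemma accQE q : nth 0 accQ (code_st q) = tm_halt M q && tm_acc M q.
Proof. by rewrite nth_mkseq ?qc_lt // qcK. Qed.

(* A configuration is a family of variables with values below [dom_size]: 0 is
   the state, 1 and 2 the head positions, [j + 3] the content of cell [j].  Its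
   block is one-hot: bit [pos w v d] says that variable [v] has value [d]. *)
Definition space (w : seq bool) := c * size w ^ c + c.
Definition dom_size (w : seq bool) := Qn + Gn + (size w).+2 + space w.
Definition var_count (w : seq bool) := (space w).+3.
Definition blk_size (w : seq bool) := var_count w * dom_size w.
Definition pos (w : seq bool) v d := v * dom_size w + d.
Definition read_code (w : seq bool) i := if i == 0 then 0 else inp w i.-1.

Lemma rsE w i : read_code w i = code_sym (read_input w i).
Proof. by case: i. Qed.

(** A step affects four variables, numbered by [r]: the state, the two head positions and the
    scanned cell [j]. *)
Definition tgt_var (j r : nat) := if r == 3 then j.+3 else r.
Definition tgt_val w q i j g r :=
  if r == 0 then nth 0 tabQ (idx q (read_code w i) g)
  else if r == 1 then minn (move_by (nth 0 tabI (idx q (read_code w i) g)) i) (size w).+1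
  else if r == 2 then move_by (nth 0 tabW (idx q (read_code w i) g)) j
  else nth 0 tabG (idx q (read_code w i) g).
Definition init_val (v : nat) := if v == 0 then code_st (tm_q0 M) else if v < 3 then 0 else code_cell (tm_blank M).

Definition want_next w q i j g r :=
  want_step (blk_size w) [:: pos w 0 q; pos w 1 i; pos w 2 j; pos w j.+3 g]
    (pos w (tgt_var j r) (tgt_val w q i j g r)).
Definition want_keep w j0 j g := want_step (blk_size w) [:: pos w 2 j0; pos w j.+3 g] (pos w j.+3 g).
Definition want_uniq w v d d' := want_amo (blk_size w) (pos w v d) (pos w v d').
Definition want_start w v := want_init (blk_size w) (pos w v (init_val v)).
Definition want_acc w := want_final (blk_size w) accQ.

Definition step_auts w := fam Qn (fun q => fam (size w).+2 (fun i => fam (space w) (fun j =>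
  fam Gn (fun g => fam 4 (fun r => [:: cnfa (blk_size w) (want_next w q i j g r) false false]))))).
Definition keep_auts w := fam (space w) (fun j0 => fam (space w) (fun j => fam Gn (fun g =>
  if j0 != j then [:: cnfa (blk_size w) (want_keep w j0 j g) false false] else [::]))).
Definition uniq_auts w := fam (var_count w) (fun v => fam (dom_size w) (fun d => fam d (fun d' =>
  [:: cnfa (blk_size w) (want_uniq w v d d') true false]))).
Definition init_auts w := fam (var_count w) (fun v => [:: cnfa (blk_size w) (want_start w v) true false]).
(** With [g0] and [fin] both true the empty word is rejected, its two virtual blocks being adjacent.
    On a nonempty word the left virtual window is harmless because of the demand 3 on second
    blocks. *)
Definition final_auts w := [:: cnfa (blk_size w) (want_acc w) true true].
Definition red_inst w := Inst 2 (step_auts w ++ (keep_auts w ++ (uniq_auts w ++ (init_auts w ++ final_auts w)))).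
Definition red w := enc_inst (red_inst w).

Ltac e2r := repeat first [e2step | progress rewrite /want_next /want_keep /want_uniq /want_start /want_acc /want_step
    /want_amo /want_init /want_final ?in_cons ?in_nil
  | progress rewrite /tgt_val /tgt_var /init_val | progress rewrite /idx | progress rewrite /move_by
  | progress rewrite /pos | progress rewrite /read_code | progress rewrite /blk_size | progress rewrite /var_count
  | progress rewrite /dom_size | progress rewrite /space].

Lemma Gen_red : Gen (fun w _ => red w).
Proof.
suff H : GenA (fun w _ => i_auts (red_inst w)).
  exact: (Gen_cat (Gen_const (enc_nat 2)) (Gen_cat H (Gen_const [:: true; true]))).
apply: GenA_cat.
  do 5 (apply: GenA_fam; [by e2r|]).
  by apply: GenA_cnfa; e2r.
apply: GenA_cat.
  do 3 (apply: GenA_fam; [by e2r|]).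
  by apply: GenA_if; [e2r|apply: GenA_cnfa; e2r].
apply: GenA_cat.
  do 3 (apply: GenA_fam; [by e2r|]).
  by apply: GenA_cnfa; e2r.
apply: GenA_cat.
  by apply: GenA_fam; [e2r|apply: GenA_cnfa; e2r].
apply: GenA_cnfa; e2r; apply: E2_table; e2var.
Qed.
Definition cfg_val (cf : config M) (v : nat) : nat :=
  match v with
  | 0 => code_st (c_q M cf)
  | 1 => c_ipos M cf
  | 2 => c_wpos M cf
  | j.+3 => code_cell (c_tape M cf j)
  end.

Lemma step4 w cf : c_ipos M cf <= (size w).+1 ->
  let: (q', g', mi, mw) := delta4 (c_q M cf) (read_input w (c_ipos M cf)) (c_tape M cf (c_wpos M cf)) in
  [/\ c_q M (tm_step M w cf) = q',
      c_ipos M (tm_step M w cf) = minn (mv mi (c_ipos M cf)) (size w).+1,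
      c_wpos M (tm_step M w cf) = mv mw (c_wpos M cf) &
      forall j, c_tape M (tm_step M w cf) j = if j == c_wpos M cf then g' else c_tape M cf j].
Proof.
move=> Hi; rewrite /delta4 /tm_step; case: ifP => _.
  by split=> //= [|j]; [rewrite (minn_idPl Hi)|case: eqP => [->|]].
by case: (tm_delta _ _ _ _) => [[[[q' g'] mi] mw] o] /=.
Qed.

Lemma ipos_le w t : c_ipos M (tm_run M w t) <= (size w).+1.
Proof.
elim: t => [|t IH] //; have := step4 IH; rewrite /tm_run iterS -/(tm_run M w t).
by case: (delta4 _ _ _) => [[[q' g'] mi] mw] [_ -> _ _]; apply: geq_minr.
Qed.

Section Word.
Variable w : seq bool.
Hypothesis Hsp : forall t, c_wpos M (tm_run M w t) < space w.
Let D := dom_size w.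
Let s := blk_size w.

Lemma Dw_gt0 : 0 < D. Proof. by rewrite /D /dom_size; lia. Qed.

Lemma pos_lt v d : v < var_count w -> d < D -> pos w v d < s.
Proof.
move=> Hv Hd; apply: (@leq_trans (v.+1 * D)); last by rewrite leq_mul2r Hv orbT.
by rewrite /pos -/D mulSn addnC ltn_add2r.
Qed.

Lemma sw_gt0 : 0 < s. Proof. by rewrite /s /blk_size muln_gt0 /= Dw_gt0. Qed.

Lemma pos_div v d : d < D -> pos w v d %/ D = v.
Proof. by move=> Hd; rewrite divnMDl ?Dw_gt0 // divn_small // addn0. Qed.

Lemma pos_mod v d : d < D -> pos w v d %% D = d.
Proof. by move=> Hd; rewrite modnMDl modn_small. Qed.

Lemma cv_lt t v : cfg_val (tm_run M w t) v < D.
Proof.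
rewrite /D /dom_size /cfg_val; case: v => [|[|[|j]]].
- have := qc_lt (c_q M (tm_run M w t)); rewrite -/Qn; lia.
- have := ipos_le w t; lia.
- have := Hsp t; lia.
- have := gc_lt (c_tape M (tm_run M w t) j); rewrite -/Gn; lia.
Qed.

Lemma tab_lt F B k : 0 < B -> (forall x, F x < B) -> nth 0 (tab F) k < B.
Proof.
move=> HB HF; case: (ltnP k (size (tab F))) => Hk; last by rewrite nth_default.
by rewrite nth_mkseq; last by move: Hk; rewrite size_mkseq.
Qed.

Lemma td_lt q i j g r : j < space w -> tgt_val w q i j g r < D.
Proof.
have Q0 : 0 < Qn by apply: leq_ltn_trans (qc_lt (tm_q0 M)).
have G0 : 0 < Gn by apply: leq_ltn_trans (gc_lt (tm_blank M)).
move=> Hj; rewrite /tgt_val /D /dom_size.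
case: ifP => _; first by have := @tab_lt (fun r => code_st r.1.1.1) Qn (idx q (read_code w i) g) Q0 (fun x => qc_lt _); rewrite -/tabQ; lia.
case: ifP => _; first by have := geq_minr (move_by (nth 0 tabI (idx q (read_code w i) g)) i) (size w).+1; lia.
case: ifP => _; first by rewrite /move_by; case: ifP => _; [lia|case: ifP => _; lia].
by have := @tab_lt (fun r => code_cell r.1.1.2) Gn (idx q (read_code w i) g) G0 (fun x => gc_lt _); rewrite -/tabG; lia.
Qed.

Lemma tv_lt j r : j < space w -> r < 4 -> tgt_var j r < var_count w.
Proof. by move=> Hj Hr; rewrite /tgt_var /var_count; case: eqP => // H; lia. Qed.

Lemma iv_cv v : init_val v = cfg_val (tm_run M w 0) v.
Proof. by case: v => [|[|[|j]]]. Qed.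

Lemma premT q i j g : q < Qn -> i < (size w).+2 -> j < space w -> g < Gn ->
  forall p, p \in [:: pos w 0 q; pos w 1 i; pos w 2 j; pos w j.+3 g] -> p < s.
Proof.
move=> Hq Hi Hj Hg p; rewrite !inE => /or4P [] /eqP ->; apply: pos_lt; rewrite /var_count /D /dom_size; lia.
Qed.

Lemma premK j0 j g : j0 < space w -> j < space w -> g < Gn ->
  forall p, p \in [:: pos w 2 j0; pos w j.+3 g] -> p < s.
Proof.
by move=> Hj0 Hj Hg p; rewrite !inE => /orP [] /eqP ->; apply: pos_lt; rewrite /var_count /D /dom_size; lia.
Qed.

(* The transition clauses, instantiated at the actual state, input symbol and
   tape symbol of a configuration, prescribe the next configuration. *)
Lemma td_run t r : r < 4 ->
  let cf := tm_run M w t in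
  tgt_val w (cfg_val cf 0) (cfg_val cf 1) (cfg_val cf 2) (cfg_val cf (cfg_val cf 2).+3) r =
  cfg_val (tm_run M w t.+1) (tgt_var (cfg_val cf 2) r).
Proof.
move=> Hr cf; have -> : tm_run M w t.+1 = tm_step M w cf by [].
have := step4 (ipos_le w t); rewrite -/cf /tgt_val rsE [cfg_val cf 0]/= [cfg_val cf 1]/= [cfg_val cf 2]/= [cfg_val cf _.+3]/=.
move: cf => cf; rewrite /tabQ /tabI /tabW /tabG !tabE.
case: (delta4 _ _ _) => [[[q' g'] mi] mw] [E1 E2 E3 E4].
rewrite /tgt_var !mvnE; case: r Hr => [|[|[|[|]]]] //= _; rewrite ?E1 ?E2 ?E3 //.
by rewrite E4 eqxx.
Qed.

Definition run_clauses (xs : seq (seq bool)) : Prop :=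
  [/\ forall q i j g r, q < Qn -> i < (size w).+2 -> j < space w -> g < Gn -> r < 4 ->
         chain s (want_next w q i j g r) false false xs,
      forall j0 j g, j0 < space w -> j < space w -> g < Gn -> j0 != j ->
         chain s (want_keep w j0 j g) false false xs,
      forall v d d', v < var_count w -> d < D -> d' < d -> chain s (want_uniq w v d d') false true xs,
      forall v, v < var_count w -> chain s (want_start w v) false true xs &
      chain s (want_acc w) true true xs].

Lemma accQ_size : size accQ <= s.
Proof.
rewrite size_mkseq; apply: (@leq_trans (1 * D)); first by rewrite mul1n /D /dom_size -/Qn; lia.
by rewrite leq_mul2r orbT.
Qed.

(** By induction, block [t] encodes the configuration after [t] steps: the start, step and keep
    clauses force the correct bit of every variable, and the uniqueness clauses exclude all its
    other bits. The last block then shows an accepting state. *)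
Lemma Cond_sound xs : run_clauses xs -> tm_accepts M w.
Proof.
have S0 : 0 < space w by apply: leq_ltn_trans (Hsp 0).
case: xs => [|x0 r]; first by case.
move=> [HT HK HU HI HF]; pose X t := nth [::] (x0 :: r) t.
have HX t : X t.+1 = nth [::] r t by [].
have Uq t v d d' : t <= size r -> v < var_count w -> d < D -> d' < d ->
    ~~ (nth false (X t) (pos w v d) && nth false (X t) (pos w v d')).
  move=> Ht Hv Hd Hd'; have := HU v d d' Hv Hd Hd'; rewrite chain_path.
  have A x := @want_amoE s sw_gt0 (pos w v d) (pos w v d') x (pos_lt Hv Hd) (pos_lt Hv (ltn_trans Hd' Hd)).
  rewrite /want_uniq (A x0).2 => /and3P [H1 H2 _]; case: t Ht => [//|t Ht].
  by move/(pathP [::])/(_ t Ht): H2; rewrite (A _).1 (A _).2 /= HX.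
have good t : t <= size r -> (forall v, v < var_count w -> nth false (X t) (pos w v (cfg_val (tm_run M w t) v))) ->
    forall v d, v < var_count w -> d < D -> nth false (X t) (pos w v d) = (cfg_val (tm_run M w t) v == d).
  move=> Ht H v d Hv Hd; have H1 := H v Hv; have Hc := cv_lt t v.
  case: (ltngtP (cfg_val (tm_run M w t) v) d) => Hcd; last by rewrite -Hcd H1.
    by have := Uq t v _ _ Ht Hv Hd Hcd; rewrite H1 andbT => /negbTE.
  by have := Uq t v _ _ Ht Hv Hc Hcd; rewrite H1 => /negbTE.
have Hpos t : t <= size r -> forall v, v < var_count w -> nth false (X t) (pos w v (cfg_val (tm_run M w t) v)).
  elim: t => [|t IH] Ht v Hv.
    have Hp : pos w v (init_val v) < s by apply: pos_lt; rewrite // iv_cv cv_lt.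
    have := HI v Hv; rewrite chain_path /want_start => /and3P [+ _ _].
    by rewrite (want_initE sw_gt0 x0 Hp).2 negbK iv_cv.
  set cf := tm_run M w t; have G := good t (ltnW Ht) (IH (ltnW Ht)).
  have Hq : cfg_val cf 0 < Qn by apply: qc_lt.
  have Hi : cfg_val cf 1 < (size w).+2 by apply: ipos_le.
  have Hj : cfg_val cf 2 < space w by apply: Hsp.
  have Hgj j : cfg_val cf j.+3 < Gn by apply: gc_lt.
  have Tr r1 : r1 < 4 -> nth false (X t.+1) (pos w (tgt_var (cfg_val cf 2) r1) (cfg_val (tm_run M w t.+1) (tgt_var (cfg_val cf 2) r1))).
    move=> Hr1; have := HT _ _ _ _ r1 Hq Hi Hj (Hgj (cfg_val cf 2)) Hr1.
    rewrite chain_path => /and3P [_ /(pathP [::])/(_ t Ht) + _].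
    rewrite /want_next (want_stepE sw_gt0); last 2 first.
    - exact: premT.
    - by apply: pos_lt; [apply: tv_lt|apply: td_lt].
    rewrite td_run // negb_and negbK -HX => /orP [/allPn [p]|//].
    rewrite -/(X t) !inE => /or4P [] /eqP ->; rewrite G ?eqxx //; try exact: cv_lt;
      by rewrite /var_count; lia.
  case: v Hv => [|[|[|j]]] Hv; [exact: (Tr 0)|exact: (Tr 1)|exact: (Tr 2)|].
  case: (eqVneq (cfg_val cf 2) j) => [Ej|Hne]; first by have := Tr 3 isT; rewrite Ej.
  have Hjj : j < space w by move: Hv; rewrite /var_count.
  have Ecv : cfg_val (tm_run M w t.+1) j.+3 = cfg_val cf j.+3.
    have -> : tm_run M w t.+1 = tm_step M w cf by [].
    have := step4 (ipos_le w t); rewrite -/cf /cfg_val.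
    case: (delta4 _ _ _) => [[[q' g'] mi] mw] [_ _ _ ->].
    by rewrite ifN // eq_sym.
  have := HK _ _ _ Hj Hjj (Hgj j) Hne.
  rewrite chain_path => /and3P [_ /(pathP [::])/(_ t Ht) + _].
  rewrite /want_keep (want_stepE sw_gt0); last 2 first.
  - exact: premK.
  - by apply: pos_lt => //; apply: cv_lt.
  rewrite Ecv negb_and negbK -HX => /orP [/allPn [p]|//].
  by rewrite -/(X t) !inE => /orP [] /eqP ->; rewrite G ?eqxx //; apply: cv_lt.
have Glast := good (size r) (leqnn _) (Hpos _ (leqnn _)).
move: HF; rewrite chain_path => /and3P [_ _].
rewrite /want_acc (want_finalE sw_gt0 _ accQ_size).2.
have -> : last x0 r = X (size r) by rewrite /X -[size r]/(size (x0 :: r)).-1 nth_last.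
move=> /allPn [p]; rewrite mem_iota add0n => /andP [_ Hp].
rewrite negb_imply negbK => /andP [Ha Hb].
have HpQ : p < Qn by move: Hp; rewrite size_mkseq.
have HpD : p < D by rewrite /D /dom_size -/Qn; lia.
have := Glast 0 p isT HpD; rewrite /pos mul0n add0n Hb => /esym /eqP Ep.
exists (size r); move: Ha; rewrite -Ep accQE; by case: (_ && _).
Qed.

Definition bitsC (cf : config M) : seq bool :=
  mkseq (fun p => cfg_val cf (p %/ D) == p %% D) s.

Lemma bitsCE cf v d : v < var_count w -> d < D -> nth false (bitsC cf) (pos w v d) = (cfg_val cf v == d).
Proof. by move=> Hv Hd; rewrite nth_mkseq ?pos_lt // pos_div // pos_mod. Qed.

Lemma Cond_complete t : tm_halt M (c_q M (tm_run M w t)) && tm_acc M (c_q M (tm_run M w t)) ->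
  run_clauses [seq bitsC (tm_run M w i) | i <- iota 0 t.+1].
Proof.
move=> Hacc; set x0 := bitsC (tm_run M w 0); pose r := [seq bitsC (tm_run M w i) | i <- iota 1 t].
rewrite [[seq _ | _ <- _]]/= -/x0 -/r.
have Hsz : size r = t by rewrite size_map size_iota.
have Hx i : i <= t -> nth [::] (x0 :: r) i = bitsC (tm_run M w i).
  by case: i => [//|i] Hi; rewrite /= (nth_map 0) ?size_iota // nth_iota.
have Hpath (e : rel (seq bool)) : (forall i, i < t -> e (bitsC (tm_run M w i)) (bitsC (tm_run M w i.+1))) -> path e x0 r.
  move=> H; apply/(pathP [::]) => i; rewrite Hsz => Hi.
  rewrite Hx ?(ltnW Hi) // -[nth _ r i]/(nth [::] (x0 :: r) i.+1) Hx //; exact: H.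
split.
- move=> q i j g r1 Hq Hi Hj Hg Hr1; rewrite chain_path /= andbT; apply: Hpath => k Hk.
  rewrite /want_next (want_stepE sw_gt0); last 2 first.
  + exact: premT.
  + by apply: pos_lt; [apply: tv_lt|apply: td_lt].
  apply/negP => /andP [/allP HX]; apply/negP; rewrite negbK.
  have L v d : v < var_count w -> d < D -> pos w v d \in [:: pos w 0 q; pos w 1 i; pos w 2 j; pos w j.+3 g] ->
      cfg_val (tm_run M w k) v = d.
    by move=> Hv Hd /HX; rewrite bitsCE // => /eqP.
  have E0 : cfg_val (tm_run M w k) 0 = q by apply: L; rewrite ?inE ?eqxx // /D /dom_size; lia.
  have E1 : cfg_val (tm_run M w k) 1 = i by apply: L; rewrite ?inE ?eqxx ?orbT // /D /dom_size; lia.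
  have E2 : cfg_val (tm_run M w k) 2 = j by apply: L; rewrite ?inE ?eqxx ?orbT // /D /dom_size; lia.
  have E3 : cfg_val (tm_run M w k) j.+3 = g by apply: L; rewrite ?inE ?eqxx ?orbT // /D /dom_size; lia.
  rewrite bitsCE ?tv_lt ?td_lt //.
  by have := td_run k Hr1; rewrite /= -/(cfg_val _ 0) -/(cfg_val _ 1) -/(cfg_val _ 2) -/(cfg_val _ _.+3) E0 E1 E2 E3 => ->.
- move=> j0 j g Hj0 Hj Hg Hne; rewrite chain_path /= andbT; apply: Hpath => k Hk.
  have HgD : g < D by rewrite /D /dom_size; lia.
  rewrite /want_keep (want_stepE sw_gt0); last 2 first.
  + exact: premK.
  + exact: pos_lt.
  apply/negP => /andP [/allP HX]; apply/negP; rewrite negbK.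
  have E2 : c_wpos M (tm_run M w k) = j0.
    have := HX (pos w 2 j0); rewrite mem_head bitsCE //; last by rewrite /D /dom_size; lia.
    by move=> /(_ isT) /eqP.
  have E3 : cfg_val (tm_run M w k) j.+3 = g.
    have := HX (pos w j.+3 g); rewrite !inE eqxx orbT bitsCE //.
    by move=> /(_ isT) /eqP.
  rewrite bitsCE // -E3; have -> : tm_run M w k.+1 = tm_step M w (tm_run M w k) by [].
  have := step4 (ipos_le w k); rewrite /cfg_val.
  case: (delta4 _ _ _) => [[[q' g'] mi] mw] [_ _ _ ->].
  by rewrite E2 ifN // eq_sym.
- move=> v d d' Hv Hd Hd'; have Hd2 := ltn_trans Hd' Hd.
  have A x := @want_amoE s sw_gt0 (pos w v d) (pos w v d') x (pos_lt Hv Hd) (pos_lt Hv Hd2).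
  have B i : ~~ (nth false (bitsC (tm_run M w i)) (pos w v d) && nth false (bitsC (tm_run M w i)) (pos w v d')).
    rewrite !bitsCE //; apply/negP => /andP [/eqP E1 /eqP E2]; lia.
  rewrite chain_path /want_uniq (A x0).2 /= B andbT /=; apply: Hpath => i Hi.
  by rewrite (A _).1 (A _).2 andTb; apply: B.
- move=> v Hv; have Hp : pos w v (init_val v) < s by apply: pos_lt; rewrite // iv_cv cv_lt.
  have A x := @want_initE s sw_gt0 (pos w v (init_val v)) x Hp.
  have Hb : nth false x0 (pos w v (init_val v)) by rewrite iv_cv bitsCE ?cv_lt.
  rewrite chain_path /want_start (A x0).2 Hb /= andbT.
  by apply: Hpath => i Hi; rewrite (A _).1.
- have A x := @want_finalE s sw_gt0 accQ x accQ_size.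
  rewrite chain_path /want_acc (A x0).1 (A _).2 /=; apply/andP; split.
    by apply: Hpath => i Hi; rewrite (A _).1 andbF.
  have -> : last x0 r = bitsC (tm_run M w t).
    by rewrite -(Hx t (leqnn t)) -[X in nth _ _ X]Hsz -[size r]/(size (x0 :: r)).-1 nth_last.
  have Hq := qc_lt (c_q M (tm_run M w t)).
  apply/allPn; exists (code_st (c_q M (tm_run M w t))); first by rewrite mem_iota size_mkseq.
  have := @bitsCE (tm_run M w t) 0 (code_st (c_q M (tm_run M w t))) isT (cv_lt t 0).
  by rewrite /pos mul0n add0n accQE Hacc /= eqxx => ->.
Qed.

(** Stated for an arbitrary [R], since it serves both for acceptance of a word and for the promise
    on the automata. *)
Lemma Forall_auts (R : nfa -> Prop) : List.Forall R (i_auts (red_inst w)) <->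
  [/\ forall q i j g r, q < Qn -> i < (size w).+2 -> j < space w -> g < Gn -> r < 4 ->
         R (cnfa s (want_next w q i j g r) false false),
      forall j0 j g, j0 < space w -> j < space w -> g < Gn -> j0 != j ->
         R (cnfa s (want_keep w j0 j g) false false),
      forall v d d', v < var_count w -> d < D -> d' < d -> R (cnfa s (want_uniq w v d d') true false),
      forall v, v < var_count w -> R (cnfa s (want_start w v) true false) &
      R (cnfa s (want_acc w) true true)].
Proof.
have H1 B : List.Forall R [:: B] <-> R B.
  by split=> [H|H]; first (by inversion H); constructor.
have -> : i_auts (red_inst w) = step_auts w ++ (keep_auts w ++ (uniq_auts w ++ (init_auts w ++ final_auts w))) by [].
rewrite (List.Forall_app R (step_auts w)) (List.Forall_app R (keep_auts w)) (List.Forall_app R (uniq_auts w)) (List.Forall_app R (init_auts w)).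
split.
  move=> [HT [HK [HU [HI HF]]]]; split.
  - move=> q i j g r Hq Hi Hj Hg Hr; apply/H1.
    move: HT => /Forall_fam/(_ q Hq)/Forall_fam/(_ i Hi)/Forall_fam/(_ j Hj).
    by move=> /Forall_fam/(_ g Hg)/Forall_fam/(_ r Hr).
  - move=> j0 j g Hj0 Hj Hg Hne; apply/H1.
    by move: HK => /Forall_fam/(_ j0 Hj0)/Forall_fam/(_ j Hj)/Forall_fam/(_ g Hg); rewrite Hne.
  - move=> v d d' Hv Hd Hd'; apply/H1.
    by move: HU => /Forall_fam/(_ v Hv)/Forall_fam/(_ d Hd)/Forall_fam/(_ d' Hd').
  - by move=> v Hv; apply/H1; move: HI => /Forall_fam/(_ v Hv).
  - exact/H1.
move=> [HT HK HU HI HF]; split; [|split; [|split; [|split]]].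
- apply/Forall_fam => q Hq; apply/Forall_fam => i Hi; apply/Forall_fam => j Hj.
  by apply/Forall_fam => g Hg; apply/Forall_fam => r Hr; apply/H1; apply: HT.
- apply/Forall_fam => j0 Hj0; apply/Forall_fam => j Hj; apply/Forall_fam => g Hg.
  by case: ifP => Hne; [apply/H1; apply: HK|constructor].
- apply/Forall_fam => v Hv; apply/Forall_fam => d Hd; apply/Forall_fam => d' Hd'.
  by apply/H1; apply: HU.
- by apply/Forall_fam => v Hv; apply/H1; apply: HI.
- exact/H1.
Qed.

Lemma red_correct : inter_nonempty (red_inst w) <-> tm_accepts M w.
Proof.
have Hw2 (wd : seq 'I_2) : all (fun a => a < 2) (map (@nat_of_ord 2) wd).
  by rewrite all_map; apply/allP => i _; apply: ltn_ord.
have HA want g0 fin (wd : seq 'I_2) := @cnfa_chain s want g0 fin sw_gt0 _ (Hw2 wd).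
split=> [[wd /Forall_auts [HT HK HU HI HF]]|[t Ht]].
  have [xs [Hxs Exs HcF]] := proj1 (HA _ _ _ wd) HF.
  have K want g0 fin : nfa_lang (cnfa s want g0 fin) wd -> chain s want fin g0 xs.
    move/(HA _ _ _ wd) => [ys [Hys Eys Hc]].
    by rewrite (blk_inj Hxs Hys) // -Exs.
  apply: (@Cond_sound xs); split=> //.
  - by move=> q i j g r Hq Hi Hj Hg Hr; apply: K; apply: HT.
  - by move=> j0 j g Hj0 Hj Hg Hne; apply: K; apply: HK.
  - by move=> v d d' Hv Hd Hd'; apply: K; apply: HU.
  - by move=> v Hv; apply: K; apply: HI.
have [HT HK HU HI HF] := Cond_complete Ht.
set xs := [seq _ | _ <- _] in HT HK HU HI HF.
have Hxs : all (fun x => size x == s) xs.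
  by rewrite all_map; apply/allP => i _ /=; rewrite size_mkseq.
pose wd := [seq (inord a : 'I_2) | a <- flatten (map blk xs)].
have Ewd : map (@nat_of_ord 2) wd = flatten (map blk xs).
  rewrite -map_comp -[RHS]map_id; apply/eq_in_map => a /flattenP [l /mapP [x _ ->]] Ha /=.
  rewrite inordK //; move: Ha; rewrite !inE => /or3P [/eqP ->|/eqP ->|] //.
  by move=> /flattenP [l' /mapP [b _ ->]]; rewrite !inE => /orP [] /eqP -> //; case: b.
have K want g0 fin : chain s want fin g0 xs -> nfa_lang (cnfa s want g0 fin) wd.
  by move=> Hc; apply/(HA _ _ _ wd); exists xs; split.
exists wd; apply/Forall_auts; split; last exact: K.
- by move=> q i j g r Hq Hi Hj Hg Hr; apply: K; apply: HT.
- by move=> j0 j g Hj0 Hj Hg Hne; apply: K; apply: HK.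
- by move=> v d d' Hv Hd Hd'; apply: K; apply: HU.
- by move=> v Hv; apply: K; apply: HI.
Qed.

Lemma red_ok det bin (C : forall Sigma : Type, lclass Sigma) :
  (forall L : lang 'I_2, DD 1 L -> C 'I_2 L) -> inst_ok det bin C (red_inst w).
Proof.
move=> HC; split=> //; have H want g0 fin : (if det then is_dfa 2 (cnfa s want g0 fin) else
    nfa_wf 2 (cnfa s want g0 fin)) /\ C 'I_2 (@nfa_lang 2 (cnfa s want g0 fin)).
  split; last by apply: HC; apply: cnfa_DD1; apply: sw_gt0.
  have Hd := cnfa_dfa want g0 fin sw_gt0; case: det => //.
  by case/and3P: Hd.
by apply/Forall_auts; split=> *; apply: H.
Qed.
End Word.
End Reduction.

Theorem INE_hard det bin (C : forall Sigma : Type, lclass Sigma) :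
  (forall L : lang 'I_2, DD 1 L -> C 'I_2 L) -> PSPACE_hard (INE det bin C).
Proof.
move=> HC L [M [c [Hsp Hdec]]]; exists (red M c); split.
  exact: (Gen_logspace (Gen_red M c)).
move=> w; have Hspw t : c_wpos M (tm_run M w t) < space c w by apply: Hsp.
have [_ [HL HnL]] := Hdec w; have Hok := red_ok M c w det bin HC.
split=> H; exists (red_inst M c w); split=> //; split=> //.
  by apply/(red_correct Hspw); apply: HL.
move/(red_correct Hspw) => [t /andP [Hh Ha]].
have [t' /andP [Hh' Ha']] := HnL H.
(* Acceptance and rejection exclude each other: from the earlier of the two halting times on, the
   configuration no longer changes. *)
case: (leqP t t') => Ht.
  by move: Ha'; rewrite (tm_run_halted Hh Ht) Ha.
by move: Ha; rewrite (tm_run_halted Hh' (ltnW Ht)) (negbTE Ha').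
Qed.

Theorem theorem22 :
  forall det bin : bool,
    PSPACE_complete (INE det bin (DD 1)) /\
    PSPACE_complete (INE det bin (ST 2)).
Proof.
move=> det bin; split; split; try exact: INE_in_PSPACE; apply: INE_hard => //.
exact: DD1_ST2.
Qed.
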